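(* Let $M$ be a manifold of dimension $n\ge2$ endowed with a (classical) Finsler metric $\hat F:TM\to\mathbb R$ with indicatrix $\hat\Sigma=\hat F^{-1}(1)$ and a non-vanishing 1-form $\omega$ such that, at each point $p\in M$, the intersection $\hat\Sigma_p\cap\omega_p^{-1}(1)$ (where $\hat\Sigma_p=\hat\Sigma\cap T_pM$) is non-empty and transverse. Then $L:\bar A\to\mathbb R$ defined as $$L(v):=\omega(v)^2-\hat F(v)^2\qquad\forall v\in\bar A:=\{w\in TM\setminus\mathbf 0:\ \omega(w)\ge\hat F(w)\}$$ is a Lorentz-Finsler metric with cone domain $A$ equal to the interior of $\bar A$. Moreover, the cone structure $\mathcal C$ of $L$ can be described by a cone triple $(\Omega,T,F)$ with $\Omega=\omega$, $T$ any vector field in $\omega^{-1}(1)\cap A$, and $F$ the Finsler metric on $\ker\Omega$ with indicatrix $(\hat\Sigma\cap\omega^{-1}(1))-T$ (i.e., the pointwise translation by $-T$ of $\hat\Sigma\cap\omega^{-1}(1)\subset TM$).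
   Context: ''Smooth'' means $C^\infty$; $\mathbf 0$ is the zero section of $TM$. Finsler metric on a vector bundle $E\to M$ (e.g. $E=TM$): a continuous function $F:E\to[0,\infty)$, positive and smooth away from the zero section, with $F(\lambda v)=\lambda F(v)$ for $\lambda>0$, such that the fundamental tensor $\frac12\frac{\partial^2}{\partial r\partial s}F^2(v+ru+sw)|_{r=s=0}$ is positive definite for all $v\neq0$. Its indicatrix is $F^{-1}(1)$. Lorentz-Finsler metric with cone domain $A$: let $A\subset TM\setminus\mathbf 0$ be open with each $A_p=A\cap T_pM$ nonempty, connected and conic (invariant under multiplication by $\lambda>0$), such that the closure $\bar A$ of $A$ in $TM\setminus\mathbf 0$ is an embedded smooth manifold with boundary, $\mathcal C$ being the boundary (called the cone structure of $L$). A smooth positively 2-homogeneous function $L:A\to(0,\infty)$ which extends smoothly as zero to $\mathcal C$ is a Lorentz-Finsler metric if for each $p$ the boundary of $A_p$ in $T_pM\setminus\{0\}$ is smooth (the closure $\bar A_p$ of $A_p$ in $T_pM\setminus\{0\}$ is a smooth manifold with boundary) and the fundamental tensor $g_v(u,w)=\frac12\frac{\partial^2}{\partial r\partial s}L(v+ru+sw)|_{r=s=0}$ of the extension of $L|_{A_p}$ is non-degenerate on $\bar A_p$ with index $n-1$ (signature $(+,-,\dots,-)$). Cone triple $(\Omega,T,F)$: a non-vanishing 1-form $\Omega$, a vector field $T$ with $\Omega(T)\equiv1$ and a Finsler metric $F$ on the bundle $\ker\Omega$; it describes the cone structure $\mathcal C=\{F(w_p)T_p+w_p:\ w_p\in\ker\Omega_p\setminus\{0\},\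 p\in M\}$. *)

(* Defs.v *)
From HB Require Import structures.
From mathcomp Require Import all_boot all_order all_algebra.
From mathcomp Require Import all_classical all_reals all_analysis.

Set Implicit Arguments.
Unset Strict Implicit.
Unset Printing Implicit Defensive.
Import Order.TTheory GRing.Theory Num.Theory.
Import numFieldNormedType.Exports.
Local Open Scope classical_set_scope.
Local Open Scope ring_scope.

Section NormedSpaces.
Context {R : realType}.
Implicit Types V W : normedModType R.

(* Used on open U in a finite-dimensional V, where continuity of all the
   directional derivatives is the usual notion of C^k. *)
Fixpoint Ck_on {V W} (k : nat) (U : set V) (f : V -> W) : Prop :=
  match k with
  | 0%N => forall x, U x -> {for x, continuous f}
  | k'.+1 => (forall x, U x -> differentiable f x) /\
             (forall v : V, Ck_on k' U (fun x => 'D_v f x))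
  end.

Definition smooth_on {V W} (U : set V) (f : V -> W) : Prop :=
  forall k, Ck_on k U f.

Definition local_extension {V W} (S : set V) (f : V -> W) (x : V)
    (O : set V) (g : V -> W) : Prop :=
  [/\ open O, O x, smooth_on O g & forall y, (S `&` O) y -> g y = f y].

(* Smoothness on an arbitrary subset: f is locally the restriction of smooth
   functions.  It applies to submanifolds, with or without boundary, and agrees
   with smooth_on when S is open. *)
Definition smooth_on_subset {V W} (S : set V) (f : V -> W) : Prop :=
  forall x, S x -> exists O g, local_extension S f x O g.

Definition diffeo_on {V} (O : set V) (phi psi : V -> V) : Prop :=
  [/\ open O, open (phi @` O), smooth_on O phi, smooth_on (phi @` O) psi
    & forall y, O y -> psi (phi y) = y].

(* The coordinate system phi, with inverse psi, maps S near x onto a relatively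
   open part of the closed half-space {ell >= 0}.  This covers interior points
   (ell (phi x) > 0) and boundary points (ell (phi x) = 0) alike. *)
Definition half_space_chart {V} (S : set V) (x : V) (O : set V)
    (phi psi : V -> V) (ell : {linear V -> R^o}) : Prop :=
  [/\ O x, diffeo_on O phi psi, exists y, ell y <> 0
    & forall y, O y -> (S y <-> 0 <= ell (phi y))].

(* Embedded smooth submanifold with boundary, of the same dimension as V: this
   is the only possible dimension for the closure of a nonempty open set. *)
Definition manifold_with_boundary {V} (S : set V) : Prop :=
  forall x, S x -> exists O phi psi ell, @half_space_chart V S x O phi psi ell.

Definition manifold_boundary {V} (S : set V) : set V :=
  [set x | S x /\ exists O phi psi ell,
     @half_space_chart V S x O phi psi ell /\ ell (phi x) = 0].

Definition second_variation {V} (f : V -> R) (v u w : V) : R :=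
  2^-1 * derive1 (fun r : R => derive1 (fun s : R => f (v + r *: u + s *: w)) 0) 0.

(* Tangent space at v of the hypersurface {f = f v}, when v is a regular point
   of f. *)
Definition level_tangent {V} (f : V -> R) (v : V) : set V :=
  [set u | 'D_u f v = 0].

Definition transverse_levels {V} (f g : V -> R) (c : R) : Prop :=
  forall v, f v = c -> g v = c -> forall u, exists u1 u2,
    [/\ level_tangent f v u1, level_tangent g v u2 & u = u1 + u2].

End NormedSpaces.

Section Index.
Context {R : realType} {n : nat}.
Implicit Types g : 'rV[R]_n -> 'rV[R]_n -> R.

Definition nondegenerate_form g : Prop :=
  forall u, (forall w, g u w = 0) -> u = 0.

Definition negative_definite_on g (U : {vspace 'rV[R]_n}) : Prop :=
  forall u, u \in U -> u != 0 -> g u u < 0.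

(* The index is the largest dimension of a negative definite subspace. *)
Definition has_index g (k : nat) : Prop :=
  (exists U, negative_definite_on g U /\ \dim U = k) /\
  (forall U, negative_definite_on g U -> (\dim U <= k)%N).

End Index.

(* A manifold is given by an atlas: chart i is a homeomorphism, with inverse
   param i, from the open set chart_dom i onto an open set of R^n; outside these
   sets the values of chart i and param i are irrelevant. The preferred chart
   chart_at p around each p only serves to represent tangent vectors. *)
Record manifold (R : realType) (n : nat) := Manifold {
  carrier :> topologicalType;
  manifold_hausdorff : hausdorff_space carrier;
  manifold_second_countable : @second_countable carrier;
  chart_index : Type;
  chart_dom : chart_index -> set carrier;
  chart : chart_index -> carrier -> 'rV[R]_n;
  param : chart_index -> 'rV[R]_n -> carrier;
  chart_at : carrier -> chart_index;
  chart_dom_open : forall i, open (chart_dom i);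
  chart_cod_open : forall i, open (chart i @` chart_dom i);
  chartK : forall i p, chart_dom i p -> param i (chart i p) = p;
  chart_continuous : forall i p, chart_dom i p -> {for p, continuous (chart i)};
  param_continuous : forall i x, (chart i @` chart_dom i) x ->
    {for x, continuous (param i)};
  chart_at_dom : forall p, chart_dom (chart_at p) p;
  transition_smooth : forall i j,
    smooth_on (chart i @` (chart_dom i `&` chart_dom j))
              (chart j \o param i)
}.

Definition chart_cod {R n} (M : manifold R n) (i : chart_index M) :
  set 'rV[R]_n := chart i @` chart_dom i.

(* The tangent space at p is identified with R^n by means of the components in
   the preferred chart chart_at p; components in another chart are obtained from
   the differential of the change of coordinates. *)
Record tangent {R : realType} {n : nat} (M : manifold R n) :=
  Tan { base : M; vec : 'rV[R]_n }.

Section TangentBundle.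
Context {R : realType} {n : nat} (M : manifold R n).
Implicit Type i : chart_index M.

Definition tangent_coord i (p : M) (v : 'rV[R]_n) : 'rV[R]_n :=
  'd (chart i \o param (chart_at p)) (chart (chart_at p) p) v.

(* The local coordinates (x, y) on TM induced by chart i, read backwards: the
   tangent vector at param i x whose components in chart i are y. *)
Definition tangent_param i (z : 'rV[R]_n * 'rV[R]_n) : tangent M :=
  let: (x, y) := z in
  let p := param i x in
  Tan p ('d (chart (chart_at p) \o param i) x y).

Definition in_coord i (S : set (tangent M)) : set ('rV[R]_n * 'rV[R]_n) :=
  [set z | chart_cod i z.1 /\ S (tangent_param i z)].

Definition tangent_open (U : set (tangent M)) : Prop :=
  forall i, open (in_coord i U).

Lemma tangent_openT : tangent_open setT.
Proof.
move=> i; rewrite (_ : in_coord i setT = fst @^-1` chart_cod i); last first.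
  by apply/seteqP; split=> z //= -[].
by apply: open_comp => [z _|]; [exact: cvg_fst|exact: chart_cod_open].
Qed.

Lemma tangent_openI : setI_closed tangent_open.
Proof.
move=> U U' oU oU' i.
rewrite (_ : in_coord i _ = in_coord i U `&` in_coord i U'); first exact: openI.
by apply/seteqP; split=> z /=; rewrite /in_coord /=; [case=> ? []|case=> -[? ?] []].
Qed.

Lemma tangent_open_bigU (I : Type) (f : I -> set (tangent M)) :
  (forall j, tangent_open (f j)) -> tangent_open (\bigcup_j f j).
Proof.
move=> of_ i; rewrite (_ : in_coord i _ = \bigcup_j in_coord i (f j)).
  by apply: bigcup_open => j _; exact: of_.
by apply/seteqP; split=> z; [case=> ? [j _ ?]; exists j|case=> j _ [? ?]; split=> //; exists j].
Qed.

HB.instance Definition _ := gen_eqMixin (tangent M).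
HB.instance Definition _ := gen_choiceMixin (tangent M).
HB.instance Definition _ := isOpenTopological.Build (tangent M)
  tangent_openT tangent_openI tangent_open_bigU.

End TangentBundle.

Section Geometry.
Context {R : realType} {n : nat} {M : manifold R n}.
Implicit Types (A S E : set (tangent M)) (p : M).

Definition nonzero_vectors : set (tangent M) := [set v | vec v != 0].

Definition fiber S p : set 'rV[R]_n := [set v | S (Tan p v)].

Definition fiber_fun (f : tangent M -> R) p (v : 'rV[R]_n) : R := f (Tan p v).

Definition tangent_smooth_on S (f : tangent M -> R) : Prop :=
  forall i, smooth_on_subset (in_coord i S) (f \o tangent_param i).

Definition tangent_manifold_with_boundary S : Prop :=
  forall i, manifold_with_boundary (in_coord i S).

Definition tangent_manifold_boundary S : set (tangent M) :=
  [set v | exists i z, [/\ chart_cod i z.1, tangent_param i z = v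
                        & manifold_boundary (in_coord i S) z]].

(* Smoothness: the components in every chart are smooth. *)
Definition vector_field (T : M -> 'rV[R]_n) : Prop :=
  forall i, smooth_on (chart_cod i)
    (fun x => tangent_coord i (param i x) (T (param i x))).

Definition one_form (omega : M -> 'rV[R]_n -> R) : Prop :=
  (forall p (a : R) u v, omega p (a *: u + v) = a * omega p u + omega p v) /\
  (forall i y, smooth_on (chart_cod i)
     (fun x => let v := tangent_param i (x, y) in omega (base v) (vec v) : R^o)).

Definition nonvanishing (omega : M -> 'rV[R]_n -> R) : Prop :=
  forall p, exists v, omega p v <> 0.

Definition kernel_bundle (omega : M -> 'rV[R]_n -> R) : set (tangent M) :=
  [set v | omega (base v) (vec v) = 0].

(* Finsler metric on a vector subbundle E of TM; only the values of F on E are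
   relevant. *)
Definition finsler_metric E (F : tangent M -> R) : Prop :=
  [/\ {within E, continuous F} /\ tangent_smooth_on (E `&` nonzero_vectors) F,
      forall v, E v -> 0 <= F v,
      forall v, E v -> vec v != 0 -> 0 < F v,
      forall p v (a : R), E (Tan p v) -> 0 < a ->
        F (Tan p (a *: v)) = a * F (Tan p v)
    & forall p v u, E (Tan p v) -> v != 0 -> E (Tan p u) -> u != 0 ->
        0 < second_variation (fun x => fiber_fun F p x ^+ 2) v u u].

Definition indicatrix E (F : tangent M -> R) : set (tangent M) :=
  [set v | E v /\ F v = 1].

(* The closure of A in TM minus the zero section. *)
Definition cone_closure A : set (tangent M) := closure A `&` nonzero_vectors.

(* The closure of A_p in T_pM minus 0. *)
Definition fiber_closure A p : set 'rV[R]_n :=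
  closure (fiber A p) `&` [set v | v != 0].

Definition cone_structure A : set (tangent M) :=
  tangent_manifold_boundary (cone_closure A).

Definition cone_domain A : Prop :=
  [/\ open A, A `<=` nonzero_vectors,
      forall p, [/\ fiber A p !=set0, connected (fiber A p)
                  & forall v (a : R), fiber A p v -> 0 < a ->
                      fiber A p (a *: v)]
    & tangent_manifold_with_boundary (cone_closure A)].

(* L stands for its own smooth extension to the closure of A; its values
   elsewhere are irrelevant.  At v in the closure of A_p the fundamental tensor
   is computed with any smooth extension g of L near v in T_pM: such extensions
   exist because L is smooth on cone_closure A, and they all give the same
   tensor because v is a limit of points of the open set A_p. *)
Definition lorentz_finsler_metric A (L : tangent M -> R) : Prop :=
  cone_domain A /\
  [/\ forall v, A v -> 0 < L v,
      forall p v (a : R), A (Tan p v) -> 0 < a ->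
        L (Tan p (a *: v)) = a ^+ 2 * L (Tan p v),
      tangent_smooth_on (cone_closure A) L /\
        (forall v, cone_structure A v -> L v = 0),
      forall p, manifold_with_boundary (fiber_closure A p)
    & forall p v, fiber_closure A p v ->
        forall O (g : 'rV[R]_n -> R^o),
          local_extension (fiber_closure A p) (fiber_fun L p) v O g ->
          nondegenerate_form (second_variation g v) /\
          has_index (second_variation g v) n.-1].

Definition cone_triple (Omega : M -> 'rV[R]_n -> R) (T : M -> 'rV[R]_n)
    (F : tangent M -> R) : Prop :=
  [/\ one_form Omega /\ nonvanishing Omega, vector_field T,
      forall p, Omega p (T p) = 1
    & finsler_metric (kernel_bundle Omega) F].

Definition cone_of_triple (Omega : M -> 'rV[R]_n -> R) (T : M -> 'rV[R]_n)
    (F : tangent M -> R) : set (tangent M) :=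
  [set v | exists p w, [/\ Omega p w = 0, w != 0
                        & v = Tan p (F (Tan p w) *: T p + w)]].

Definition translate_by_neg (T : M -> 'rV[R]_n) S : set (tangent M) :=
  [set Tan (base v) (vec v - T (base v)) | v in S].

End Geometry.

(* Main.v *)
(* Transversality of the indicatrix and [omega = 1] says that at every vector of
   the cone [Fhat <= omega] some direction [u] makes [omega - Fhat] grow to first
   order.  So [omega - Fhat] serves as a coordinate near the closed cone (implicit
   function theorem), which gives the manifolds with boundary and identifies the
   interior with [Fhat < omega].  Positivity of the fundamental tensor gives the
   inequality [D_y Fhat x <= Fhat y], hence the triangle inequality, hence convexity
   of the cone.  The form of [L = omega^2 - Fhat^2] at [v] is negative definite on
   [ker omega], has value [L v >= 0] at [v], and [v] pairs with [u] to
   [omega v * omega u - Fhat v * D_u Fhat v]; Lorentz signature follows by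
   decomposing along [ker omega] and [v].

   For a field [T] in the cone with [omega T = 1], the norm [F w] is the root [l] of
   [Fhat (w + l T) = l], which exists and is unique for every [w], not only on
   [ker omega], because [Fhat (w + l T) - l] strictly decreases in [l].  Such a
   [T] is built from local ones by a locally finite sum, the cone being convex. *)

Require Import Defs.
From HB Require Import structures.
From mathcomp Require Import all_boot all_order all_algebra.
From mathcomp Require Import all_classical all_reals all_analysis.
From mathcomp Require Import ring lra.

Set Implicit Arguments.
Unset Strict Implicit.
Unset Printing Implicit Defensive.
Import Order.TTheory GRing.Theory Num.Theory.
Import numFieldNormedType.Exports.
Local Open Scope classical_set_scope.
Local Open Scope ring_scope.

(** * Smooth maps *)

(** [smooth_on] means iterated directional differentiability, so stability under composition is not
    formal: the direction of the outer derivative moves with the point. Expanding that direction in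
    a finite basis ([has_basis]) repairs this. The charts and the new norm are both reduced to an
    equation in one scalar unknown, for which monotonicity and intermediate values suffice. A chart
    fits because its straightening map moves points along a single vector, so inverting it is one
    scalar equation. Solving for the root at all nonzero vectors makes the new norm smooth on an
    open part of TM. It is then its own smooth extension off [kernel_bundle omega], and this bundle
    never has to be trivialised. Smoothness of that norm is obtained in coordinates of TM, jointly
    in base point and vector, whereas its convexity is computed in one tangent space and takes
    smoothness as a hypothesis. Zero vectors escape the implicit function theorem; continuity there
    comes from comparing the root with fixed levels. *)

Section Differential.
Context {R : realType}.
Implicit Types V W : normedModType R.

(** The entry point for functions known only through an estimate: transfer along local equality, the
    implicit function, and [flat] at 0. *)
Lemma is_diff_eps V W (f : V -> W) x (df : {linear V -> W}) :
  continuous df ->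
  (forall e, 0 < e -> \forall h \near (0 : V),
     `|f (h + x) - f x - df h| <= e * `|h|) ->
  is_diff x f df.
Proof.
move=> dfc H.
have E : f \o shift x = cst (f x) + df +o_ 0 id.
  apply/eqaddoP => e e0; move: (H e e0); apply: filterS => h /=.
  by rewrite !fctE /= opprD addrA.
by apply: DiffDef; [apply/diff_locallyP; rewrite (diff_unique dfc E)|
  exact: diff_unique].
Qed.

Lemma near_eq_is_diff V W (f g : V -> W) x df :
  (\forall y \near x, f y = g y) -> is_diff x f df -> is_diff x g df.
Proof.
move=> fg [dfx dfE].
have dfc : continuous ('d f x) by exact: diff_continuous.
have -> : df = 'd f x by rewrite dfE.
apply: is_diff_eps => // e e0.
have /eqaddoP := diff_locally dfx => /(_ e e0) H.
have fgx : f x = g x by exact: (nbhs_singleton fg).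
have fg0 : \forall h \near (0 : V), f (h + x) = g (h + x).
  move: fg; rewrite (near_shift 0 x); apply: filterS => h.
  by rewrite /= subr0.
near=> h.
have <- : f (h + x) = g (h + x) by near: h.
rewrite -fgx -addrA -opprD.
by near: h; move: H; apply: filterS => h; rewrite !fctE.
Unshelve. all: by end_near. Qed.

Lemma near_eq_differentiable V W (f g : V -> W) x :
  (\forall y \near x, f y = g y) -> differentiable f x -> differentiable g x.
Proof. by move=> fg /differentiableP /(near_eq_is_diff fg). Qed.

(** Scaling as a two-argument map, so that the library's differential of bilinear maps yields the
    product rule for [k z *: f z]. *)
Definition scale_map V (k : R) (v : V) : V := k *: v.

Lemma scale_map_is_bilinear V :
  bilinear_for (GRing.Scale.Law.clone _ _ *:%R _)
    (GRing.Scale.Law.clone _ _ *:%R _) (@scale_map V : R^o -> V -> V).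
Proof.
rewrite /scale_map; split=> [u a b c|u a b c] /=; first by rewrite scalerDl scalerA.
by rewrite scalerDr !scalerA mulrC.
Qed.

HB.instance Definition _ V :=
  bilinear_isBilinear.Build R R^o V V _ _ (@scale_map V)
    (@scale_map_is_bilinear V).

Lemma is_diff_scale V W (k dk : V -> R) (f df : V -> W) x :
  is_diff x (k : V -> R^o) dk -> is_diff x f df ->
  is_diff x (fun z => k z *: f z) (fun z => k x *: df z + dk z *: f x).
Proof.
move=> dkx dfx.
have C : continuous (fun p : R^o * W => @scale_map W p.1 p.2).
  move=> p; exact: (@scale_continuous _ _ p).
have D : is_diff (k x : R^o, f x) (fun p : R^o * W => @scale_map W p.1 p.2)
    (fun p => @scale_map W (k x) p.2 + @scale_map W p.1 (f x)).
  by apply: DiffDef; [exact: differentiable_bilin|rewrite diff_bilin].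
exact: (@is_diff_comp _ _ _ _ (fun y => (k y : R^o, f y))
  (fun y => (dk y : R^o, df y))).
Qed.

Lemma is_diff_derive V W (f : V -> W) df x v :
  is_diff x f df -> 'D_v f x = df v.
Proof. by move=> [dfx <-]; rewrite deriveE. Qed.

Lemma derive_comp V W (X : normedModType R) (f : V -> W) (g : W -> X) x v :
  differentiable f x -> differentiable g (f x) ->
  'D_v (g \o f) x = 'D_('D_v f x) g (f x).
Proof.
move=> df dg; rewrite (deriveE _ df) (deriveE _ dg).
by rewrite (deriveE _ (differentiable_comp df dg)) diff_comp.
Qed.

End Differential.

Section FiniteBasis.
Context {R : realType}.

(** Finite dimension in the form the chain rule uses: vectors [e k] with continuous linear
    coordinate functionals [c k]. *)
Definition has_basis (W : normedModType R) : Prop :=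
  exists m (e : 'I_m -> W) (c : 'I_m -> {linear W -> R^o}),
    (forall k, continuous (c k)) /\ forall w, w = \sum_(k < m) c k w *: e k.

Lemma has_basis_real : has_basis R^o.
Proof.
exists 1%N, (fun=> 1), (fun=> idfun); split=> [_ x|w]; first exact: cvg_id.
by rewrite big_ord1 /= /GRing.scale /= mulr1.
Qed.

Lemma has_basis_rV n : has_basis 'rV[R]_n.
Proof.
have lin k : linear (fun w : 'rV[R]_n => w 0 k : R^o).
  by move=> a u v; rewrite !mxE.
pose c k : {linear 'rV[R]_n -> R^o} :=
  HB.pack (fun w : 'rV[R]_n => w 0 k : R^o)
    (GRing.isLinear.Build _ _ _ _ _ (lin k)).
exists n, (fun k => delta_mx 0 k), c; split=> [k x|w].
  exact: coord_continuous.
by rewrite [LHS]row_sum_delta.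
Qed.

Lemma has_basis_prod (V W : normedModType R) :
  has_basis V -> has_basis W -> has_basis (V * W)%type.
Proof.
move=> [m [e [c [cc cE]]]] [m' [e' [c' [cc' cE']]]].
have lin1 k : linear (fun w : V * W => c k w.1).
  by move=> a u v; rewrite linearP.
have lin2 k : linear (fun w : V * W => c' k w.2).
  by move=> a u v; rewrite linearP.
pose d1 k : {linear (V * W)%type -> R^o} :=
  HB.pack (fun w : V * W => c k w.1) (GRing.isLinear.Build _ _ _ _ _ (lin1 k)).
pose d2 k : {linear (V * W)%type -> R^o} :=
  HB.pack (fun w : V * W => c' k w.2) (GRing.isLinear.Build _ _ _ _ _ (lin2 k)).
exists (m + m')%N,
  (fun k : 'I_(m + m') => match fintype.split k with inl i => (e i, 0) | inr i => (0, e' i) end),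
  (fun k : 'I_(m + m') => match fintype.split k with inl i => d1 i | inr i => d2 i end); split.
  move=> k; case: (fintype.split k) => i x.
  - by apply: (@continuous_comp _ _ _ fst (c i)); [exact: cvg_fst|exact: cc].
  - by apply: (@continuous_comp _ _ _ snd (c' i)); [exact: cvg_snd|exact: cc'].
move=> [v w]; rewrite big_split_ord /=.
under eq_bigr do rewrite (unsplitK (inl _)) /=.
under [X in _ + X]eq_bigr do rewrite (unsplitK (inr _)) /=.
have inl_sum (F : 'I_m -> V) : \sum_k (F k, 0 : W) = (\sum_k F k, 0).
  by rewrite [RHS](big_morph (fun v => (v, 0 : W)) (id1 := 0) (op1 := +%R)) // => a b;
    apply/pair_equal_spec; split; rewrite /= ?addr0.
have inr_sum (F : 'I_m' -> W) : \sum_k (0 : V, F k) = (0, \sum_k F k).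
  by rewrite [RHS](big_morph (fun v => (0 : V, v)) (id1 := 0) (op1 := +%R)) // => a b;
    apply/pair_equal_spec; split; rewrite /= ?addr0.
have sV k : c k v *: (e k, 0 : W) = (c k v *: e k, 0).
  by apply/pair_equal_spec; split; rewrite // scaler0.
have sW k : c' k w *: (0 : V, e' k) = (0, c' k w *: e' k).
  by apply/pair_equal_spec; split; rewrite // scaler0.
under eq_bigr do rewrite sV.
under [X in _ + X]eq_bigr do rewrite sW.
rewrite inl_sum inr_sum -cE -cE'.
by apply/pair_equal_spec; split; rewrite /= ?addr0 ?add0r.
Qed.

End FiniteBasis.

(** * Closure properties of C^k and smooth maps *)

Section Smoothness.
Context {R : realType}.
Implicit Types V W X : normedModType R.

(** The derivatives in [Ck_on] are those of [f] on the ambient space; [U] only selects the points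
    where they are considered. *)
Lemma Ck_on_restrict V W k (U U' : set V) (f : V -> W) :
  U' `<=` U -> Ck_on k U f -> Ck_on k U' f.
Proof.
elim: k f => [|k IH] f sU /=; first by move=> cf x /sU /cf.
by move=> [df Df]; split=> [x /sU /df//|v]; apply: IH (Df v).
Qed.

Lemma Ck_on_local V W k (U : set V) (f : V -> W) :
  (forall x, U x -> exists O, O x /\ Ck_on k O f) -> Ck_on k U f.
Proof.
elim: k f => [|k IH] f H /=; first by move=> x /H [P [Ox /(_ _ Ox)]].
split=> [x /H [P [Ox [/(_ _ Ox)]]]//|v].
by apply: IH => x /H [P [Ox [_ /(_ v) DO]]]; exists P.
Qed.

(** Openness of [U] turns equality on [U] into equality near each point, which is what derivatives
    see. *)
Lemma Ck_on_ext V W k (U : set V) (f g : V -> W) : open U ->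
  (forall x, U x -> f x = g x) -> Ck_on k U f -> Ck_on k U g.
Proof.
move=> oU; elim: k f g => [|k IH] f g fg /=.
  move=> cf x Ux; have nfg : \forall y \near x, f y = g y.
    by apply: filterS fg _; exact: open_nbhs_nbhs.
  rewrite /prop_for /continuous_at -(fg x Ux).
  by apply: cvg_trans (cf x Ux); apply: near_eq_cvg.
move=> [df Df]; have nfg x : U x -> \forall y \near x, f y = g y.
  by move=> Ux; apply: filterS fg _; exact: open_nbhs_nbhs.
split=> [x Ux|v]; first by apply: near_eq_differentiable (nfg _ Ux) (df _ Ux).
apply: IH (Df v) => x Ux; exact: near_eq_derive (nfg _ Ux).
Qed.

Lemma Ck_on_pred V W k (U : set V) (f : V -> W) : Ck_on k.+1 U f -> Ck_on k U f.
Proof.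
elim: k f => [|k IH] f; first by move=> [df _] x /df /differentiable_continuous.
by move=> [df Df]; split=> // v; apply: IH (Df v).
Qed.

Lemma Ck_on_cst V W k (U : set V) (a : W) : Ck_on k U (fun=> a).
Proof.
elim: k a => [|k IH] a /=; first by move=> x _; exact: cvg_cst.
split=> [x _|v]; first exact: differentiable_cst.
rewrite (_ : (fun x => 'D_v _ x) = fun=> 0); first exact: IH.
by apply/funext => x; exact: derive_cst.
Qed.

Lemma Ck_on_lin V W k (U : set V) (f : {linear V -> W}) : continuous f ->
  Ck_on k U f.
Proof.
move=> cf; case: k => [|k] /=; first by move=> x _; exact: cf.
split=> [x _|v]; first exact: linear_differentiable.
rewrite (_ : (fun x => 'D_v f x) = fun=> f v); first exact: Ck_on_cst.
apply/funext => x; rewrite deriveE ?diff_lin //; exact: linear_differentiable.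
Qed.

Lemma Ck_on_id V k (U : set V) : Ck_on k U (@id V).
Proof. by apply: (@Ck_on_lin _ _ _ _ idfun) => x; exact: cvg_id. Qed.

Lemma Ck_onD V W k (U : set V) (f g : V -> W) : open U ->
  Ck_on k U f -> Ck_on k U g -> Ck_on k U (fun x => f x + g x).
Proof.
move=> oU; elim: k f g => [|k IH] f g /=.
  by move=> cf cg x Ux; apply: (@cvgD _ _ _ _ _ f g); [exact: cf|exact: cg].
move=> [df Df] [dg Dg]; split=> [x Ux|v].
  by apply: (@differentiableD _ _ _ f g); [exact: df|exact: dg].
apply: Ck_on_ext (IH _ _ (Df v) (Dg v)) => // x Ux.
by rewrite (@deriveD _ _ _ f g) //; apply: diff_derivable; [exact: df|exact: dg].
Qed.

Lemma Ck_on_sum V W k (U : set V) m (f : 'I_m -> V -> W) : open U ->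
  (forall i, Ck_on k U (f i)) -> Ck_on k U (fun x => \sum_i f i x).
Proof.
move=> oU; elim: m f => [|m IH] f cf.
  rewrite (_ : (fun x => \sum_i f i x) = fun=> 0); first exact: Ck_on_cst.
  by apply/funext => x; rewrite big_ord0.
rewrite (_ : (fun x => \sum_i f i x) = fun x => \sum_(i < m) f (widen_ord (leqnSn m) i) x +
  f ord_max x); last by apply/funext => x; rewrite big_ord_recr.
by apply: Ck_onD => //; exact: IH.
Qed.

Lemma Ck_onZ V W k (U : set V) (a : V -> R) (f : V -> W) : open U ->
  Ck_on k U (a : V -> R^o) -> Ck_on k U f -> Ck_on k U (fun x => a x *: f x).
Proof.
move=> oU; elim: k a f => [|k IH] a f.
  by move=> ca cf x Ux; apply: (@cvgZ _ _ _ _ _ a f); [exact: ca|exact: cf].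
(* The product rule pairs each derivative with the other factor undifferentiated, so both factors
   are also needed at the lower order. *)
move=> Ca Cf; have Ca' := Ck_on_pred Ca; have Cf' := Ck_on_pred Cf.
case: Ca Cf => da Da [df Df].
have D x : U x -> is_diff x (fun z => a z *: f z)
    (fun z => a x *: 'd f x z + 'd (a : V -> R^o) x z *: f x).
  by move=> Ux; apply: is_diff_scale; apply: differentiableP; [exact: da|exact: df].
split=> [x /D []//|v].
apply: (@Ck_on_ext _ _ _ _ (fun x => a x *: 'D_v f x + 'D_v (a : V -> R^o) x *: f x)) => //.
  move=> x Ux; rewrite (is_diff_derive _ (D x Ux)).
  by rewrite (deriveE _ (df x Ux)) (deriveE _ (da x Ux)).
apply: (Ck_onD oU); [exact: IH Ca' (Df v)|exact: IH (Da v) Cf'].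
Qed.

Lemma Ck_on_pair V W X k (U : set V) (f : V -> W) (g : V -> X) : open U ->
  Ck_on k U f -> Ck_on k U g -> Ck_on k U (fun x => (f x, g x)).
Proof.
move=> oU; elim: k f g => [|k IH] f g.
  by move=> cf cg x Ux; apply: cvg_pair; [exact: cf|exact: cg].
move=> [df Df] [dg Dg]; have D x : U x ->
    is_diff x (fun z => (f z, g z)) (fun z => ('d f x z, 'd g x z)).
  by move=> Ux; apply: is_diff_pair; apply: differentiableP; [exact: df|exact: dg].
split=> [x /D []//|v].
apply: Ck_on_ext (IH _ _ (Df v) (Dg v)) => // x Ux.
rewrite (is_diff_derive _ (D x Ux)).
by rewrite (deriveE _ (df x Ux)) (deriveE _ (dg x Ux)).
Qed.

(** The derivative along [v] is that of [g] in the moving direction ['D_v f x]. Written as the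
    finite sum of [c j ('D_v f x) *: 'D_(e j) g (f x)], it has fixed directions only, and the
    induction hypothesis applies to each term. *)
Lemma Ck_on_comp V W X k (U : set V) (O : set W) (f : V -> W) (g : W -> X) :
  has_basis W -> open U -> (forall x, U x -> O (f x)) ->
  Ck_on k U f -> Ck_on k O g -> Ck_on k U (fun x => g (f x)).
Proof.
move=> [m [e [c [cc cE]]]] oU.
have lin_comp j h l : Ck_on l U h -> Ck_on l U (fun x => c j (h x)).
  elim: l h => [|l IH] h.
    by move=> ch x Ux; apply: (@continuous_comp _ _ _ h (c j)); [exact: ch|exact: cc].
  move=> [dh Dh]; have D x : U x -> is_diff x (fun z => c j (h z)) (fun z => c j ('d h x z)).
    move=> Ux; apply: (@is_diff_comp _ _ _ _ h ('d h x) (c j) (c j)).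
      by apply: differentiableP; exact: dh.
    by apply: DiffDef; [exact: linear_differentiable|exact: diff_lin].
  split=> [x /D []//|v].
  apply: Ck_on_ext (IH _ (Dh v)) => // x Ux.
  by rewrite (is_diff_derive _ (D x Ux)) (deriveE _ (dh x Ux)).
elim: k f g => [|k IH] f g fUO Cf Cg.
  move=> x Ux; apply: (@continuous_comp _ _ _ f g); [exact: Cf|exact: Cg (fUO _ Ux)].
have Cf' := Ck_on_pred Cf; case: Cf Cg => df Df [dg Dg].
split=> [x Ux|v].
  by apply: (@differentiable_comp _ _ _ _ f g); [exact: df|exact: dg (fUO _ Ux)].
apply: (@Ck_on_ext _ _ _ _ (fun x => \sum_j c j ('D_v f x) *: 'D_(e j) g (f x))) => //.
  move=> x Ux; have dgf := dg _ (fUO _ Ux).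
  rewrite (derive_comp _ (df x Ux) dgf) (deriveE _ dgf) [in RHS](cE ('D_v f x)).
  by rewrite linear_sum; apply: eq_bigr => j _; rewrite linearZ /= (deriveE _ dgf).
apply: Ck_on_sum => // j; apply: Ck_onZ => //; first exact: lin_comp (Df v).
exact: IH fUO Cf' (Dg _).
Qed.

Lemma Ck_onV V k (U : set V) (f : V -> R) : open U ->
  (forall x, U x -> f x != 0) ->
  Ck_on k U (f : V -> R^o) -> Ck_on k U ((fun x => (f x)^-1) : V -> R^o).
Proof.
move=> oU f0; elim: k => [|k IH] Cf.
  by move=> x Ux; apply: cvgV; [exact: f0|exact: Cf].
have Cf' := Ck_on_pred Cf; case: Cf => df Df.
split=> [x Ux|v].
  by apply: differentiableV; [exact: df|exact: f0].
apply: (@Ck_on_ext _ _ _ _ (fun x => (- 1) *: ((f x)^-1 *: ((f x)^-1 *: 'D_v (f : V -> R^o) x)))) => //.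
  move=> x Ux; rewrite (deriveE _ (differentiableV (df x Ux) (f0 x Ux))).
  rewrite (diffV (df x Ux) (f0 x Ux)) (deriveE _ (df x Ux)) /= /GRing.scale /=.
  by rewrite expr2 invfM mulN1r mulNr mulrA.
apply: Ck_onZ => //; first exact: Ck_on_cst.
apply: (Ck_onZ oU (IH Cf')).
exact: (Ck_onZ oU (IH Cf') (Df v)).
Qed.

Lemma smooth_on_restrict V W (U U' : set V) (f : V -> W) :
  U' `<=` U -> smooth_on U f -> smooth_on U' f.
Proof. by move=> UU' sf k; exact: Ck_on_restrict (sf k). Qed.

Lemma smooth_on_local V W (U : set V) (f : V -> W) :
  (forall x, U x -> exists O, O x /\ smooth_on O f) -> smooth_on U f.
Proof.
by move=> H k; apply: Ck_on_local => x /H[P [Px sf]]; exists P; split.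
Qed.

Lemma smooth_on_ext V W (U : set V) (f g : V -> W) : open U ->
  (forall x, U x -> f x = g x) -> smooth_on U f -> smooth_on U g.
Proof. by move=> oU fg sf k; exact: Ck_on_ext (sf k). Qed.

Lemma smooth_on_continuous V W (U : set V) (f : V -> W) : smooth_on U f ->
  forall x, U x -> {for x, continuous f}.
Proof. by move=> /(_ 0%N). Qed.

Lemma smooth_on_differentiable V W (U : set V) (f : V -> W) : smooth_on U f ->
  forall x, U x -> differentiable f x.
Proof. by move=> /(_ 1%N)[]. Qed.

Lemma smooth_on_derive V W (U : set V) (f : V -> W) v : smooth_on U f ->
  smooth_on U (fun x => 'D_v f x).
Proof. by move=> sf k; have [_] := sf k.+1; exact. Qed.

Lemma smooth_on_cst V W (U : set V) (a : W) : smooth_on U (fun=> a).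
Proof. by move=> k; exact: Ck_on_cst. Qed.

Lemma smooth_on_lin V W (U : set V) (f : {linear V -> W}) : continuous f ->
  smooth_on U f.
Proof. by move=> cf k; exact: Ck_on_lin. Qed.

Lemma smooth_on_id V (U : set V) : smooth_on U (@id V).
Proof. by move=> k; exact: Ck_on_id. Qed.

Lemma smooth_onD V W (U : set V) (f g : V -> W) : open U ->
  smooth_on U f -> smooth_on U g -> smooth_on U (fun x => f x + g x).
Proof. by move=> oU sf sg k; exact: Ck_onD (sf k) (sg k). Qed.

Lemma smooth_onZ V W (U : set V) (a : V -> R) (f : V -> W) : open U ->
  smooth_on U (a : V -> R^o) -> smooth_on U f ->
  smooth_on U (fun x => a x *: f x).
Proof. by move=> oU sa sf k; exact: Ck_onZ (sa k) (sf k). Qed.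

Lemma smooth_onN V W (U : set V) (f : V -> W) : open U ->
  smooth_on U f -> smooth_on U (fun x => - f x).
Proof.
move=> oU sf; rewrite (_ : (fun x => - f x) = fun x => (-1) *: f x).
  by apply: smooth_onZ => //; exact: smooth_on_cst.
by apply/funext => x; rewrite scaleN1r.
Qed.

Lemma smooth_onB V W (U : set V) (f g : V -> W) : open U ->
  smooth_on U f -> smooth_on U g -> smooth_on U (fun x => f x - g x).
Proof. by move=> oU sf sg; apply: smooth_onD => //; exact: smooth_onN. Qed.

Lemma smooth_onM V (U : set V) (f g : V -> R^o) : open U ->
  smooth_on U f -> smooth_on U g -> smooth_on U ((fun x => f x * g x) : V -> R^o).
Proof. by move=> oU sf sg; exact: smooth_onZ. Qed.

Lemma smooth_onV V (U : set V) (f : V -> R^o) : open U ->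
  (forall x, U x -> f x != 0) -> smooth_on U f ->
  smooth_on U ((fun x => (f x)^-1) : V -> R^o).
Proof. by move=> oU f0 sf k; exact: Ck_onV (sf k). Qed.

Lemma smooth_on_sum V W (U : set V) m (f : 'I_m -> V -> W) : open U ->
  (forall i, smooth_on U (f i)) -> smooth_on U (fun x => \sum_i f i x).
Proof. by move=> oU sf k; apply: Ck_on_sum => // i; exact: sf. Qed.

Lemma smooth_on_pair V W X (U : set V) (f : V -> W) (g : V -> X) : open U ->
  smooth_on U f -> smooth_on U g -> smooth_on U (fun x => (f x, g x)).
Proof. by move=> oU sf sg k; exact: Ck_on_pair (sf k) (sg k). Qed.

Lemma smooth_on_comp V W X (U : set V) (O : set W) (f : V -> W) (g : W -> X) :
  has_basis W -> open U -> (forall x, U x -> O (f x)) ->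
  smooth_on U f -> smooth_on O g -> smooth_on U (fun x => g (f x)).
Proof. by move=> bW oU fUO sf sg k; exact: Ck_on_comp (sf k) (sg k). Qed.

Lemma smooth_on_fst V W (U : set (V * W)) : smooth_on U fst.
Proof.
have lin : linear (fst : V * W -> V) by [].
pose f : {linear (V * W)%type -> V} :=
  HB.pack (fst : V * W -> V) (GRing.isLinear.Build _ _ _ _ _ lin).
by apply: (@smooth_on_lin _ _ _ f) => x; exact: cvg_fst.
Qed.

Lemma smooth_on_snd V W (U : set (V * W)) : smooth_on U snd.
Proof.
have lin : linear (snd : V * W -> W) by [].
pose f : {linear (V * W)%type -> W} :=
  HB.pack (snd : V * W -> W) (GRing.isLinear.Build _ _ _ _ _ lin).
by apply: (@smooth_on_lin _ _ _ f) => x; exact: cvg_snd.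
Qed.

Lemma is_derive_line V W (f : V -> W) x v (t : R) :
  differentiable f (x + t *: v) ->
  is_derive t 1 (fun s : R => f (x + s *: v)) ('D_v f (x + t *: v)).
Proof.
move=> df; have D : is_diff (t : R) (fun s : R => f (x + s *: v))
    (fun s : R => 'd f (x + t *: v) (s *: v)).
  apply: (@is_diff_comp _ _ _ _ (fun s : R => x + s *: v) (fun s : R => s *: v) f).
    apply: (is_diff_eq (is_diffD (is_diff_cst x t) (is_diff_scalel t v))).
    by apply/funext => s; rewrite !fctE add0r.
  exact: differentiableP.
apply: DeriveDef; first by apply: diff_derivable; case: D.
by rewrite (is_diff_derive _ D) scale1r (deriveE _ df).
Qed.

End Smoothness.

(** * The implicit function theorem for one scalar unknown *)

Lemma mean_value (R : realType) (f df : R -> R) (a b : R) : a < b ->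
  (forall x, a <= x <= b -> is_derive x 1 f (df x)) ->
  exists2 c, a < c < b & f b - f a = df c * (b - a).
Proof.
move=> ab dfx; have [|||c cab E] := @MVT R f df a b => //.
- by move=> x; rewrite in_itv /= => /andP[ax xb]; apply: dfx; rewrite !ltW.
- by apply: derivable_within_continuous => x; rewrite in_itv /= => /dfx[].
- by exists c => //; move: cab; rewrite in_itv.
Qed.

Lemma continuous_pair_cst (R : realType) (V W : normedModType R) (w : W) :
  continuous (fun v : V => (v, w)).
Proof.
move=> v; apply: (@smooth_on_continuous _ _ _ setT) => //.
by apply: smooth_on_pair; [exact: openT|exact: smooth_on_id|exact: smooth_on_cst].
Qed.

Section Enclosures.
Context {R : realType}.
Implicit Types a b c k s x y : R.

Lemma shift_within a b k x : `|k| < x - a -> `|k| < b - x -> a <= k + x <= b.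
Proof. by rewrite !ltr_norml => /andP[? _] /andP[_ ?]; apply/andP; split; lra. Qed.

Lemma near_pos_gt0 x y : 0 < y -> `|x - y| <= y / 2 -> 0 < x.
Proof. by rewrite ler_norml => y0 /andP[? _]; lra. Qed.

Lemma near_neg_lt0 x y : 0 < y -> `|x - - y| <= y / 2 -> x < 0.
Proof. by rewrite ler_norml => y0 /andP[_ ?]; lra. Qed.

Lemma dist_enclosed a b c s : c < a + s + b -> a - s + b < c -> `|c - b - a| <= s.
Proof. by move=> ? ?; rewrite ler_norml; apply/andP; split; lra. Qed.

End Enclosures.

Section ImplicitFunction.
Context {R : realType} {V : normedModType R}.
Variables (H : V * R^o -> R^o) (O : set (V * R^o)) (v0 : V) (t0 : R).
Hypotheses (bV : has_basis V) (oO : open O) (sH : smooth_on O H)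
  (Oz0 : O (v0, t0 : R^o)) (Hz0 : H (v0, t0 : R^o) = 0).

Let dt z := 'D_(0, 1 : R^o) H z.

Let dHt v t : O (v, t : R^o) ->
  is_derive t 1 (fun t : R => H (v, t : R^o)) (dt (v, t : R^o)).
Proof.
move=> Ovt; have E (s : R) : (v, s : R^o) = (v, 0) + s *: (0, 1 : R^o).
  by apply/pair_equal_spec; split; rewrite /= ?scaler0 ?addr0 ?add0r // /GRing.scale /= mulr1.
have -> : (fun t : R => H (v, t : R^o)) = fun s : R => H ((v, 0) + s *: (0, 1 : R^o)).
  by apply/funext => s; rewrite -E.
rewrite (E t); apply: is_derive_line; rewrite -E.
exact: smooth_on_differentiable sH _ Ovt.
Qed.

(** On a small box [H] increases in [t], so the intermediate value theorem gives one root above each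
    [v]. Differentiability follows by trapping the root between two values of [t] where [H] has
    opposite signs. *)
Lemma implicit_function_increasing : 0 < dt (v0, t0 : R^o) ->
  exists U (g : V -> R^o) d,
    [/\ open U /\ U v0, 0 < d, g v0 = t0,
        forall v, U v -> [/\ O (v, g v), H (v, g v) = 0, dt (v, g v) != 0
          & forall t : R, `|t - t0| < d -> H (v, t : R^o) = 0 -> t = g v]
      & smooth_on U g].
Proof.
move=> dt0.
have cdt : {for (v0, t0 : R^o), continuous dt}.
  exact: smooth_on_continuous (smooth_on_derive _ sH) _ Oz0.
have [r r0 Hr] : exists2 r, 0 < r & forall v (t : R), ball v0 r v ->
    `|t - t0| < r -> O (v, t : R^o) /\ 0 < dt (v, t : R^o).
  have : \forall z \near (v0, t0 : R^o), O z /\ 0 < dt z.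
    near=> z; split; near: z; first exact: open_nbhs_nbhs.
    by apply: (cvgr_gt _ cdt).
  move=> /nbhs_ballP [r /= r0 Hr]; exists r => // v t vb tb; apply: Hr.
  by split=> //=; rewrite -ball_normE /= distrC.
(* Half the radius, so that the closed interval of radius [d] lies in the open one where the
   derivative is positive. *)
pose d := r / 2.
have d0 : 0 < d by rewrite divr_gt0.
have dr : d < r by rewrite ltr_pdivrMr // ltr_pMr // ltr1n.
have Hd v (t : R) : ball v0 r v -> t0 - d <= t <= t0 + d ->
    O (v, t : R^o) /\ 0 < dt (v, t : R^o).
  move=> vb /andP[t1 t2]; apply: Hr => //; apply: le_lt_trans dr.
  by rewrite ler_distl; apply/andP; split.
have mono v (s t : R) : ball v0 r v -> t0 - d <= s -> s < t -> t <= t0 + d ->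
    H (v, s : R^o) < H (v, t : R^o).
  move=> vb s1 st t2; have [|c /andP[c1 c2] E] :=
    @mean_value R (fun t => H (v, t : R^o)) (fun t => dt (v, t : R^o)) _ _ st.
    move=> x /andP[x1 x2]; apply: dHt; apply: (Hd v x vb _).1.
    by rewrite (le_trans s1 x1) (le_trans x2 t2).
  rewrite -subr_gt0 E mulr_gt0 ?subr_gt0 //; apply: (Hd v c vb _).2.
  by rewrite (le_trans s1 (ltW c1)) (le_trans (ltW c2) t2).
have v0b : ball v0 r v0 by exact: ballxx.
have tp : t0 < t0 + d by rewrite ltrDl.
have tm : t0 - d < t0 by rewrite ltrBlDr ltrDl.
(* Opposite signs at the two ends persist for [v] near [v0], by continuity of [H] at the two end
   points over [v0]. *)
pose P v := [/\ ball v0 r v, 0 < H (v, t0 + d : R^o) & H (v, t0 - d : R^o) < 0].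
have cH v (t : R) : O (v, t : R^o) -> {for v, continuous (fun v => H (v, t : R^o))}.
  move=> Ovt; apply: (@continuous_comp _ _ _ (fun v : V => (v, t : R^o)) H).
    exact: continuous_pair_cst.
  exact: smooth_on_continuous sH _ Ovt.
have PU : \forall v \near v0, P v.
  have O1 : O (v0, t0 + d : R^o) by apply: (Hd _ _ v0b _).1; rewrite lexx andbT ltW // (lt_trans tm).
  have O2 : O (v0, t0 - d : R^o) by apply: (Hd _ _ v0b _).1; rewrite lexx /= ltW // (lt_trans tm).
  near=> v; split; near: v.
  - exact: nbhsx_ballx.
  - apply: (cvgr_gt _ (cH _ _ O1)); rewrite -Hz0; apply: mono => //; exact: ltW.
  - apply: (cvgr_lt _ (cH _ _ O2)); rewrite -Hz0; apply: mono => //; exact: ltW.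
pose U := interior P.
have UP v : U v -> P v by exact: interior_subset.
(* Stated for every [v], with the arbitrary value 0 off [U], so that choice yields a total
   function. *)
have root v : exists t : R, U v -> t0 - d <= t <= t0 + d /\ H (v, t : R^o) = 0.
  case: (pselect (U v)) => [/UP [vb H1 H2]|nU]; last by exists 0.
  have [|||t] := @IVT R (fun t => H (v, t : R^o)) (t0 - d) (t0 + d) 0.
  - by apply: ltW; exact: lt_trans tm tp.
  - apply: derivable_within_continuous => x; rewrite in_itv /= => xI.
    by have [] := dHt (Hd v x vb xI).1.
  - by rewrite ge_min le_max (ltW H1) (ltW H2) orbT.
  - by rewrite in_itv /= => tI Ht; exists t.
have [g Hg] := choice root.
have gO v : U v -> O (v, g v : R^o) /\ 0 < dt (v, g v : R^o).
  by move=> Uv; have [vb _ _] := UP _ Uv; apply: Hd => //; exact: (Hg v Uv).1.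
have lt_g v (s : R) : U v -> t0 - d <= s <= t0 + d -> 0 < H (v, s : R^o) -> g v < s.
  move=> Uv /andP[s1 s2] Hs; have [/andP[g1 g2] Hgv] := Hg v Uv; have [vb _ _] := UP _ Uv.
  rewrite ltNge le_eqVlt; apply/negP => /orP[/eqP E|sg].
    by move: Hs; rewrite E Hgv ltxx.
  by have := mono v s (g v) vb s1 sg g2; rewrite Hgv ltNge (ltW Hs).
have gt_g v (s : R) : U v -> t0 - d <= s <= t0 + d -> H (v, s : R^o) < 0 -> s < g v.
  move=> Uv /andP[s1 s2] Hs; have [/andP[g1 g2] Hgv] := Hg v Uv; have [vb _ _] := UP _ Uv.
  rewrite ltNge le_eqVlt; apply/negP => /orP[/eqP E|sg].
    by move: Hs; rewrite -E Hgv ltxx.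
  by have := mono v (g v) s vb g1 sg s2; rewrite Hgv ltNge (ltW Hs).
have g_in v : U v -> t0 - d < g v < t0 + d.
  move=> Uv; have [vb H1 H2] := UP _ Uv; apply/andP; split.
    by apply: gt_g => //; rewrite lexx /= ltW // (lt_trans tm).
  by apply: lt_g => //; rewrite lexx andbT ltW // (lt_trans tm).
have uniq v (t : R) : U v -> t0 - d <= t <= t0 + d -> H (v, t : R^o) = 0 -> t = g v.
  move=> Uv /andP[t1 t2] Ht; have [/andP[g1 g2] Hgv] := Hg v Uv; have [vb _ _] := UP _ Uv.
  case: (ltgtP t (g v)) => // tg.
    by have := mono v _ _ vb t1 tg g2; rewrite Ht Hgv ltxx.
  by have := mono v _ _ vb g1 tg t2; rewrite Ht Hgv ltxx.
have oU : open U by exact: open_interior.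
have Uv0 : U v0 by exact: PU.
exists U, g, d; split=> //.
- by rewrite -(@uniq v0 t0 Uv0) // !ltW.
- move=> v Uv; have [gv1 gv2] := gO v Uv; split=> //.
  + by have [] := Hg v Uv.
  + by rewrite gt_eqF.
  + by move=> t td; apply: uniq => //; move/ltW: td; rewrite ler_distl.
(* The differential predicted by differentiating [H (v, g v) = 0]. *)
- have dg v : U v -> is_diff v (g : V -> R^o)
      (fun h => - (dt (v, g v : R^o))^-1 *: 'd H (v, g v : R^o) (h, 0 : R^o)).
    move=> Uv; have [Oz b0] := gO v Uv; have [_ Hz] := Hg v Uv.
    set z := (v, g v : R^o) in Oz b0 Hz *; set b := dt z in b0 *.
    have dHz : differentiable H z by exact: smooth_on_differentiable sH _ Oz.
    have Llin : linear (fun h => - b^-1 *: 'd H z (h, 0 : R^o) : R^o).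
      move=> a x y; rewrite (_ : (a *: x + y, 0 : R^o) = a *: (x, 0 : R^o) + (y, 0 : R^o)).
        by rewrite linearP scalerDr !scalerA (mulrC a).
      by apply/pair_equal_spec; split => //=; rewrite scaler0 addr0.
    pose L : {linear V -> R^o} := HB.pack (fun h => - b^-1 *: 'd H z (h, 0 : R^o) : R^o)
      (GRing.isLinear.Build _ _ _ _ _ Llin).
    have Lc : continuous L.
      move=> h; apply: (@continuousZl_tmp _ _ _ (fun h => 'd H z (h, 0 : R^o)) (- b^-1) h).
      apply: (@continuous_comp _ _ _ (fun h : V => (h, 0 : R^o)) ('d H z)).
        exact: continuous_pair_cst.
      exact: diff_continuous.
    have bE : b = 'd H z (0, 1 : R^o) by rewrite -(deriveE _ dHz).
    (* With [L] the predicted differential, the linear part of [H] at [k = L h + s] is [b * s]: its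
       sign is the sign of [s]. *)
    have dHE h (k : R) : 'd H z (h, k : R^o) = b * (k - L h).
      have -> : (h, k : R^o) = (h, 0 : R^o) + k *: (0, 1 : R^o).
        by apply/pair_equal_spec; split;
          rewrite /= ?scaler0 ?addr0 ?add0r // /GRing.scale /= mulr1.
      rewrite linearD linearZ /= -bE /L /= /GRing.scale /= mulrBr mulNr mulrN opprK.
      by rewrite mulrA divff ?gt_eqF // mul1r addrC mulrC.
    have [C C0 LC] := linear_lipschitz Lc.
    apply: (@is_diff_eps _ _ _ _ _ L) => // e e0.
    (* [K] dominates both 1 and [C + e], hence the maximum norm of [(h, k)] is at most [K * |h|] as
       soon as [|k| <= (C + e) * |h|]. *)
    pose K := 1 + C + e.
    have K0 : 0 < K by rewrite !addr_gt0.
    (* This tolerance keeps the remainder below half of the main term [b * (e * |h|)]. *)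
    have eta0 : 0 < b * e / (2 * K) by rewrite divr_gt0 ?mulr_gt0.
    have /eqaddoP /(_ _ eta0) /nbhs_ballP [rho /= rho0 HH] := diff_locally dHz.
    have HHE (h : V) (k : R) : `|h| < rho / K -> `|k| <= (C + e) * `|h| ->
        `|H (h + v, k + g v : R^o) - b * (k - L h)| <= b * (e * `|h|) / 2.
      move=> hr kh.
      have hK : `|(h, k : R^o)| <= K * `|h|.
        rewrite ge_max /= (le_trans kh) ?andbT; last first.
          by rewrite ler_wpM2r // /K -addrA lerDr.
        by rewrite ler_peMl // /K -addrA lerDl addr_ge0 ?ltW.
      have := HH (h, k : R^o); rewrite -ball_normE /= sub0r normrN => HH'.
      have : `|(h, k : R^o)| < rho.
        by rewrite (le_lt_trans hK) // mulrC -ltr_pdivlMr.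
      move=> /HH'; rewrite !fctE /= Hz add0r dHE => /le_trans; apply.
      rewrite (le_trans (ler_wpM2l (ltW eta0) hK)) //.
      have -> // : b * e / (2 * K) * (K * `|h|) = b * (e * `|h|) / 2.
      by field; rewrite gt_eqF.
    have gz : t0 - d < g v < t0 + d by exact: g_in.
    (* The room around [g v] inside the interval where roots are compared; for small [h] both test
       values stay in it. *)
    pose m := Num.min (g v - (t0 - d)) (t0 + d - g v).
    have m0 : 0 < m by rewrite lt_min !subr_gt0.
    have Ce0 : 0 < C + e by rewrite addr_gt0.
    near=> h.
    have [->|h0] := eqVneq h 0; first by rewrite add0r (linear0 ('d H z)) scaler0 subr0 (subrr (g v : R)) !normr0 mulr0.
    have hn : 0 < `|h| by rewrite normr_gt0.
    have hr : `|h| < rho / K by near: h; apply: nbhs0_lt; rewrite divr_gt0.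
    have hm : `|h| < m / (C + e) by near: h; apply: nbhs0_lt; rewrite divr_gt0.
    have Uh : U (h + v).
      near: h; have : \forall y \near v, U y by exact: open_nbhs_nbhs.
      by rewrite (near_shift 0 v); apply: filterS => y /=; rewrite subr0.
    have kE (s : R) : `|s| = e * `|h| -> `|L h + s| <= (C + e) * `|h| /\
        t0 - d <= L h + s + g v <= t0 + d.
      move=> sE; have kb : `|L h + s| <= (C + e) * `|h|.
        by rewrite (le_trans (ler_normD _ _)) // mulrDl sE lerD2r.
      split=> //; move: hm; rewrite ltr_pdivlMr // mulrC => /(le_lt_trans kb).
      by rewrite lt_min => /andP[]; exact: shift_within.
    have s0 : 0 < e * `|h| by rewrite mulr_gt0.
    have [k1 I1] := kE (e * `|h|) (gtr0_norm s0).
    have [k2 I2] := kE (- (e * `|h|)) (eq_trans (normrN _) (gtr0_norm s0)).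
    (* At the increments [L h + e |h|] and [L h - e |h|] the main term wins over the remainder, so
       [H] is positive at the first and negative at the second, and the root lies between. *)
    have := HHE _ _ hr k1; have := HHE _ _ hr k2.
    have -> : L h + e * `|h| - L h = e * `|h| by ring.
    have -> : L h - e * `|h| - L h = - (e * `|h|) by ring.
    rewrite mulrN => B2 B1; have bs : 0 < b * (e * `|h|) by rewrite mulr_gt0.
    have G1 := lt_g _ _ Uh I1 (near_pos_gt0 bs B1).
    have G2 := gt_g _ _ Uh I2 (near_neg_lt0 bs B2).
    have : `|g (h + v) - g v - L h : R| <= e * `|h| by exact: dist_enclosed.
    exact.
  (* Bootstrapping: the derivative of [g] is a quotient of derivatives of [H] at [(v, g v)], hence
     as regular as [g] is already known to be. *)
  move=> k; elim: k => [|k IH].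
    by move=> v Uv; apply: differentiable_continuous; have [] := dg v Uv.
  split=> [v /dg []//|w].
  apply: (@Ck_on_ext _ _ _ _ _ (fun v => - (dt (v, g v : R^o))^-1 *: 'D_(w, 0 : R^o) H (v, g v : R^o))) => //.
    move=> v Uv; rewrite (is_diff_derive _ (dg v Uv)).
    by rewrite (deriveE _ (smooth_on_differentiable sH (gO v Uv).1)).
  have Cp : Ck_on k U (fun v => (v, g v : R^o)) by apply: Ck_on_pair => //; exact: Ck_on_id.
  have bVR : has_basis (V * R^o)%type by apply: has_basis_prod => //; exact: has_basis_real.
  have CD (u : V * R^o) : Ck_on k U (fun v => 'D_u H (v, g v : R^o)).
    by apply: Ck_on_comp Cp (smooth_on_derive u sH k) => // v /gO[].
  apply: Ck_onZ => //.
  rewrite (_ : (fun v => - _) = fun v => (-1) *: (dt (v, g v : R^o))^-1); last first.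
    by apply/funext => v; rewrite scaleN1r.
  apply: Ck_onZ => //; first exact: Ck_on_cst.
  by apply: (Ck_onV oU _ (CD _)) => v Uv; have [_ b0] := gO v Uv; rewrite gt_eqF.
Unshelve. all: by end_near. Qed.

End ImplicitFunction.

Lemma implicit_function (R : realType) (V : normedModType R)
    (H : V * R^o -> R^o) (O : set (V * R^o)) (v0 : V) (t0 : R) :
  has_basis V -> open O -> smooth_on O H -> O (v0, t0 : R^o) ->
  H (v0, t0 : R^o) = 0 -> 'D_(0, 1 : R^o) H (v0, t0 : R^o) != 0 ->
  exists U (g : V -> R^o) d,
    [/\ open U /\ U v0, 0 < d, g v0 = t0,
        forall v, U v -> H (v, g v) = 0 /\
          forall t : R, `|t - t0| < d -> H (v, t : R^o) = 0 -> t = g v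
      & smooth_on U g].
Proof.
move=> bV oO sH Oz Hz; rewrite neq_lt => /orP[D0|D0]; last first.
  have [U [g [d [H1 H2 H3 H4 H5]]]] := implicit_function_increasing bV oO sH Oz Hz D0.
  by exists U, g, d; split=> // v /H4[].
(* Passing to [- H] makes the derivative positive and keeps the zeros. *)
pose N z : R^o := - H z.
have sN : smooth_on O N by exact: smooth_onN.
have DN : 0 < 'D_(0, 1 : R^o) N (v0, t0 : R^o).
  rewrite /N (@deriveN _ _ _ H); first by rewrite oppr_gt0.
  by apply: diff_derivable; exact: smooth_on_differentiable sH _ Oz.
have Nz : N (v0, t0 : R^o) = 0 by rewrite /N Hz oppr0.
have [U [g [d [H1 H2 H3 H4 H5]]]] := implicit_function_increasing bV oO sN Oz Nz DN.
exists U, g, d; split=> // v /H4[_ Hg _ uniq]; split.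
  by apply/eqP; rewrite -oppr_eq0 -/(N _) Hg.
by move=> t td Ht; apply: uniq => //; rewrite /N Ht oppr0.
Qed.

Lemma open_setX (S T : topologicalType) (A : set S) (B : set T) :
  open A -> open B -> open (A `*` B).
Proof.
move=> oA oB; rewrite openE => -[x y] [/= Ax By]; exists (A, B) => //=.
by split; exact: open_nbhs_nbhs.
Qed.

Lemma open_setI_preimage (S T : topologicalType) (U : set S) (P : set T) (f : S -> T) :
  open U -> (forall x, U x -> {for x, continuous f}) -> open P ->
  open (U `&` f @^-1` P).
Proof.
move=> oU cf oP; rewrite openE => x [Ux Px].
apply: filterI; first exact: open_nbhs_nbhs.
by apply: cf => //; exact: open_nbhs_nbhs.
Qed.

(* [phi] and [psi] move points along [e] only. *)
Lemma level_chart (R : realType) (V : normedModType R) (h : V -> R^o) (P : set V)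
    (v e : V) (ell : {linear V -> R^o}) :
  has_basis V -> open P -> smooth_on P h -> P v -> continuous ell ->
  ell e = 1 -> 'D_e h v != 0 ->
  exists O phi psi, [/\ O v, O `<=` P, diffeo_on O phi psi
    & forall y, O y -> ell (phi y) = h y].
Proof.
move=> bV oP sh Pv cl le De.
(* As [ell e = 1], this multiple of [e] is the one that changes [ell y] into [h y]. *)
pose phi y := y + (h y - ell y) *: e.
have sphi : smooth_on P phi.
  apply: smooth_onD => //; first exact: smooth_on_id.
  apply: smooth_onZ => //; last exact: smooth_on_cst.
  by apply: smooth_onB => //; exact: smooth_on_lin.
have lphi y : ell (phi y) = h y.
  rewrite /phi linearD linearZ /= le /GRing.scale /= mulr1; ring.
pose a (z : V * R^o) := z.1 + z.2 *: e.
have sa : smooth_on setT a.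
  apply: smooth_onD; [exact: openT|exact: smooth_on_fst|].
  by apply: smooth_onZ; [exact: openT|exact: smooth_on_snd|exact: smooth_on_cst].
pose Q := setT `&` a @^-1` P.
have oQ : open Q.
  apply: open_setI_preimage => //; [exact: openT|exact: smooth_on_continuous].
(* To invert [phi] at [z] is to find [t] with [h (z + t e) = ell z]: one scalar unknown. *)
pose H z : R^o := h (a z) - ell z.1.
have bVR : has_basis (V * R^o)%type.
  by apply: has_basis_prod => //; exact: has_basis_real.
have sH : smooth_on Q H.
  apply: smooth_onB => //.
    apply: (@smooth_on_comp _ _ _ _ _ P) => //; first by move=> z [].
    exact: smooth_on_restrict sa.
  apply: (@smooth_on_comp _ _ _ _ _ setT) => //; first exact: smooth_on_fst.
  exact: smooth_on_lin.
pose t0 : R := - (h v - ell v).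
have aphi y : a (phi y, - (h y - ell y) : R^o) = y.
  by rewrite /a /phi /= scaleNr addrK.
have Hphi y : H (phi y, - (h y - ell y) : R^o) = 0.
  by rewrite /H aphi /= lphi subrr.
have Qz : Q (phi v, t0 : R^o) by split => //=; rewrite /t0 aphi.
have DH : 'D_(0, 1 : R^o) H (phi v, t0 : R^o) != 0.
  have dh : differentiable h v by exact: smooth_on_differentiable sh _ Pv.
  have dH : differentiable H (phi v, t0 : R^o) by exact: smooth_on_differentiable sH _ Qz.
  have zE (s : R) : (phi v, t0 : R^o) + s *: (0, 1 : R^o) = (phi v, t0 + s : R^o).
    by apply/pair_equal_spec; split;
      rewrite /= ?scaler0 ?addr0 // /GRing.scale /= mulr1.
  have D1 : is_derive (0 : R) 1 (fun s : R => H ((phi v, t0 : R^o) + s *: (0, 1 : R^o)))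
      ('D_(0, 1 : R^o) H (phi v, t0 : R^o)).
    by have := @is_derive_line _ _ _ H (phi v, t0 : R^o) (0, 1 : R^o) 0;
       rewrite scale0r addr0; apply.
  have D2 : is_derive (0 : R) 1 (fun s : R => h (v + s *: e)) ('D_e h v).
    by have := @is_derive_line _ _ _ h v e 0; rewrite scale0r addr0; apply.
  have E : (fun s : R => H ((phi v, t0 : R^o) + s *: (0, 1 : R^o))) =
      (fun s : R => h (v + s *: e)) - cst (ell (phi v)) :> (R -> R).
    apply/funext => s; rewrite zE /H /a /= scalerDl addrA fctE; congr (h (_ + _) - _).
    by rewrite /phi /t0 scaleNr addrK.
  have D3 := is_deriveB D2 (is_derive_cst (ell (phi v)) (0 : R) 1).
  by move: D1; rewrite E => -[_ <-]; case: D3 => _ ->; rewrite subr0.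
have [U [g [d [[oU Uv] d0 gv Hg sg]]]] := implicit_function bV oQ sH Qz (Hphi v) DH.
pose psi z := z + g z *: e.
have spsi : smooth_on U psi.
  apply: smooth_onD => //; first exact: smooth_on_id.
  by apply: smooth_onZ => //; exact: smooth_on_cst.
(* On [O] the parameter that leads from [phi y] back to [y] lies within the uniqueness radius [d],
   so it equals [g (phi y)], and [psi] undoes [phi]. *)
pose O := P `&` (fun y => (phi y, - (h y - ell y) : R^o)) @^-1` (U `*` ball (t0 : R^o) d).
have oO : open O.
  apply: open_setI_preimage => //; last first.
    by apply: open_setX => //; exact: ball_open.
  apply: smooth_on_continuous; apply: smooth_on_pair => //.
  by apply: smooth_onN => //; apply: smooth_onB => //; exact: smooth_on_lin.
have OU y : O y -> U (phi y) by case=> _ [].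
have psiK y : O y -> psi (phi y) = y.
  move=> [Py [/= Uy yd]]; rewrite /psi -((Hg _ Uy).2 (- (h y - ell y))) //.
    by rewrite /phi scaleNr addrK.
  by move: yd; rewrite -ball_normE /= distrC.
have phiK z : U z -> phi (psi z) = z.
  move=> Uz; have [Hz _] := Hg _ Uz; rewrite /phi.
  have -> : h (psi z) = ell z by apply/eqP; rewrite -subr_eq0; apply/eqP.
  have -> : ell z - ell (psi z) = - (g z : R).
    by rewrite /psi linearD linearZ /= le /GRing.scale /= mulr1; ring.
  by rewrite scaleNr addrK.
have imE : phi @` O = U `&` psi @^-1` O.
  apply/seteqP; split=> [_ [y Oy <-]|z [Uz Oz]].
    by split; [exact: OU|rewrite /= psiK].
  by exists (psi z) => //; exact: phiK.
exists O, phi, psi; split=> //.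
- by split=> //; split=> //=; exact: ballxx.
- by move=> y [].
- split=> //.
  + rewrite imE; apply: open_setI_preimage => //; exact: smooth_on_continuous.
  + by apply: smooth_on_restrict sphi => y [].
  + by apply: smooth_on_restrict spsi; rewrite imE => y [].
Qed.

(** * Homogeneous functions and Minkowski norms *)

Section SecondVariation.
Context {R : realType} {V : normedModType R}.
Implicit Types (f : V -> R^o) (O : set V).

Lemma is_derive_line0 f v u : differentiable f v ->
  is_derive (0 : R) 1 (fun s : R => f (v + s *: u)) ('D_u f v).
Proof.
by move=> df; have := @is_derive_line _ _ _ f v u 0; rewrite scale0r addr0; apply.
Qed.

Lemma continuous_line (v u : V) : continuous (fun s : R => v + s *: u).
Proof.
move=> s; apply: differentiable_continuous; apply: differentiableD.
  exact: differentiable_cst.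
exact: (@ex_diff _ _ _ _ _ _ _ (is_diff_scalel s u)).
Qed.

Lemma near_line O (v u : V) : open O -> O v -> \forall s \near (0 : R), O (v + s *: u).
Proof.
move=> oO Ov; apply: (@continuous_line v u 0).
by rewrite scale0r addr0; exact: open_nbhs_nbhs.
Qed.

(** Trades the nested one-variable derivatives for directional ones, to which linearity and product
    rules apply. Openness of [O] lets the inner derivative be rewritten for all small [r]. *)
Lemma second_variationE f O v u w : open O -> smooth_on O f -> O v ->
  second_variation f v u w = 2^-1 * 'D_u (fun x => 'D_w f x) v.
Proof.
move=> oO sf Ov; rewrite /second_variation derive1E.
have -> : 'D_1 (fun r : R => derive1 (fun s : R => f (v + r *: u + s *: w)) 0) 0 =
    'D_1 (fun r : R => 'D_w f (v + r *: u)) 0.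
  apply: near_eq_derive; apply: filterS (near_line u oO Ov) => r Or.
  rewrite derive1E.
  by have [_ ->] := is_derive_line0 w (smooth_on_differentiable sf Or).
have dw := smooth_on_differentiable (smooth_on_derive w sf) Ov.
by have [_ ->] := is_derive_line0 u dw.
Qed.

Lemma deriveDl O f v u w : smooth_on O f -> O v ->
  'D_(u + w) f v = 'D_u f v + 'D_w f v.
Proof.
move=> sf Ov; have df := smooth_on_differentiable sf Ov.
by rewrite !(deriveE _ df) linearD.
Qed.

Lemma deriveZl O f v (a : R) u : smooth_on O f -> O v ->
  'D_(a *: u) f v = a * 'D_u f v.
Proof.
move=> sf Ov; have df := smooth_on_differentiable sf Ov.
by rewrite !(deriveE _ df) linearZ.
Qed.

Lemma near_eq_derive_on O (f g : V -> R^o) v u : open O -> O v ->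
  (forall x, O x -> f x = g x) -> 'D_u f v = 'D_u g v.
Proof.
by move=> oO Ov fg; apply: near_eq_derive; apply: filterS fg _; exact: open_nbhs_nbhs.
Qed.

Lemma derive2Dr O f v u w z : open O -> smooth_on O f -> O v ->
  'D_z ('D_(u + w) f) v = 'D_z ('D_u f) v + 'D_z ('D_w f) v.
Proof.
move=> oO sf Ov.
rewrite (@near_eq_derive_on O _ (fun x => 'D_u f x + 'D_w f x)) //; last first.
  by move=> x Ox; exact: deriveDl sf Ox.
have d y : derivable ('D_y f) v z.
  exact: diff_derivable (smooth_on_differentiable (smooth_on_derive y sf) Ov).
exact: deriveD.
Qed.

Lemma derive2Zr O f v (a : R) u z : open O -> smooth_on O f -> O v ->
  'D_z ('D_(a *: u) f) v = a * 'D_z ('D_u f) v.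
Proof.
move=> oO sf Ov.
rewrite (@near_eq_derive_on O _ (a \*: (fun x => 'D_u f x))) //; last first.
  by move=> x Ox; exact: deriveZl sf Ox.
have d y : derivable ('D_y f) v z.
  exact: diff_derivable (smooth_on_differentiable (smooth_on_derive y sf) Ov).
exact: deriveZ.
Qed.

Lemma derive_mul O f g v u : smooth_on O f -> smooth_on O g -> O v ->
  'D_u (fun x => f x * g x : R^o) v = f v * 'D_u g v + 'D_u f v * g v.
Proof.
move=> sf sg Ov; rewrite (@deriveM _ _ f g).
- by rewrite /GRing.scale /= (mulrC (g v)).
- exact: diff_derivable (smooth_on_differentiable sf Ov).
- exact: diff_derivable (smooth_on_differentiable sg Ov).
Qed.

End SecondVariation.

Section Homogeneous.
Context {R : realType} {V : normedModType R}.

Definition nonzero : set V := [set v | v != 0].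

Lemma open_nonzero : open nonzero.
Proof.
rewrite (_ : nonzero = (fun v : V => `|v|) @^-1` [set x | 0 < x]).
  by apply: open_comp; [move=> v _; exact: norm_continuous|exact: open_gt].
by apply/seteqP; split=> v; rewrite /nonzero /= normr_gt0.
Qed.

Variables (k : nat) (Q : V -> R^o).
Hypotheses (sQ : smooth_on nonzero Q)
  (hQ : forall (a : R) v, 0 < a -> v != 0 -> Q (a *: v) = a ^+ k * Q v).

(** Both sides are the derivative at [s = 0] of [Q ((1 + s) v) = (1 + s) ^ k * Q v], valid while
    [1 + s] is positive. *)
Lemma euler v : v != 0 -> 'D_v Q v = k%:R * Q v.
Proof.
move=> v0; have [_ <-] := is_derive_line0 v (smooth_on_differentiable sQ v0).
have -> : 'D_1 (fun s : R => Q (v + s *: v)) 0 =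
    'D_1 (fun s : R => (cst 1 + id) s ^+ k * Q v : R^o) 0.
  apply: near_eq_derive; near=> s.
  have s1 : 0 < 1 + s.
    have : `|s| < 1 by near: s; exact: (@nbhs0_lt _ R^o).
    by rewrite ltr_norml => /andP[? _]; lra.
  by rewrite -hQ // scalerDl scale1r.
case: k => [|m].
  by rewrite mul0r (_ : (fun _ => _) = cst (Q v)) ?derive_cst // ; apply/funext => s; rewrite expr0 mul1r.
have D : is_derive (0 : R) 1 ((cst 1 + id : R -> R) ^+ m.+1 * cst (Q v)) (m.+1%:R * Q v).
  apply: is_derive_eq; rewrite /GRing.scale /= !fctE addr0 expr1n.
  by rewrite expr1n; ring.
rewrite (_ : (fun s => _) = ((cst 1 + id : R -> R) ^+ m.+1 * cst (Q v) : R -> R)).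
  by case: D.
by apply/funext => s; rewrite !fctE.
Unshelve. all: by end_near. Qed.

(** Homogeneity of degree [k - 1] for the derivative, with a factor [a] on the left to avoid the
    subtraction. *)
Lemma homogeneous_derive (a : R) v u : 0 < a -> v != 0 ->
  a * 'D_u Q (a *: v) = a ^+ k * 'D_u Q v.
Proof.
move=> a0 v0; have av0 : a *: v != 0 by rewrite scaler_eq0 gt_eqF.
rewrite -(deriveZl _ _ sQ av0).
have [_ <-] := is_derive_line0 (a *: u) (smooth_on_differentiable sQ av0).
rewrite (@near_eq_derive _ _ _ _ (a ^+ k \*: (fun s : R => Q (v + s *: u)))); last first.
  apply: filterS (near_line u open_nonzero v0) => s s0.
  by rewrite scalerA (mulrC s) -scalerA -scalerDr hQ.
have [d <-] := is_derive_line0 u (smooth_on_differentiable sQ v0).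
exact: deriveZ.
Qed.

End Homogeneous.

Section Homogeneous2.
Context {R : realType} {V : normedModType R} (k : nat) (Q : V -> R^o).
Hypotheses (sQ : smooth_on (@nonzero _ V) Q)
  (hQ : forall (a : R) v, 0 < a -> v != 0 -> Q (a *: v) = a ^+ k.+1 * Q v).

(** Euler's relation for ['D_u Q], which is homogeneous of degree [k]. *)
Lemma euler_derive v u : v != 0 -> 'D_v ('D_u Q) v = k%:R * 'D_u Q v.
Proof.
move=> v0; apply: (euler (smooth_on_derive u sQ)) => // a w a0 w0.
apply: (mulfI (lt0r_neq0 a0)); rewrite (homogeneous_derive sQ hQ) // exprS mulrA //.
Qed.

(* Differentiate Euler's relation [D_x Q x = (k + 1) Q x] in [x]. *)
Lemma derive_euler v u : v != 0 -> 'D_u ('D_v Q) v = k%:R * 'D_u Q v.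
Proof.
move=> v0.
have D1 (s : R) : v + s *: u != 0 -> 'D_v Q (v + s *: u) + s * 'D_u Q (v + s *: u) =
    k.+1%:R * Q (v + s *: u).
  move=> s0; rewrite -(deriveZl _ _ sQ s0) -(deriveDl _ _ sQ s0).
  exact: (euler sQ hQ).
have dv : is_derive (0 : R) 1 (fun s : R => 'D_v Q (v + s *: u)) ('D_u ('D_v Q) v).
  exact: (is_derive_line0 u (smooth_on_differentiable (smooth_on_derive v sQ) v0)).
have du : is_derive (0 : R) 1 (fun s : R => 'D_u Q (v + s *: u)) ('D_u ('D_u Q) v).
  exact: (is_derive_line0 u (smooth_on_differentiable (smooth_on_derive u sQ) v0)).
have dQ := is_derive_line0 u (smooth_on_differentiable sQ v0).
have D2 : is_derive (0 : R) 1 (fun s : R => 'D_v Q (v + s *: u) + s * 'D_u Q (v + s *: u) : R)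
   ('D_u ('D_v Q) v + 'D_u Q v).
  have dM := is_deriveM (is_derive_id (0 : R) 1) du.
  apply: (is_derive_eq (is_deriveD dv dM)).
  by rewrite (scale0r u) (addr0 v) scale0r add0r /GRing.scale /= mulr1.
have D3 := is_deriveZ (k.+1%:R : R) dQ.
have E : 'D_u ('D_v Q) v + 'D_u Q v = k.+1%:R * 'D_u Q v.
  have [_ <-] := D2; have [_ D3E] := D3.
  rewrite -[RHS]/(k.+1%:R *: 'D_u Q v) -D3E; apply: near_eq_derive.
  by apply: filterS (near_line u open_nonzero v0) => s /D1.
by apply/eqP; rewrite -(inj_eq (addIr ('D_u Q v))) E mulrS mulrDl mul1r addrC.
Qed.

End Homogeneous2.

Lemma derive_gt0_right (R : realType) (f : R -> R) (l : R) :
  is_derive (0 : R) 1 f l -> 0 < l -> \forall s \near (0 : R)^'+, f 0 < f s.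
Proof.
move=> [df <-] D0; move: df; rewrite /derivable => /cvg_ex[l' Hl].
have lE : 'D_1 f 0 = l' by apply/cvg_lim.
have Hr : h^-1 *: (f (h *: 1 + 0) - f 0) @[h --> (0:R)^'+] --> l'.
  exact: cvg_dnbhs_at_right Hl.
rewrite lE in D0; have Hn := cvgr_gt _ Hr _ D0.
near=> s.
have s0 : 0 < s by near: s; exact: nbhs_right_gt.
have : 0 < s^-1 *: (f (s *: 1 + 0) - f 0) by near: s; exact: Hn.
by rewrite addr0 /GRing.scale /= mulr1 pmulr_rgt0 ?invr_gt0 // subr_gt0.
Unshelve. all: by end_near. Qed.

Lemma derive_ge0_right (R : realType) (f : R -> R) (l : R) :
  is_derive (0 : R) 1 f l -> (\forall s \near (0 : R)^'+, f 0 <= f s) -> 0 <= l.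
Proof.
move=> Df fs; rewrite leNgt -oppr_gt0; apply/negP => l0.
have : \forall s \near (0 : R)^'+, False.
  apply: filterS2 (derive_gt0_right (is_deriveN Df) l0) fs => s.
  by rewrite !fctE ltrN2 ltNge => /negP.
by move=> /filter_ex[].
Qed.

Definition minkowski_norm (R : realType) (V : normedModType R) (F : V -> R^o) :=
  [/\ smooth_on (@nonzero _ V) F, F 0 = 0, forall v, v != 0 -> 0 < F v,
      forall (a : R) v, 0 < a -> F (a *: v) = a * F v
    & forall v u, v != 0 -> u != 0 ->
        0 < second_variation (fun x => F x ^+ 2) v u u].

Section Minkowski.
Context {R : realType} {V : normedModType R} (F : V -> R^o).
Hypothesis mF : minkowski_norm F.

Let sF : smooth_on (@nonzero _ V) F. Proof. by case: mF. Qed.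
Let F0 : F 0 = 0. Proof. by case: mF. Qed.
Let Fgt0 v : v != 0 -> 0 < F v. Proof. by case: mF => _ _ /(_ v). Qed.
Let Fh (a : R) v : 0 < a -> F (a *: v) = a * F v. Proof. by case: mF => _ _ _ /(_ a v). Qed.
Let oN : open (@nonzero _ V). Proof. exact: open_nonzero. Qed.

Let E v : R^o := F v * F v.

Lemma minkowski_ge0 v : 0 <= F v.
Proof. by have [->|/Fgt0/ltW//] := eqVneq v 0; rewrite F0. Qed.

Let sE : smooth_on (@nonzero _ V) E.
Proof. exact: smooth_onM. Qed.

Let dE v u : v != 0 -> 'D_u E v = 2 * F v * 'D_u F v.
Proof. by move=> v0; rewrite (derive_mul _ sF sF v0); ring. Qed.

Let d2E v u : v != 0 ->
  'D_u ('D_u E) v = 2 * ('D_u F v * 'D_u F v + F v * 'D_u ('D_u F) v).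
Proof.
move=> v0.
rewrite (@near_eq_derive_on _ _ (@nonzero _ V) _ (fun x => (2 * F x) * 'D_u F x : R^o)) //; last by move=> x; exact: dE.
rewrite (@derive_mul _ _ (@nonzero _ V) (fun x => 2 * F x)) //; last first.
- exact: smooth_on_derive.
- by apply: smooth_onM => //; exact: smooth_on_cst.
rewrite (@derive_mul _ _ (@nonzero _ V) (cst 2)) ?derive_cst //; last exact: smooth_on_cst.
by rewrite /cst; ring.
Qed.

Let d2E_gt0 v u : v != 0 -> u != 0 -> 0 < 'D_u ('D_u E) v.
Proof.
move=> v0 u0; case: mF => _ _ _ _ /(_ v u v0 u0).
rewrite (_ : (fun x => _) = E); last by apply/funext => x; rewrite expr2.
by rewrite (second_variationE _ _ oN sE v0) pmulr_rgt0 ?invr_gt0.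
Qed.

Lemma minkowski_derive0 (a : R) v u : 0 < a -> v != 0 -> 'D_u F (a *: v) = 'D_u F v.
Proof.
move=> a0 v0; apply: (mulfI (lt0r_neq0 a0)).
by rewrite (homogeneous_derive (k := 1) sF) // => b w b0 w0; rewrite Fh ?expr1.
Qed.

Lemma minkowski_euler v : v != 0 -> 'D_v F v = F v.
Proof.
move=> v0; rewrite (euler (k := 1) sF) ?mul1r // => b w b0 w0; rewrite Fh ?expr1 //.
Qed.

(** Convexity of [F ^ 2] along a segment missing 0, the only point where smoothness fails. Two mean
    values are used: one for the increment of [E], one for that of its derivative. *)
Lemma tangent_line_le v d : (forall t : R, 0 <= t <= 1 -> v + t *: d != 0) ->
  E v + 'D_d E v <= E (v + d).
Proof.
move=> nz.
have [||c /andP[c0 c1] Ec] := @mean_value _ (fun t : R => E (v + t *: d))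
    (fun t : R => 'D_d E (v + t *: d)) 0 1.
- by [].
- move=> t /nz n; exact: is_derive_line (smooth_on_differentiable sE n).
- have [||b /andP[b0 b1] Eb] := @mean_value _ (fun t : R => 'D_d E (v + t *: d))
    (fun t : R => 'D_d ('D_d E) (v + t *: d)) 0 c.
  + by [].
  + move=> t /andP[t0 tc]; have n : v + t *: d != 0 by apply: nz; rewrite t0 (le_trans tc) // ltW.
    exact: (is_derive_line (smooth_on_differentiable (smooth_on_derive d sE) n)).
  + move: Ec Eb; rewrite !scale0r !addr0 !scale1r subr0 mulr1 => Ec Eb.
    have bn : v + b *: d != 0 by apply: nz; rewrite (ltW b0) (ltW (lt_trans b1 c1)).
    have [d0|d0] := eqVneq d 0.
      by rewrite d0 derive0 !addr0.
    have : 0 <= 'D_d E (v + c *: d) - 'D_d E v.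
      by rewrite Eb subr0 mulr_ge0 //; apply: ltW => //; exact: d2E_gt0.
    by rewrite subr_ge0 -Ec => h; rewrite -lerBrDl.
Qed.

(* The tangent line to [F ^ 2] at a multiple of [x] on the level of [y]. *)
Lemma fundamental_inequality x y : x != 0 -> 'D_y F x <= F y.
Proof.
move=> x0; have [->|y0] := eqVneq y 0; first by rewrite derive0 F0.
have Fx := Fgt0 x0; have Fy := Fgt0 y0.
(* Rescaling [x] leaves ['D_y F] unchanged and achieves [F v = F y]; the tangent line inequality
   then reads [2 F y * ('D_y F v - F y) <= 0]. *)
pose a := F y / F x; have a0 : 0 < a by rewrite divr_gt0.
pose v := a *: x; have v0 : v != 0 by rewrite scaler_eq0 gt_eqF.
have Fv : F v = F y by rewrite /v Fh // /a divfK // gt_eqF.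
rewrite -(minkowski_derive0 y a0 x0) -/v.
have [nz|] := pselect (forall t : R, 0 <= t <= 1 -> v + t *: (y - v) != 0).
  have := tangent_line_le nz; rewrite (addrC v) subrK dE //.
  have -> : 'D_(y - v) F v = 'D_y F v - F v.
    rewrite (deriveDl _ _ sF v0) -[- v]scaleN1r (deriveZl _ _ sF v0).
    by rewrite minkowski_euler // mulN1r.
  rewrite /E Fv => H; have : 2 * F y * ('D_y F v - F y) <= 0 by lra.
  by rewrite pmulr_rle0 ?mulr_gt0 // subr_le0.
(* If the segment from [v] to [y] meets 0, then [y] is a nonpositive multiple of [v], and Euler's
   relation makes ['D_y F v] nonpositive. *)
move=> /existsNP[t /not_implyP[/andP[t0 t1] /negP/negPn/eqP tz]].
have {}tz : t *: y = - (1 - t) *: v.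
  apply/eqP; rewrite -subr_eq0 -tz scaleNr opprK scalerBl scale1r scalerBr.
  by rewrite addrC -addrA [- _ + _]addrC.
have tn : t != 0.
  apply: contra_neq v0 => tz0; move: tz; rewrite tz0 subr0 scale0r scaleN1r => /esym/eqP.
  by rewrite oppr_eq0 => /eqP.
have tp : 0 < t by rewrite lt_neqAle eq_sym tn.
have : t * 'D_y F v <= 0.
  rewrite -(deriveZl _ _ sF v0) tz (deriveZl _ _ sF v0) minkowski_euler //.
  by rewrite mulNr oppr_le0 mulr_ge0 ?subr_ge0 // ltW ?Fv.
rewrite pmulr_rle0 // => /le_trans; apply; exact: ltW.
Qed.

(** By Euler, [F (x + y)] is the derivative of [F] at [x + y] along [x + y]; split the direction and
    bound each part by the fundamental inequality. *)
Lemma minkowski_triangle x y : F (x + y) <= F x + F y.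
Proof.
have [->|n] := eqVneq (x + y) 0; first by rewrite F0 addr_ge0 ?minkowski_ge0.
by rewrite -(minkowski_euler n) (deriveDl _ _ sF n) lerD ?fundamental_inequality.
Qed.

(** Positivity for [F ^ 2] does not give this directly, because of the extra square of ['D_u F].
    Instead the fundamental inequality at [v] and at [v + s u] encloses [F (v + s u) - F v], which
    shows that ['D_u F] does not decrease along [u]. *)
Lemma minkowski_derive2_ge0 v u : v != 0 -> 0 <= 'D_u ('D_u F) v.
Proof.
move=> v0; apply: (derive_ge0_right (is_derive_line0 u
  (smooth_on_differentiable (smooth_on_derive u sF) v0))).
have : \forall s \near (0 : R)^'+, v + s *: u != 0.
  by apply: cvg_within; exact: (near_line u oN v0).
move=> nz; near=> s.
have s0 : 0 < s by near: s; exact: nbhs_right_gt.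
have w0 : v + s *: u != 0 by near: s.
rewrite scale0r addr0 -(ler_pM2l s0).
have e1 : s * 'D_u F v <= F (v + s *: u) - F v.
  rewrite lerBrDl -[X in X + _]minkowski_euler // -(deriveZl _ _ sF v0).
  by rewrite -(deriveDl _ _ sF v0) fundamental_inequality.
apply: (le_trans e1); rewrite -(deriveZl _ _ sF w0) lerBlDr.
have := fundamental_inequality (v + s *: u - s *: u) w0.
rewrite (deriveDl _ _ sF w0) minkowski_euler // -scaleNr 2!(deriveZl _ _ sF w0).
by rewrite scaleNr addrK mulNr; lra.
Unshelve. all: by end_near. Qed.

(** When ['D_u F v] vanishes, the second derivative of [F ^ 2] reduces to a positive multiple of
    that of [F]. *)
Lemma minkowski_derive2_gt0 v u : v != 0 -> u != 0 -> 'D_u F v = 0 ->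
  0 < 'D_u ('D_u F) v.
Proof.
move=> v0 u0 D0; have := d2E_gt0 v0 u0.
by rewrite d2E // D0 mul0r add0r pmulr_rgt0 // pmulr_rgt0 ?Fgt0.
Qed.

(** The quantity is [G * G'' + G' ^ 2] along [u]: the square is positive unless [G'] vanishes, and
    then [G''] is. *)
Lemma second_variation_sqr_gt0 (G : V -> R^o) v u : smooth_on (@nonzero _ V) G ->
  v != 0 -> 0 < G v -> 0 <= 'D_u ('D_u G) v ->
  ('D_u G v = 0 -> 0 < 'D_u ('D_u G) v) ->
  0 < second_variation (fun x => G x ^+ 2) v u u.
Proof.
move=> sG v0 G0 D2 D2'.
have sq : (fun x => G x ^+ 2) = (fun x => G x * G x : R^o).
  by apply/funext => x; rewrite expr2.
rewrite sq (second_variationE _ _ oN _ v0); last exact: smooth_onM.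
rewrite (@near_eq_derive_on _ _ (@nonzero _ V) _ (fun x => (2 * G x) * 'D_u G x : R^o)) //; last first.
  by move=> x x0; rewrite (derive_mul _ sG sG x0); ring.
have s2G : smooth_on (@nonzero _ V) (fun x => 2 * G x : R^o).
  by apply: smooth_onM => //; exact: smooth_on_cst.
rewrite (derive_mul _ s2G (smooth_on_derive u sG) v0).
rewrite (@derive_mul _ _ (@nonzero _ V) (cst 2)) ?derive_cst //; last exact: smooth_on_cst.
rewrite /cst mul0r addr0.
have -> : 2^-1 * (2 * G v * 'D_u ('D_u G) v + 2 * 'D_u G v * 'D_u G v) =
    G v * 'D_u ('D_u G) v + 'D_u G v * 'D_u G v by field.
have [D0|Dn] := eqVneq ('D_u G v) 0.
  by rewrite D0 mulr0 addr0 mulr_gt0 // D2'.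
rewrite ltr_wpDl ?mulr_ge0 // ?ltW // -expr2 lt_neqAle eq_sym sqrf_eq0 Dn.
exact: sqr_ge0.
Qed.

End Minkowski.

(** Since [G z] is the only root over [z], it coincides with the local solution supplied by the
    implicit function theorem. *)
Lemma smooth_on_root (R : realType) (Z : normedModType R) (U : set Z)
    (O : set (Z * R^o)) (H : Z * R^o -> R^o) (G : Z -> R^o) :
  has_basis Z -> open U -> open O -> smooth_on O H ->
  (forall z, U z -> [/\ O (z, G z), H (z, G z) = 0,
     'D_(0, 1 : R^o) H (z, G z) != 0 & forall t : R, H (z, t : R^o) = 0 -> t = G z]) ->
  smooth_on U G.
Proof.
move=> bZ oU oO sH HG; apply: smooth_on_local => z Uz.
have [Oz Hz Dz _] := HG z Uz.
have [W [g [d [[oW Wz] d0 gz Hg sg]]]] := implicit_function bZ oO sH Oz Hz Dz.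
exists (W `&` U); split=> //; apply: (@smooth_on_ext _ _ _ _ g).
- exact: openI.
- by move=> y [Wy Uy]; have [_ _ _] := HG y Uy; apply; have [] := Hg y Wy.
- by apply: smooth_on_restrict sg => y [].
Qed.

(** * Zermelo navigation in one tangent space *)

Section Zermelo.
Context {R : realType} {V : normedModType R} (F : V -> R^o) (T : V).
Hypotheses (mF : minkowski_norm F) (cF : continuous F) (FT : F T < 1).

Let sF : smooth_on (@nonzero _ V) F. Proof. by case: mF. Qed.
Let F0 : F 0 = 0. Proof. by case: mF. Qed.
Let Fgt0 v : v != 0 -> 0 < F v. Proof. by case: mF => _ _ /(_ v). Qed.
Let Fh (a : R) v : 0 < a -> F (a *: v) = a * F v. Proof. by case: mF => _ _ _ /(_ a v). Qed.
Let oN : open (@nonzero _ V). Proof. exact: open_nonzero. Qed.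
Let Fge0 v : 0 <= F v. Proof. exact: minkowski_ge0. Qed.

(* Zermelo navigation with wind [- T]: the indicatrix of [zermelo] is that of
   [F] translated by [- T].  The root is unique as [F T < 1]. *)
Definition zermelo (w : V) : R^o := xget 0 [set l | F (w + l *: T) = l].

(** Adding [(b - a) T] raises [F] by at most [(b - a) * F T], which is less than [b - a]. *)
Let decr w (a b : R) : a < b -> F (w + b *: T) - b < F (w + a *: T) - a.
Proof.
move=> ab; have -> : w + b *: T = (w + a *: T) + (b - a) *: T.
  by rewrite scalerBl -addrA subrKC.
have := minkowski_triangle mF (w + a *: T) ((b - a) *: T).
rewrite Fh ?subr_gt0 // => h.
have : (b - a) * F T < b - a by rewrite gtr_pMr // subr_gt0.
lra.
Qed.

Lemma zermeloP w : F (w + zermelo w *: T) = zermelo w.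
Proof.
suff [l Hl] : exists l : R, F (w + l *: T) = l.
  by have := @xgetPex R^o 0 [set l : R^o | F (w + l *: T) = l]; apply; exists l.
have T1 : 0 < 1 - F T by rewrite subr_gt0.
(* Solves [F w + b * F T = b], so the triangle inequality makes [F (w + l T) - l] nonpositive at
   [l = b]; at [l = 0] it is nonnegative. *)
pose b := F w / (1 - F T).
have b0 : 0 <= b by rewrite divr_ge0 // ltW.
have [|||l _ Hl] := @IVT R (fun l => F (w + l *: T) - l) 0 b 0.
- exact: b0.
- apply: continuous_subspaceT => l; apply: cvgB; last exact: cvg_id.
  apply: (@continuous_comp _ _ _ (fun l : R => w + l *: T) F); last exact: cF.
  apply: cvgD; first exact: cvg_cst.
  by apply: cvgZr_tmp; exact: cvg_id.
- rewrite scale0r addr0 subr0 ge_min le_max Fge0 /= andbT orbC.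
  (* Homogeneity covers positive factors only, so [b = 0] is separated. *)
  have [b0'|bn] := eqVneq b 0.
    by rewrite b0' scale0r addr0 subr0; move/eqP: b0'; rewrite mulf_eq0 invr_eq0 (gt_eqF T1) orbF => /eqP ->; rewrite lexx.
  have bp : 0 < b by rewrite lt_neqAle eq_sym bn.
  have := minkowski_triangle mF w (b *: T); rewrite Fh //.
  have : b * (1 - F T) = F w by rewrite divfK // gt_eqF.
  by move=> e1 e2; apply/orP; left; lra.
by exists l; apply/eqP; rewrite -subr_eq0 Hl.
Qed.

Lemma zermelo_unique w (l : R) : F (w + l *: T) = l -> l = zermelo w.
Proof.
move=> Hl; have := zermeloP w; case: (ltgtP l (zermelo w)) => // /(decr w);
  rewrite Hl zermeloP; lra.
Qed.

(** A bound on the root becomes an inequality for [F] at a fixed level [a]; this gives continuity in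
    all variables, zero vectors included. *)
Lemma zermelo_lt w (a : R) : F (w + a *: T) < a <-> zermelo w < a.
Proof.
have := zermeloP w; split=> h; last by have := decr w h; lra.
case: (ltgtP a (zermelo w)) => // [/(decr w)|E]; first lra.
by move: h; rewrite E zermeloP ltxx.
Qed.

Lemma zermelo_gt w (a : R) : a < F (w + a *: T) <-> a < zermelo w.
Proof.
have := zermeloP w; split=> h; last by have := decr w h; lra.
case: (ltgtP a (zermelo w)) => // [/(decr w)|E]; first lra.
by move: h; rewrite E zermeloP ltxx.
Qed.

Lemma zermelo_ge0 w : 0 <= zermelo w.
Proof. by rewrite -zermeloP. Qed.

(** If the point were 0, the root would be [F 0 = 0] and so [w = 0]. Hence [F] is smooth wherever it
    is evaluated. *)
Lemma zermelo_point_neq0 w : w != 0 -> w + zermelo w *: T != 0.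
Proof.
apply: contra_neq => E; have := zermeloP w; rewrite E F0 => Z.
by move: E; rewrite -Z scale0r addr0.
Qed.

Lemma zermelo_gt0 w : w != 0 -> 0 < zermelo w.
Proof. by move=> /zermelo_point_neq0/Fgt0; rewrite zermeloP. Qed.

Lemma zermeloZ (a : R) w : 0 < a -> zermelo (a *: w) = a * zermelo w.
Proof.
move=> a0; apply/esym/zermelo_unique.
by rewrite -scalerA -scalerDr Fh // zermeloP.
Qed.

(** Makes the derivative in [l] of [F (w + l T) - l] negative: nondegeneracy for the implicit
    function theorem, and the sign of the factor in [zermelo_derive2]. *)
Lemma minkowski_derive_wind v : v != 0 -> 'D_T F v < 1.
Proof. by move=> v0; apply: le_lt_trans FT; exact: fundamental_inequality. Qed.

(** Supplied later by [smooth_fiber_zermelo], from joint smoothness in the coordinates of TM. *)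
Hypothesis sG : smooth_on (@nonzero _ V) zermelo.

Let Y x := x + zermelo x *: T.
Let Y0 x : x != 0 -> Y x != 0. Proof. exact: zermelo_point_neq0. Qed.

Let dY x u : x != 0 -> is_derive x u Y (u + 'D_u zermelo x *: T).
Proof.
move=> x0; have dG := smooth_on_differentiable sG x0.
have D : is_diff x (fun z => zermelo z *: T)
    (fun z => zermelo x *: 0 + 'd zermelo x z *: T).
  by apply: is_diff_scale; exact: differentiableP.
have dG1 : is_derive x u (fun z => zermelo z *: T) ('D_u zermelo x *: T).
  apply: DeriveDef; first by apply: diff_derivable; case: D.
  by rewrite (is_diff_derive _ D) scaler0 add0r (deriveE _ dG).
exact: (is_deriveD (is_derive_id x u) dG1).
Qed.

Let sY : smooth_on (@nonzero _ V) Y.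
Proof.
apply: smooth_onD => //; first exact: smooth_on_id.
by apply: smooth_onZ => //; exact: smooth_on_cst.
Qed.

Let comp_Y (f : V -> R^o) x u : smooth_on (@nonzero _ V) f -> x != 0 ->
  'D_u (fun x => f (Y x)) x = 'D_(u + 'D_u zermelo x *: T) f (Y x).
Proof.
move=> sf x0; have dYx := smooth_on_differentiable sY x0.
have df := smooth_on_differentiable sf (Y0 x0).
rewrite -[LHS]/('D_u (f \o Y) x) (derive_comp _ dYx df).
by have [_ ->] := dY u x0.
Qed.

Lemma zermelo_derive x u : x != 0 ->
  'D_u zermelo x = 'D_(u + 'D_u zermelo x *: T) F (Y x).
Proof.
move=> x0; rewrite -comp_Y //; apply: (near_eq_derive_on _ oN) => // z _.
by rewrite /Y zermeloP.
Qed.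

(* Differentiate [zermelo_derive] once more along [u]. *)
Lemma zermelo_derive2 x u : x != 0 -> let xi := u + 'D_u zermelo x *: T in
  (1 - 'D_T F (Y x)) * 'D_u ('D_u zermelo) x = 'D_xi ('D_xi F) (Y x).
Proof.
move=> x0 xi; have yx := Y0 x0.
have E z : z != 0 -> 'D_u zermelo z = 'D_u F (Y z) + 'D_u zermelo z * 'D_T F (Y z).
  move=> z0; rewrite {1}zermelo_derive // (deriveDl _ _ sF (Y0 z0)).
  by rewrite (deriveZl _ _ sF (Y0 z0)).
have sDu := smooth_on_derive u sF; have sDT := smooth_on_derive T sF.
have dc (f : V -> R^o) : smooth_on (@nonzero _ V) f -> derivable (fun z => f (Y z)) x u.
  move=> sf; apply: diff_derivable.
  exact: (differentiable_comp (smooth_on_differentiable sY x0)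
    (smooth_on_differentiable sf yx)).
have dG : derivable ('D_u zermelo) x u.
  exact: diff_derivable (smooth_on_differentiable (smooth_on_derive u sG) x0).
have E1 : 'D_u ('D_u zermelo) x = 'D_xi ('D_u F) (Y x) +
    ('D_u zermelo x * 'D_xi ('D_T F) (Y x) + 'D_T F (Y x) * 'D_u ('D_u zermelo) x).
  rewrite -(comp_Y u sDu x0) -(comp_Y u sDT x0) [LHS](near_eq_derive_on u oN x0 E).
  by rewrite (deriveD (dc _ sDu) (derivableM dG (dc _ sDT))) (deriveM dG (dc _ sDT)).
(* [xi] is a fixed vector, its coefficient being frozen at [x], so linearity in the direction
   applies. *)
have E2 : 'D_xi ('D_xi F) (Y x) =
    'D_xi ('D_u F) (Y x) + 'D_u zermelo x * 'D_xi ('D_T F) (Y x).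
  have s := derive2Zr ('D_u zermelo x) T xi oN sF yx.
  by rewrite -s; exact: (derive2Dr u _ xi oN sF yx).
rewrite E2; move: E1; move: ('D_u ('D_u zermelo) x) ('D_T F (Y x)).
move: ('D_xi ('D_u F) (Y x)) ('D_u zermelo x * 'D_xi ('D_T F) (Y x)) => a b c d.
by move=> E1; rewrite mulrBl mul1r {1}E1 addrA addrK.
Qed.

(** The positive factor of [zermelo_derive2] transfers convexity from [F]; where ['D_u zermelo]
    vanishes, [xi] is [u] itself, and strictness transfers too. *)
Lemma zermelo_second_variation v u : v != 0 -> u != 0 ->
  0 < second_variation (fun x => zermelo x ^+ 2) v u u.
Proof.
move=> v0 u0.
have D1 : 0 < 1 - 'D_T F (Y v) by rewrite subr_gt0; exact: minkowski_derive_wind (Y0 v0).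
have E := zermelo_derive2 u v0.
apply: (second_variation_sqr_gt0 sG v0); first exact: zermelo_gt0.
  by rewrite -(pmulr_rge0 _ D1) E; exact: minkowski_derive2_ge0 (Y0 v0).
move=> D0; rewrite -(pmulr_rgt0 _ D1) E D0 scale0r addr0.
apply: (minkowski_derive2_gt0 mF (Y0 v0) u0).
by have := zermelo_derive u v0; rewrite D0 scale0r addr0.
Qed.

End Zermelo.

(** * The cone of one tangent space *)

Section Cone.
Context {R : realType} {V : normedModType R}.
Variables (F : V -> R^o) (om : {linear V -> R^o}).
Hypotheses (mF : minkowski_norm F) (cF : continuous F) (com : continuous om).
Hypothesis transverse : forall v, F v = 1 -> om v = 1 -> exists2 u, 'D_u F v = 0 & om u != 0.

Let sF : smooth_on (@nonzero _ V) F. Proof. by case: mF. Qed.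
Let F0 : F 0 = 0. Proof. by case: mF. Qed.
Let Fgt0 v : v != 0 -> 0 < F v. Proof. by case: mF => _ _ /(_ v). Qed.
Let Fh (a : R) v : 0 < a -> F (a *: v) = a * F v. Proof. by case: mF => _ _ _ /(_ a v). Qed.
Let oN : open (@nonzero _ V). Proof. exact: open_nonzero. Qed.

(** Inside the cone [v] itself works, by Euler. On the boundary, scale [v] to the indicatrix:
    transversality gives a direction tangent to it on which [om] is nonzero, up to a change of
    sign. *)
Lemma cone_direction v : v != 0 -> F v <= om v -> exists u, 'D_u F v < om u.
Proof.
move=> v0; rewrite le_eqVlt => /orP[/eqP E|lt]; last first.
  by exists v; rewrite (minkowski_euler mF v0).
have c0 := Fgt0 v0.
have ci0 : 0 < (F v)^-1 by rewrite invr_gt0.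
have [||u D0 u0] := transverse (v := (F v)^-1 *: v).
- by rewrite Fh // mulVf ?gt_eqF.
- by rewrite linearZ /= -E /GRing.scale /= mulVf ?gt_eqF.
rewrite (minkowski_derive0 mF u ci0 v0) in D0.
move: u0; rewrite neq_lt => /orP[neg|pos]; last by exists u; rewrite D0.
exists (-1 *: u); rewrite (deriveZl _ _ sF v0) D0 mulr0 linearZ /= scaleN1r.
by rewrite oppr_gt0.
Qed.

Lemma cone_height_derive v u : v != 0 ->
  is_derive (0 : R) 1 (fun s : R => om (v + s *: u) - F (v + s *: u))
  (om u - 'D_u F v).
Proof.
move=> v0; have D1 := is_derive_line0 u (smooth_on_differentiable sF v0).
have D2 : is_derive (0 : R) 1 (fun s : R => om (v + s *: u)) (om u).
  have := is_derive_line0 u (linear_differentiable v com).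
  by rewrite (deriveE _ (linear_differentiable v com)) diff_lin.
exact: is_deriveB D2 D1.
Qed.

Lemma cone_enter v u : v != 0 -> F v <= om v -> 'D_u F v < om u ->
  \forall s \near (0 : R)^'+, F (v + s *: u) < om (v + s *: u).
Proof.
move=> v0 le D; have D' : 0 < om u - 'D_u F v by rewrite subr_gt0.
apply: filterS (derive_gt0_right (cone_height_derive u v0) D') => s.
by rewrite scale0r addr0 => h; rewrite -subr_gt0; apply: le_lt_trans h; rewrite subr_ge0.
Qed.

Lemma cone_leave v u : v != 0 -> F v = om v -> 'D_u F v < om u ->
  \forall s \near (0 : R)^'+, om (v + s *: - u) < F (v + s *: - u).
Proof.
move=> v0 E D.
have D' : 0 < - (om (- u) - 'D_(- u) F v).
  by rewrite linearN -(scaleN1r u) (deriveZl _ _ sF v0) mulN1r; lra.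
have DN := is_deriveN (cone_height_derive (- u) v0).
apply: filterS (derive_gt0_right DN D') => s.
by rewrite !fctE scale0r addr0 E subrr oppr0 oppr_gt0 subr_lt0.
Qed.

Definition open_cone := [set v : V | F v < om v].
Definition closed_cone := [set v : V | v != 0 /\ F v <= om v].

Lemma open_cone_nonzero : open_cone `<=` (@nonzero _ V).
Proof.
move=> v; rewrite /open_cone /nonzero /=; apply: contraTneq => ->.
by rewrite F0 linear0 ltxx.
Qed.

Lemma open_open_cone : open open_cone.
Proof.
rewrite (_ : open_cone = (fun v => om v - F v) @^-1` [set x | 0 < x]).
  apply: open_comp; last exact: open_gt.
  by move=> v _; apply: cvgB; [exact: com|exact: cF].
by apply/seteqP; split=> v; rewrite /open_cone /= subr_gt0.
Qed.

Lemma cone_shift (P : V -> Prop) v u :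
  (\forall s \near (0 : R)^'+, P (v + s *: u)) -> closure P v.
Proof.
move=> Ps B Bv.
have : \forall s \near (0 : R)^'+, (P `&` B) (v + s *: u).
  near=> s; split; first by near: s.
  near: s; apply: cvg_within; apply: (@continuous_line _ _ v u 0); by rewrite scale0r addr0.
by move=> /filter_ex[s Hs]; exists (v + s *: u).
Unshelve. all: by end_near. Qed.

(** A boundary vector is a limit of vectors of the open cone along the direction of
    [cone_direction]. *)
Lemma closed_coneE : closure open_cone `&` [set v | v != 0] = closed_cone.
Proof.
apply/seteqP; split=> v.
  move=> [cv v0]; split=> //.
  have cl : closed [set v : V | 0 <= om v - F v].
    rewrite (_ : [set _ | _] = (fun v => om v - F v) @^-1` [set x | 0 <= x]) //.
    apply: (@closed_comp _ _ (fun v => om v - F v)); last exact: closed_ge.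
    by move=> w _; apply: cvgB; [exact: com|exact: cF].
  rewrite -subr_ge0; apply: cl; apply: closure_subset cv => w /=.
  by rewrite /open_cone /= subr_ge0 => /ltW.
move=> [v0 le]; split=> //; have [u D] := cone_direction v0 le.
exact: cone_shift (cone_enter v0 le D).
Qed.

Lemma open_cone_convex v w (t : R) : 0 <= t <= 1 -> open_cone v -> open_cone w ->
  open_cone (v + t *: (w - v)).
Proof.
move=> /andP[t0 t1] Cv Cw.
(* The end points are set apart because homogeneity needs both weights positive. *)
have [->|tn] := eqVneq t 0; first by rewrite scale0r addr0.
have [->|tn1] := eqVneq t 1; first by rewrite scale1r addrC subrK.
have tp : 0 < t by rewrite lt_neqAle eq_sym tn.
have tp1 : 0 < 1 - t by rewrite subr_gt0 lt_neqAle tn1.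
have -> : v + t *: (w - v) = (1 - t) *: v + t *: w.
  by rewrite scalerBl scale1r scalerBr addrAC -addrA addrA.
rewrite /open_cone /=; apply: le_lt_trans (minkowski_triangle mF _ _) _.
by rewrite !Fh // linearD !linearZ /= /GRing.scale /= ltrD // ltr_pM2l.
Qed.

Lemma open_cone_connected : connected open_cone.
Proof.
have [[v0 Cv0]|n0] := pselect (open_cone !=set0); last first.
  rewrite (_ : open_cone = set0); first exact: connected0.
  by apply/seteqP; split=> // v Cv; apply: n0; exists v.
pose seg w := (fun t : R => v0 + t *: (w - v0)) @` `[0, 1].
have -> : open_cone = \bigcup_(w in open_cone) seg w.
  apply/seteqP; split=> [w Cw|w [x Cx [t /=]]].
    exists w => //; exists 1; last by rewrite scale1r addrC subrK.
    by rewrite /= in_itv /= ler01 lexx.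
  by rewrite in_itv /= => tI <-; exact: open_cone_convex.
apply: bigcup_connected.
  exists v0 => w _; exists 0; last by rewrite scale0r addr0.
  by rewrite /= in_itv /= ler01 lexx.
move=> w _; apply: connected_continuous_connected; first exact: segment_connected.
by apply: continuous_subspaceT => t; exact: continuous_line.
Qed.

End Cone.

(** The two second derivatives are continuous at [v] and agree on an open set accumulating there.
    This is why the fundamental tensor does not depend on the chosen extension. *)
Lemma derive2_unique (R : realType) (V : normedModType R) (f g : V -> R^o)
    (O1 O2 S : set V) v u w :
  open O1 -> open O2 -> O1 v -> O2 v -> smooth_on O1 f -> smooth_on O2 g ->
  open S -> closure S v -> (forall y, S y -> O1 y -> O2 y -> f y = g y) ->
  'D_u ('D_w f) v = 'D_u ('D_w g) v.
Proof.
move=> o1 o2 v1 v2 sf sg oS cS fg.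
apply/eqP; rewrite -subr_eq0; apply/negPn/negP => n0.
pose d y : R^o := 'D_u ('D_w f) y - 'D_u ('D_w g) y.
have cd : {for v, continuous d}.
  by apply: cvgB; [exact: smooth_on_continuous (smooth_on_derive u (smooth_on_derive w sf)) _ v1|
    exact: smooth_on_continuous (smooth_on_derive u (smooth_on_derive w sg)) _ v2].
have nd : \forall y \near v, d y != 0.
  apply: (cd [set x | x != 0]); apply: open_nbhs_nbhs; split=> //; exact: open_nonzero.
have : \forall y \near v, [/\ d y != 0, O1 y & O2 y].
  by near=> y; split; near: y => //; exact: open_nbhs_nbhs.
move=> /cS[y [Sy [dy y1 y2]]]; move/negP: dy; apply; rewrite subr_eq0.
have oP : open (S `&` O1 `&` O2) by do 2!apply: openI => //.
apply/eqP; apply: (near_eq_derive_on u oP) => // z Pz.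
apply: (near_eq_derive_on w oP Pz) => x [[Sx x1] x2]; exact: fg.
Unshelve. all: by end_near. Qed.

(** * Signature of the Lorentz form *)

Section Signature.
Context {R : realType} {n : nat}.
Let V : normedModType R := 'rV[R]_n.
Variables (F : V -> R^o) (om : {linear V -> R^o}).
Hypotheses (mF : minkowski_norm F) (cF : continuous F) (com : continuous om).
Hypothesis transverse : forall v, F v = 1 -> om v = 1 -> exists2 u, 'D_u F v = 0 & om u != 0.

Let sF : smooth_on (@nonzero _ V) F. Proof. by case: mF. Qed.
Let F0 : F 0 = 0. Proof. by case: mF. Qed.
Let Fgt0 v : v != 0 -> 0 < F v. Proof. by case: mF => _ _ /(_ v). Qed.
Let Fh (a : R) v : 0 < a -> F (a *: v) = a * F v. Proof. by case: mF => _ _ _ /(_ a v). Qed.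
Let oN : open (@nonzero _ V). Proof. exact: open_nonzero. Qed.

Definition lorentz (v : V) : R^o := om v * om v - F v * F v.

Let som (S : set V) : smooth_on S om. Proof. exact: smooth_on_lin. Qed.

Lemma smooth_lorentz : smooth_on (@nonzero _ V) lorentz.
Proof. by apply: smooth_onB => //; exact: smooth_onM. Qed.
Let sL := smooth_lorentz.

Let Lh (a : R) v : 0 < a -> v != 0 -> lorentz (a *: v) = a ^+ 2 * lorentz v.
Proof. by move=> a0 _; rewrite /lorentz Fh // linearZ /= /GRing.scale /=; ring. Qed.

Let dom v u : 'D_u om v = om u.
Proof. by rewrite (deriveE _ (linear_differentiable v com)) diff_lin. Qed.

Let dL v u : v != 0 -> 'D_u lorentz v = 2 * (om v * om u - F v * 'D_u F v).
Proof.
move=> v0; rewrite /lorentz.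
have sm (f : V -> R^o) : smooth_on (@nonzero _ V) f -> derivable (fun x => f x * f x : R^o) v u.
  by move=> sf; apply: diff_derivable; exact: (smooth_on_differentiable (smooth_onM oN sf sf) v0).
rewrite (deriveB (sm _ (som _)) (sm _ sF)); rewrite (derive_mul _ (som (@nonzero _ V)) (som _) v0).
by rewrite (derive_mul _ sF sF v0) dom; move: ('D_u F v) => d; ring.
Qed.

Let B := second_variation lorentz.

Let BE v u w (v0 : v != 0) : B v u w = _ := second_variationE u w oN sL v0.

(** For [k] in the kernel of [om], the derivative of [lorentz] along [k] is minus that of [F ^ 2] at
    every nonzero point, so the form is minus the fundamental tensor of [F]. *)
Let B_ker v k : v != 0 -> om k = 0 -> k != 0 -> B v k k < 0.
Proof.
move=> v0 k0 kn; have : 0 < second_variation (fun x => F x ^+ 2) v k k.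
  by case: mF => _ _ _ _; apply.
rewrite (_ : (fun x => F x ^+ 2) = fun x => F x * F x : R^o); last first.
  by apply/funext => x; rewrite expr2.
have sE := smooth_onM oN sF sF.
rewrite (second_variationE _ _ oN sE v0) (BE k k v0) => E.
rewrite -oppr_gt0 -mulrN.
rewrite (near_eq_derive_on k oN v0 (g := (-1) \*: 'D_k (fun x => F x * F x : R^o))); last first.
  move=> x x0; rewrite dL // k0 mulr0 sub0r /= (derive_mul _ sF sF x0) /GRing.scale /=.
  by move: ('D_k F x) => d; ring.
rewrite deriveZ /= ?scaleN1r ?opprK //.
exact: diff_derivable (smooth_on_differentiable (smooth_on_derive k sE) v0).
Qed.

(** Together with [B_l] this replaces symmetry of second derivatives: each order of differentiation
    has its own Euler relation. *)
Let B_r v u : v != 0 -> B v v u = om v * om u - F v * 'D_u F v.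
Proof.
move=> v0; rewrite (BE v u v0) (euler_derive (k := 1) sL Lh) // dL // mul1r.
by move: ('D_u F v) => d; field.
Qed.

Let B_l v u : v != 0 -> B v u v = om v * om u - F v * 'D_u F v.
Proof.
move=> v0; rewrite (BE u v v0) (derive_euler (k := 1) sL Lh) // dL // mul1r.
by move: ('D_u F v) => d; field.
Qed.

Let Bdiag v : v != 0 -> B v v v = lorentz v.
Proof. by move=> v0; rewrite B_r // (minkowski_euler mF v0). Qed.

Let cone_om v : v != 0 -> F v <= om v -> 0 < om v.
Proof. by move=> /Fgt0; exact: lt_le_trans. Qed.

Let lorentz_ge0 v : v != 0 -> F v <= om v -> 0 <= lorentz v.
Proof.
move=> v0 le; rewrite subr_ge0 ler_pM //; exact: minkowski_ge0.
Qed.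

(** Split a vector of the radical as [k + c v] with [k] in the kernel of [om], then show that both
    parts vanish. *)
Let B_nondegenerate v : v != 0 -> F v <= om v -> nondegenerate_form (B v).
Proof.
move=> v0 le u Bu; have ov := cone_om v0 le.
pose c := om u / om v; pose k := u - c *: v.
have uE : u = k + c *: v by rewrite subrK.
have k0 : om k = 0.
  by rewrite /k linearB linearZ /= /GRing.scale /= divfK ?subrr // gt_eqF.
have Bl w : B v u w = B v k w + c * B v v w.
  rewrite (BE u w v0) (BE k w v0) (BE v w v0) uE (deriveDl _ _ (smooth_on_derive w sL) v0).
  rewrite (deriveZl _ _ (smooth_on_derive w sL) v0).
  by move: ('D_k _ _) ('D_v _ _) => x y; ring.
have e1 : B v k k + c * B v v k = 0 by rewrite -Bl.
have e2 : B v v k + c * B v v v = 0.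
  by have := Bl v; rewrite Bu (B_r k v0) -(B_l k v0) => <-.
(* [e1] and [e2] give [B v k k = c ^ 2 * B v v v], nonnegative on the closed cone, against
   [B_ker]. *)
have kz : k = 0.
  apply/eqP; apply/negPn/negP => kn; have := B_ker v0 k0 kn.
  have := lorentz_ge0 v0 le; rewrite -Bdiag // => b1 b2.
  have : 0 <= c ^+ 2 * B v v v by rewrite mulr_ge0 // sqr_ge0.
  have -> : c ^+ 2 * B v v v = B v k k.
    have -> : B v k k = - (c * B v v k) by apply/eqP; rewrite -addr_eq0 e1.
    have -> : B v v k = - (c * B v v v) by apply/eqP; rewrite -addr_eq0 e2.
    by move: (B v v v) => b; ring.
  by rewrite leNgt b2.
have [cz|cn] := eqVneq c 0; first by rewrite uE kz cz scale0r addr0.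
(* If [c] is nonzero, [v] lies in the radical. Taking [w = v] forces [F v = om v], and then [om]
   equals the derivative of [F] at [v], contrary to [cone_direction]. *)
have Bv w : om v * om w = F v * 'D_w F v.
  apply/eqP; rewrite -subr_eq0 -B_r //; apply/eqP; apply: (mulfI cn).
  have := Bl w; rewrite Bu kz mulr0 (BE 0 w v0) derive0.
  by rewrite mulr0 add0r => <-.
have Fo : F v = om v.
  have := Bv v; rewrite (minkowski_euler mF v0) => /eqP.
  by rewrite -!expr2 eqrXn2 ?(ltW ov) ?(minkowski_ge0 mF) // => /eqP ->.
have [w] := cone_direction mF transverse v0 le.
by have := Bv w; rewrite Fo => /(mulfI (lt0r_neq0 ov)) ->; rewrite ltxx.
Qed.

Let B_index v : v != 0 -> F v <= om v -> has_index (B v) n.-1.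
Proof.
move=> v0 le; have ov := cone_om v0 le; split.
  exists (lker (linfun om)); split.
    move=> k; rewrite memv_ker lfunE /= => /eqP k0 kn; exact: B_ker.
  have := limg_ker_dim (linfun om) fullv; rewrite capfv.
  have -> : (linfun om @: fullv)%VS = fullv.
    apply/eqP; rewrite eqEdim subvf /= dimvf /dim /=.
    rewrite lt0n dimv_eq0; apply: contraTneq ov => img0.
    have : (linfun om) v \in (linfun om @: fullv)%VS by apply: memv_img; exact: memvf.
    by rewrite img0 memv0 lfunE /= => /eqP ->; rewrite ltxx.
  by rewrite !dimvf /dim /= mul1n addn1 => /(congr1 predn).
(* A larger negative definite subspace would be the whole space and contain [v], whose square
   [lorentz v] is nonnegative. *)
move=> U negU; rewrite leqNgt; apply/negP => dU.
have : v \in U.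
  suff -> : U = fullv by exact: memvf.
  apply/eqP; rewrite eqEdim subvf /= dimvf /dim /= mul1n.
  by apply: leq_trans dU; exact: leqSpred.
by move=> /negU /(_ v0); rewrite Bdiag // ltNge lorentz_ge0.
Qed.

Lemma lorentz_signature v (O : set V) (g : V -> R^o) :
  v != 0 -> F v <= om v -> open O -> O v -> smooth_on O g ->
  (forall y, closed_cone F om y -> O y -> g y = lorentz y) ->
  nondegenerate_form (second_variation g v) /\
  has_index (second_variation g v) n.-1.
Proof.
move=> v0 le oO Ov sg gL.
have -> : second_variation g v = B v.
  apply/funext => u; apply/funext => w; rewrite (second_variationE _ _ oO sg Ov) (BE u w v0).
  have cv : closure (open_cone F om) v.
    have : closed_cone F om v by [].
    by rewrite -(closed_coneE mF cF com transverse) => -[].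
  have E := derive2_unique u w oO oN Ov v0 sg sL (open_open_cone cF com) cv.
  rewrite E; first by [].
  move=> y Cy Oy y0.
  apply: (gL y _ Oy).
  split; first exact: y0.
  exact: ltW.
by split; [exact: B_nondegenerate|exact: B_index].
Qed.

End Signature.

(** * Coordinates on the tangent bundle *)

Lemma open_near (T : topologicalType) (O : set T) (x : T) :
  open O -> O x -> \forall y \near x, O y.
Proof. by move=> oO Ox; exact: open_nbhs_nbhs. Qed.

Section ManifoldCoordinates.
Context {R : realType} {n : nat} (M : manifold R n).
Let V : normedModType R := 'rV[R]_n.
Implicit Types (i j : chart_index M) (x y : V) (p : M).

Lemma has_basis_VV : has_basis (V * V)%type.
Proof. by apply: has_basis_prod; exact: has_basis_rV. Qed.

Lemma open_chart_cod i : open (chart_cod i). Proof. exact: chart_cod_open. Qed.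

Lemma chart_codP i p : chart_dom i p -> chart_cod i (chart i p).
Proof. by move=> ip; exists p. Qed.

Lemma param_dom i x : chart_cod i x -> chart_dom i (param i x).
Proof. by move=> [p ip <-]; rewrite chartK. Qed.

Lemma paramK i x : chart_cod i x -> chart i (param i x) = x.
Proof. by move=> [p ip <-]; rewrite chartK. Qed.

Definition overlap i j : set V := chart i @` (chart_dom i `&` chart_dom j).

Lemma overlapP i j x : overlap i j x <-> chart_cod i x /\ chart_dom j (param i x).
Proof.
split=> [[p [ip jp] <-]|[ix jx]]; first by rewrite chartK //; split => //; exact: chart_codP.
by exists (param i x); [split => //; exact: param_dom|exact: paramK].
Qed.

Lemma open_overlap i j : open (overlap i j).
Proof.
rewrite (_ : overlap i j = chart_cod i `&` param i @^-1` chart_dom j).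
  apply: open_setI_preimage; [exact: open_chart_cod| |exact: chart_dom_open].
  by move=> x ix; exact: param_continuous.
by apply/seteqP; split=> x /overlapP.
Qed.

Definition jac i j (x : V) : V -> V := 'd (chart j \o param i) x.

Lemma transition_differentiable i j x : overlap i j x ->
  differentiable (chart j \o param i) x.
Proof. exact: (smooth_on_differentiable (transition_smooth i j)). Qed.

Lemma jac_id i x y : chart_cod i x -> jac i i x y = y.
Proof.
move=> ix; have : is_diff x (chart i \o param i) id.
  apply: (@near_eq_is_diff _ _ _ id).
  by move: (open_near (@open_chart_cod i) ix); apply: filterS => z /paramK.
by rewrite /jac => -[_ ->].
Qed.

Lemma jac_comp i j (k : chart_index M) x y : overlap i j x -> chart_dom k (param i x) ->
  jac j k (chart j (param i x)) (jac i j x y) = jac i k x y.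
Proof.
move=> ij kx; have [ix jx] := (overlapP i j x).1 ij.
have ik : overlap i k x by apply/overlapP.
have jk : overlap j k (chart j (param i x)).
  by apply/overlapP; rewrite chartK //; split=> //; exact: chart_codP.
rewrite /jac -[LHS]/(('d _ _ \o 'd _ _) y).
have D : is_diff x ((chart k \o param j) \o (chart j \o param i))
    ('d (chart k \o param j) (chart j (param i x)) \o 'd (chart j \o param i) x).
  by apply: is_diff_comp; apply: differentiableP; exact: transition_differentiable.
have : is_diff x (chart k \o param i)
    ('d (chart k \o param j) (chart j (param i x)) \o 'd (chart j \o param i) x).
  apply: near_eq_is_diff D.
  move: (open_near (@open_overlap i j) ij); apply: filterS => z /overlapP[_ jz] /=.
  by rewrite chartK.
by case=> _ <-.
Qed.

Lemma jacE i j x y : overlap i j x -> jac i j x y = 'D_y (chart j \o param i) x.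
Proof. by move=> ij; rewrite (deriveE _ (transition_differentiable ij)). Qed.

Lemma row_sum y : y = \sum_k y 0 k *: (delta_mx 0 k : V).
Proof. exact: row_sum_delta. Qed.

Lemma smooth_coord (Z : normedModType R) (S : set Z) (f : Z -> V) (k : 'I_n) :
  open S -> smooth_on S f -> smooth_on S (fun z => f z 0 k : R^o).
Proof.
move=> oS sf; have lin : linear (fun w : V => w 0 k : R^o).
  by move=> a u v; rewrite !mxE.
pose c : {linear V -> R^o} := HB.pack (fun w : V => w 0 k : R^o)
  (GRing.isLinear.Build _ _ _ _ _ lin).
apply: (@smooth_on_comp _ _ _ _ S setT f c) => //; first exact: has_basis_rV.
by apply: smooth_on_lin => x; exact: coord_continuous.
Qed.

(** By linearity in the second argument, [L z (a z)] is a sum over the standard basis of smooth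
    coefficients times maps with a constant argument. *)
Lemma smooth_on_family (Z W : normedModType R) (S : set Z) (a : Z -> V)
    (L : Z -> V -> W) : open S -> smooth_on S a ->
  (forall z, S z -> linear (L z)) ->
  (forall y, smooth_on S (fun z => L z y)) ->
  smooth_on S (fun z => L z (a z)).
Proof.
move=> oS sa linL sL.
apply: (@smooth_on_ext _ _ _ _ (fun z => \sum_k a z 0 k *: L z (delta_mx 0 k))) => //.
  move=> z Sz; pose l : {linear V -> W} :=
    HB.pack (L z) (GRing.isLinear.Build _ _ _ _ _ (linL z Sz)).
  rewrite [in RHS](row_sum (a z)) -[RHS]/(l _) linear_sum.
  by apply: eq_bigr => k _; rewrite linearZ.
by apply: smooth_on_sum => // k; apply: smooth_onZ => //; exact: smooth_coord.
Qed.

Lemma smooth_jac (Z : normedModType R) (S : set Z) i j (b a : Z -> V) : open S ->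
  smooth_on S b -> smooth_on S a -> (forall z, S z -> overlap i j (b z)) ->
  smooth_on S (fun z => jac i j (b z) (a z)).
Proof.
move=> oS sb sa ij.
apply: (@smooth_on_family _ _ _ _ (fun z => jac i j (b z))) => //.
  by move=> z _ c u v; rewrite /jac linearP.
move=> y; apply: (@smooth_on_ext _ _ _ _ (fun z => 'D_y (chart j \o param i) (b z))) => //.
  by move=> z /ij/jacE ->.
apply: (@smooth_on_comp _ _ _ _ _ (overlap i j) b (fun x => 'D_y (chart j \o param i) x)) => //; first exact: has_basis_rV.
by apply: smooth_on_derive; exact: transition_smooth.
Qed.

Lemma chart_at_overlap i x : chart_cod i x -> overlap i (chart_at (param i x)) x.
Proof. by move=> ix; apply/overlapP; split=> //; exact: chart_at_dom. Qed.

Lemma tangent_paramE i x y :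
  tangent_param i (x, y) = Tan (param i x) (jac i (chart_at (param i x)) x y).
Proof. by []. Qed.

Lemma tangent_coordK i x y : chart_cod i x ->
  tangent_coord i (param i x) (vec (tangent_param i (x, y))) = y.
Proof.
move=> ix; rewrite /tangent_coord /= -/(jac _ _ _ _) -/(jac _ _ _ _).
by rewrite jac_comp ?jac_id //; [exact: chart_at_overlap|exact: param_dom].
Qed.

Lemma tangent_paramK i p (v : V) : chart_dom i p ->
  tangent_param i (chart i p, tangent_coord i p v) = Tan p v.
Proof.
move=> ip; rewrite tangent_paramE chartK //; congr Tan.
have atp := chart_at_dom p.
rewrite /tangent_coord -/(jac _ _ _ _) -{1}(chartK ip).
have -> : chart i p = chart i (param (chart_at p) (chart (chart_at p) p)) by rewrite chartK.
rewrite jac_comp ?chartK ?jac_id //; first exact: chart_codP.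
by apply/overlapP; rewrite chartK //; split=> //; exact: chart_codP.
Qed.

Lemma tangent_param_at p v : tangent_param (chart_at p) (chart (chart_at p) p, v) = Tan p v.
Proof.
by rewrite tangent_paramE chartK ?jac_id //; [exact: chart_codP (chart_at_dom p)|exact: chart_at_dom].
Qed.

Lemma tangent_param0 i x y : chart_cod i x ->
  (vec (tangent_param i (x, y)) == 0) = (y == 0).
Proof.
move=> ix; apply/eqP/eqP => [E|->]; last by rewrite /= linear0.
by rewrite -(tangent_coordK y ix) E /tangent_coord linear0.
Qed.

Lemma tangent_param_continuous i z : chart_cod i z.1 ->
  {for z, continuous (tangent_param i)}.
Proof.
move=> iz B; rewrite nbhsE => -[P [oP Pz] PB].
have : in_coord i P z by [].
move=> /(open_near (oP i)); apply: filterS => w [_ /PB].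
exact.
Qed.

Lemma continuous_fiber p : continuous (fun v : V => Tan p v : tangent M).
Proof.
move=> v; have -> : (fun v : V => Tan p v : tangent M) =
    tangent_param (chart_at p) \o (fun v => (chart (chart_at p) p, v)).
  by apply/funext => w; rewrite /= -tangent_param_at.
apply: continuous_comp.
  apply: (@smooth_on_continuous _ _ _ setT) => //.
  by apply: smooth_on_pair; [exact: openT|exact: smooth_on_cst|exact: smooth_on_id].
by apply: tangent_param_continuous; exact: chart_codP (chart_at_dom p).
Qed.

Definition coord_dom i : set (V * V) := [set z | chart_cod i z.1].

Lemma open_coord_dom i : open (coord_dom i).
Proof.
rewrite (_ : coord_dom i = setT `&` fst @^-1` chart_cod i).
  apply: open_setI_preimage; [exact: openT| |exact: open_chart_cod].
  by move=> x _; exact: cvg_fst.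
by apply/seteqP; split=> z // [].
Qed.

Definition coord_nonzero i : set (V * V) := [set z | chart_cod i z.1 /\ z.2 != 0].

Lemma open_coord_nonzero i : open (coord_nonzero i).
Proof.
rewrite (_ : coord_nonzero i = coord_dom i `&` snd @^-1` (@nonzero _ V)).
  apply: open_setI_preimage; [exact: open_coord_dom| |exact: open_nonzero].
  by move=> x _; exact: cvg_snd.
by apply/seteqP; split=> z.
Qed.

Lemma in_coord_nonzero i : in_coord i nonzero_vectors = coord_nonzero i.
Proof.
apply/seteqP; split=> -[x y] [ix] n0; split => //.
  by rewrite /= -(tangent_param0 y ix).
by rewrite /nonzero_vectors /mkset tangent_param0.
Qed.

Lemma tangent_open_lt (f g : tangent M -> R) :
  (forall i z, chart_cod i z.1 -> {for z, continuous (f \o tangent_param i)}) ->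
  (forall i z, chart_cod i z.1 -> {for z, continuous (g \o tangent_param i)}) ->
  open [set v | f v < g v].
Proof.
move=> cf cg; suff oT : tangent_open [set v | f v < g v] by exact: oT.
move=> i.
rewrite (_ : in_coord i _ = coord_dom i `&`
  (fun z => g (tangent_param i z) - f (tangent_param i z)) @^-1` [set a | 0 < a]).
  apply: open_setI_preimage; [exact: open_coord_dom| |exact: open_gt].
  by move=> z iz; apply: cvgB; [exact: cg|exact: cf].
by apply/seteqP; split=> z [iz]; rewrite /= subr_gt0; split.
Qed.

End ManifoldCoordinates.

Section OneForm.
Context {R : realType} {n : nat} (M : manifold R n).
Let V : normedModType R := 'rV[R]_n.
Variable omega : M -> 'rV[R]_n -> R.
Hypothesis homega : one_form omega.
Implicit Types (i : chart_index M) (p : M).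

Lemma one_form_linear p : linear (omega p : V -> R^o).
Proof. by move=> a u v; case: homega => /(_ p a u v). Qed.

Definition covector p : {linear V -> R^o} :=
  HB.pack (omega p : V -> R^o) (GRing.isLinear.Build _ _ _ _ _ (one_form_linear p)).

Definition form_coord i (z : V * V) : R^o :=
  omega (base (tangent_param i z)) (vec (tangent_param i z)).

Lemma smooth_form_coord i : smooth_on (@coord_dom _ _ M i) (form_coord i).
Proof.
apply: (@smooth_on_ext _ _ _ _ (fun z => form_coord i (z.1, z.2))) => //.
- exact: open_coord_dom.
- by move=> [].
apply: (@smooth_on_family _ _ _ _ _ snd (fun z y => form_coord i (z.1, y))).
- exact: open_coord_dom.
- exact: smooth_on_snd.
- move=> z iz a u v; rewrite /form_coord /= !linearP.
  exact: (one_form_linear (param i z.1)).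
- move=> y; apply: (@smooth_on_comp _ _ _ _ _ (chart_cod i) fst (fun x => form_coord i (x, y))).
  + exact: has_basis_rV.
  + exact: open_coord_dom.
  + by [].
  + exact: smooth_on_fst.
  + by case: homega => _ /(_ i y).
Qed.

Lemma continuous_form_coord i z : chart_cod i z.1 -> {for z, continuous (form_coord i)}.
Proof. exact: (smooth_on_continuous (@smooth_form_coord i)). Qed.

Lemma form_coord_at p v : form_coord (chart_at p) (chart (chart_at p) p, v) = omega p v.
Proof. by rewrite /form_coord tangent_param_at. Qed.

Lemma continuous_covector p : continuous (covector p).
Proof.
move=> v; have -> : (covector p : V -> R^o) =
    form_coord (chart_at p) \o (fun v => (chart (chart_at p) p, v)).
  by apply/funext => w; rewrite /= form_coord_at.
apply: continuous_comp.
  apply: (@smooth_on_continuous _ _ _ setT) => //.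
  by apply: smooth_on_pair; [exact: openT|exact: smooth_on_cst|exact: smooth_on_id].
by apply: continuous_form_coord; exact: chart_codP (chart_at_dom p).
Qed.

End OneForm.

Section FinslerFiber.
Context {R : realType} {n : nat} (M : manifold R n).
Let V : normedModType R := 'rV[R]_n.
Variable F : tangent M -> R.
Hypothesis hF : finsler_metric [set: tangent M] F.
Implicit Types (i : chart_index M) (p : M).

Lemma finsler_continuous : continuous F.
Proof. by case: hF => [[cF _] _ _ _ _]; by apply/continuous_subspace_setT. Qed.

Definition norm_coord i (z : V * V) : R^o := F (tangent_param i z).

Lemma continuous_norm_coord i z : chart_cod i z.1 -> {for z, continuous (norm_coord i)}.
Proof.
move=> iz; apply: (@continuous_comp _ _ _ (tangent_param i) F).
  exact: tangent_param_continuous.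
exact: finsler_continuous.
Qed.

Lemma smooth_norm_coord i : smooth_on (@coord_nonzero _ _ M i) (norm_coord i).
Proof.
case: hF => [[_ /(_ i) sF] _ _ _ _].
apply: smooth_on_local => z iz.
have [|O [g [oO Oz sg gF]]] := sF z.
  by rewrite setTI in_coord_nonzero.
exists (coord_nonzero i `&` O); split=> //.
apply: (@smooth_on_ext _ _ _ _ g).
- by apply: openI => //; exact: open_coord_nonzero.
- by move=> w Hw; rewrite gF // setTI in_coord_nonzero.
- by apply: smooth_on_restrict sg => w [].
Qed.

Definition fiber_norm p : V -> R^o := fun v => F (Tan p v).

Lemma norm_coord_at p v : norm_coord (chart_at p) (chart (chart_at p) p, v) = fiber_norm p v.
Proof. by rewrite /norm_coord tangent_param_at. Qed.

Lemma continuous_fiber_norm p : continuous (fiber_norm p).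
Proof.
move=> v; apply: (@continuous_comp _ _ _ (fun v : V => Tan p v : tangent M) F).
  exact: continuous_fiber.
exact: finsler_continuous.
Qed.

Lemma smooth_fiber_slice p (f : V * V -> R^o) :
  smooth_on (coord_nonzero (chart_at p)) f ->
  smooth_on (@nonzero _ V) (fun v => f (chart (chart_at p) p, v)).
Proof.
move=> sf; apply: (@smooth_on_comp _ _ _ _ _ (coord_nonzero (chart_at p))
  (fun v : V => (chart (chart_at p) p, v)) f) => //.
- exact: has_basis_VV.
- exact: open_nonzero.
- by move=> v v0; split => //=; exact: chart_codP (chart_at_dom p).
- by apply: smooth_on_pair; [exact: open_nonzero|exact: smooth_on_cst|exact: smooth_on_id].
Qed.

Lemma minkowski_fiber_norm p : minkowski_norm (fiber_norm p).
Proof.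
case: hF => [_ _ Fpos Fh Fv].
have F0 : fiber_norm p 0 = 0.
  (* Homogeneity is assumed for positive factors only; the factor 2 at the zero vector gives
     [F 0 = 2 * F 0]. *)
  have : F (Tan p ((2 : R) *: (0 : V))) = 2 * F (Tan p (0 : V)) by apply: Fh.
  by rewrite scaler0 /fiber_norm; lra.
split => //.
- apply: (@smooth_on_ext _ _ _ _ (fun v => norm_coord (chart_at p) (chart (chart_at p) p, v))).
  + exact: open_nonzero.
  + by move=> v _; rewrite norm_coord_at.
  + by apply: smooth_fiber_slice; exact: smooth_norm_coord.
- by move=> v v0; exact: Fpos.
- by move=> a v a0; exact: Fh.
- by move=> v u v0 u0; exact: Fv.
Qed.

End FinslerFiber.

(** * Interior and closure of the cone in TM *)

Section FinslerCone.
Context {R : realType} {n : nat} (M : manifold R n).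
Let V : normedModType R := 'rV[R]_n.
Variables (F : tangent M -> R) (omega : M -> 'rV[R]_n -> R).
Hypotheses (hF : finsler_metric [set: tangent M] F) (homega : one_form omega)
  (homega0 : nonvanishing omega)
  (htransverse : forall p : M, transverse_levels (fiber_fun F p) (omega p) 1).

Let om := covector homega.
Let com p : continuous (om p) := @continuous_covector _ _ _ _ homega p.
Let mF p := minkowski_fiber_norm hF p.
Let cF p := @continuous_fiber_norm _ _ _ _ hF p.

(** In the splitting of some [u] off the kernel of [omega], the part tangent to the level of [omega]
    lies in that kernel, so the other part carries all of [omega u]. *)
Lemma fiber_transverse p (v : V) : fiber_norm F p v = 1 -> om p v = 1 ->
  exists2 u, 'D_u (fiber_norm F p) v = 0 & om p u != 0.
Proof.
move=> Fv ov; have [u /eqP u0] := homega0 p.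
have [u1 [u2 [D1 D2 uE]]] := htransverse Fv ov u.
exists u1; first exact: D1.
have D2' : om p u2 = 0.
  rewrite -[RHS]D2 -[RHS]/('D_u2 (om p) v).
  by rewrite (deriveE _ (linear_differentiable v (@com p))) (diff_lin v (@com p)).
move: u0; rewrite uE -[omega p _]/(om p (u1 + u2)) linearD D2' addr0.
by [].
Qed.

Definition cone_bar : set (tangent M) :=
  [set w | nonzero_vectors w /\ F w <= omega (base w) (vec w)].

Definition cone_open : set (tangent M) := [set w | F w < omega (base w) (vec w)].

Lemma open_cone_open : open cone_open.
Proof.
apply: (@tangent_open_lt _ _ _ F (fun w => omega (base w) (vec w))) => i z iz.
  exact: continuous_norm_coord.
exact: continuous_form_coord.
Qed.

Lemma cone_open_nonzero : cone_open `<=` nonzero_vectors.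
Proof. by move=> [p v] Cv; exact: (@open_cone_nonzero _ _ _ (om p) (mF p) v Cv). Qed.

(** A vector with [F v = omega v] leaves the set by arbitrarily small steps along [- u], for [u]
    from [cone_direction]. Moving within the fibre is enough, as its inclusion in TM is
    continuous. *)
Lemma interior_cone_bar : interior cone_bar = cone_open.
Proof.
apply/seteqP; split=> [[p v] Iv|]; last first.
  rewrite -open_subsetE; last exact: open_cone_open.
  by move=> w Cw; split; [exact: cone_open_nonzero|exact: ltW].
have [v0 le] := interior_subset Iv.
rewrite /cone_open /mkset lt_neqAle le andbT; apply/eqP => E.
have [u D] := cone_direction (mF p) (@fiber_transverse p) v0 le.
have out := cone_leave (mF p) (@com p) v0 E D.
have near_in : \forall s \near (0 : R)^'+, cone_bar (Tan p (v + s *: - u)).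
  apply: cvg_within.
  have c : {for (0 : R), continuous (fun s : R => Tan p (v + s *: - u) : tangent M)}.
    apply: continuous_comp; first exact: continuous_line.
    exact: continuous_fiber.
  by apply: c; rewrite scale0r addr0.
have : \forall s \near (0 : R)^'+, False.
  near=> s.
  have [_] : cone_bar (Tan p (v + s *: - u)) by near: s.
  rewrite leNgt => /negP; apply; near: s; exact: out.
by move=> /filter_ex[].
Unshelve. all: by end_near. Qed.

Lemma cone_closure_open : cone_closure cone_open = cone_bar.
Proof.
apply/seteqP; split=> [[p v] [cv v0]|[p v] [v0 le]]; last first.
  split=> //; move=> B nB.
  have [u D] := cone_direction (mF p) (@fiber_transverse p) v0 le.
  have : closure (open_cone (fiber_norm F p) (om p)) v.
    exact: cone_shift (cone_enter (mF p) (@com p) v0 le D).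
  have nB' : nbhs (v : V) (fun w => B (Tan p w)) by exact: (@continuous_fiber _ _ M p v).
  by move=> /(_ _ nB') [w [Cw Bw]]; exists (Tan p w).
split=> //; rewrite leNgt; apply/negP => lt.
have oO : open [set w : tangent M | omega (base w) (vec w) < F w].
  apply: (@tangent_open_lt _ _ _ (fun w => omega (base w) (vec w)) F) => i z iz.
    exact: continuous_form_coord.
  exact: continuous_norm_coord.
have [w [/= w1 w2]] := cv _ (open_near oO lt).
by have := lt_trans w1 w2; rewrite ltxx.
Qed.

Lemma fiber_closure_open p : fiber_closure cone_open p = closed_cone (fiber_norm F p) (om p).
Proof. exact: (closed_coneE (mF p) (@cF p) (@com p) (@fiber_transverse p)). Qed.

End FinslerCone.

(** * The Lorentz-Finsler metric *)

Lemma exists_dual (R : realType) (n : nat) (e : 'rV[R]_n) : e != 0 ->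
  exists ell : {linear 'rV[R]_n -> R^o}, continuous ell /\ ell e = 1.
Proof.
move=> /rV0Pn[k ek].
have lin : linear (fun w : 'rV[R]_n => (e 0 k)^-1 * w 0 k : R^o).
  by move=> a u v; rewrite !mxE /GRing.scale /=; ring.
pose ell : {linear 'rV[R]_n -> R^o} :=
  HB.pack (fun w : 'rV[R]_n => (e 0 k)^-1 * w 0 k : R^o)
    (GRing.isLinear.Build _ _ _ _ _ lin).
exists ell; split; last by rewrite /ell /= mulVf.
move=> w; apply: (@continuousZl_tmp _ _ _ (fun w : 'rV[R]_n => w 0 k : R^o) (e 0 k)^-1 w).
exact: coord_continuous.
Qed.

(* A chart is a homeomorphism, so the half-space condition at a zero of [ell]
   would hold on a whole neighbourhood, whereas [ell] changes sign there. *)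
Lemma interior_not_boundary (R : realType) (V : normedModType R) (S : set V) x O
    (phi psi : V -> V) (ell : {linear V -> R^o}) :
  half_space_chart S x O phi psi ell -> interior S x -> ell (phi x) <> 0.
Proof.
move=> [Ox [oO oI sphi spsi psiK] [e e0] Sell] Sx lx.
have cpsi : {for phi x, continuous psi}.
  by apply: (smooth_on_continuous spsi); exists x.
have n1 : \forall y \near phi x, S (psi y) /\ O (psi y) /\ (phi @` O) y.
  near=> y; split; last split; near: y.
  - by apply: cpsi; rewrite psiK.
  - by apply: cpsi; rewrite psiK //; exact: open_near.
  - by apply: open_near => //; exists x.
have n2 : \forall y \near phi x, 0 <= ell y.
  apply: filterS n1 => y [Sy [Oy [z Oz zy]]].
  by have := (Sell _ Oy).1 Sy; rewrite -zy psiK.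
have n3 u : \forall s \near (0 : R)^'+, 0 <= ell (phi x + s *: u).
  by apply: cvg_within; apply: (@continuous_line _ _ (phi x) u 0 [set y | 0 <= ell y]); rewrite scale0r addr0.
have pos u : 0 <= ell u.
  have /filter_ex[s [s0]] : \forall s \near (0 : R)^'+, 0 < s /\ 0 <= ell (phi x + s *: u).
    by near=> s; split; near: s; [exact: nbhs_right_gt|exact: n3].
  by rewrite linearD linearZ /= lx add0r /GRing.scale /= pmulr_rge0.
by apply: e0; apply/eqP; rewrite eq_le pos andbT -oppr_ge0 -linearN pos.
Unshelve. all: by end_near. Qed.

Section LorentzFinsler.
Context {R : realType} {n : nat} (M : manifold R n).
Let V : normedModType R := 'rV[R]_n.
Variables (F : tangent M -> R) (omega : M -> 'rV[R]_n -> R).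
Hypotheses (hF : finsler_metric [set: tangent M] F) (homega : one_form omega)
  (homega0 : nonvanishing omega)
  (htransverse : forall p : M, transverse_levels (fiber_fun F p) (omega p) 1).

Let om := covector homega.
Let com p : continuous (om p) := @continuous_covector _ _ _ _ homega p.
Let mF p := minkowski_fiber_norm hF p.
Let cF p := @continuous_fiber_norm _ _ _ _ hF p.
Let tr p := @fiber_transverse _ _ _ _ _ homega homega0 htransverse p.
Let Abar := cone_bar F omega.
Let A := cone_open F omega.

Definition height_coord i (z : V * V) : R^o := form_coord omega i z - norm_coord F i z.

Lemma smooth_form_coord_nonzero i : smooth_on (@coord_nonzero _ _ M i) (form_coord omega i).
Proof. by apply: smooth_on_restrict (@smooth_form_coord _ _ _ _ homega i) => z []. Qed.

Lemma smooth_height_coord i : smooth_on (@coord_nonzero _ _ M i) (height_coord i).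
Proof.
apply: smooth_onB.
- exact: open_coord_nonzero.
- exact: smooth_form_coord_nonzero.
- exact: smooth_norm_coord.
Qed.

Lemma in_coord_bar i z : in_coord i Abar z <-> coord_nonzero i z /\ 0 <= height_coord i z.
Proof.
rewrite subr_ge0; split=> [[iz [nz le]]|[]].
  by split=> //; rewrite -in_coord_nonzero.
by rewrite -in_coord_nonzero => -[iz nz] le.
Qed.

(** Only the fibre component is moved, by the chart components of the vector from [cone_direction];
    the base point stays, so the derivative is one already known in a single tangent space. *)
Lemma height_direction i z : in_coord i Abar z ->
  exists e : V, 'D_(0, e) (height_coord i) z != 0.
Proof.
move: z => [x y] iz; have [[ix y0] _] := (in_coord_bar i (x, y)).1 iz.
have [_ [v0 le]] := iz; set p := param i x in v0 le.
set v : V := vec (tangent_param i (x, y)) in v0 le.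
have [u D] := cone_direction (mF p) (@tr p) v0 le.
exists (tangent_coord i p u).
have dh := smooth_on_differentiable (@smooth_height_coord i) (conj ix y0 : coord_nonzero i (x, y)).
have [_ <-] := is_derive_line0 (0, tangent_coord i p u : V) dh.
have [_ E] := cone_height_derive (mF p) (@com p) u v0.
rewrite (_ : (fun s : R => height_coord i ((x, y) + s *: (0, tangent_coord i p u))) =
  fun s : R => om p (v + s *: u) - fiber_norm F p (v + s *: u)).
  by rewrite E subr_eq0 gt_eqF.
apply/funext => s.
have Js : tangent_param i ((x, y) + s *: (0, tangent_coord i p u)) = Tan p (v + s *: u).
  have -> : (x, y) + s *: (0, tangent_coord i p u) = (x, y + s *: tangent_coord i p u) :> V * V.
    by apply/pair_equal_spec; split; rewrite //= scaler0 addr0.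
  rewrite tangent_paramE -/p; congr Tan; rewrite /jac linearD linearZ; congr (_ + _ *: _).
  have pi : chart_dom i p by exact: param_dom.
  by have := tangent_paramK u pi; rewrite /p paramK // => -[].
by rewrite /height_coord /form_coord /norm_coord Js.
Qed.

(** The value [ell (phi z)] is recorded because [cone_boundary] uses it to recognise boundary
    points. *)
Lemma bar_chart i z : in_coord i Abar z -> exists O phi psi ell,
  half_space_chart (in_coord i Abar) z O phi psi ell /\ ell (phi z) = height_coord i z.
Proof.
move=> iz; have [e De] := height_direction iz.
have e0 : e != 0 by apply: contra_neq De => ->; rewrite derive0.
have [l [cl le]] := exists_dual e0.
have lin : linear (fun w : V * V => l w.2) by move=> a u v; rewrite linearP.
pose ell : {linear (V * V)%type -> R^o} := HB.pack (fun w : V * V => l w.2)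
  (GRing.isLinear.Build _ _ _ _ _ lin).
have cell : continuous ell.
  by move=> w; apply: (@continuous_comp _ _ _ snd l); [exact: cvg_snd|exact: cl].
have Pz : coord_nonzero i z by case: ((in_coord_bar i z).1 iz).
have [Q [phi [psi [Qz QP dQ lphi]]]] := level_chart (@has_basis_VV _ n)
  (@open_coord_nonzero _ _ M i) (@smooth_height_coord i) Pz cell (le : ell (0, e) = 1) De.
exists Q, phi, psi, ell; split; last exact: lphi.
split=> //; first by exists (0, e); rewrite [ell _]le; apply/eqP; exact: oner_neq0.
move=> w Qw; rewrite lphi //; split=> [/in_coord_bar[]//|h].
by apply/in_coord_bar; split=> //; exact: QP.
Qed.

Lemma tangent_manifold_cone_bar : tangent_manifold_with_boundary Abar.
Proof.
move=> i z /bar_chart[Q [phi [psi [ell [H _]]]]].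
by exists Q, phi, psi, ell.
Qed.

(** Being a boundary point means that some chart vanishes there; [interior_not_boundary] rules this
    out on the open cone for every chart, while [bar_chart] provides one where [F v = omega v]. *)
Lemma cone_boundary : tangent_manifold_boundary Abar =
  [set v | vec v != 0 /\ F v = omega (base v) (vec v)].
Proof.
apply/seteqP; split=> [v [i [z [iz zv [Sz [Q [phi [psi [ell [H l0]]]]]]]]]|[p v] [/= v0 Fv]].
  have [_ [nz le]] := Sz; rewrite -zv; split=> //; apply/eqP; rewrite eq_le le /=.
  rewrite leNgt; apply/negP => lt; apply: (interior_not_boundary H _ l0).
  have oA : open (in_coord i A) by exact: (open_cone_open hF homega).
  move: (open_near oA (conj iz lt : in_coord i A z)); apply: filterS => w [iw Aw].
  by split=> //; split; [exact: (cone_open_nonzero hF homega Aw)|exact: ltW].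
pose i := chart_at p; pose z : V * V := (chart i p, v).
have iz : chart_cod i z.1 by exact: chart_codP (chart_at_dom p).
have zE : tangent_param i z = Tan p v by exact: tangent_param_at.
have Sz : in_coord i Abar z by split=> //; rewrite zE; split => //=; rewrite Fv.
exists i, z; split=> //; split=> //.
have [Q [phi [psi [ell [H lE]]]]] := bar_chart Sz; exists Q, phi, psi, ell; split=> //.
by rewrite lE /height_coord /form_coord /norm_coord zE /= Fv subrr.
Qed.

Lemma fiber_manifold p : manifold_with_boundary (closed_cone (fiber_norm F p) (om p)).
Proof.
move=> v [v0 le]; have [u D] := cone_direction (mF p) (@tr p) v0 le.
have u0 : u != 0.
  by move: D; apply: contraTneq => ->; rewrite derive0 linear0 ltxx.
have [ell [cell le1]] := exists_dual u0.
pose h (w : V) : R^o := om p w - fiber_norm F p w.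
have sh : smooth_on (@nonzero _ V) h.
  apply: smooth_onB; [exact: open_nonzero|apply: smooth_on_lin; exact: com|by case: (mF p)].
have Dh : 'D_u h v != 0.
  have [_ <-] := is_derive_line0 u (smooth_on_differentiable sh v0).
  have [_ E] := cone_height_derive (mF p) (@com p) u v0.
  by rewrite /h E subr_eq0 gt_eqF.
have [Q [phi [psi [Qz QP dQ lphi]]]] := level_chart (has_basis_rV n)
  (@open_nonzero _ V) sh v0 cell le1 Dh.
exists Q, phi, psi, ell; split=> //; first by exists u; rewrite le1; apply/eqP; exact: oner_neq0.
move=> w Qw; rewrite lphi // /h subr_ge0; split=> [[]//|h'].
by split=> //; exact: QP.
Qed.

Let L := fun v : tangent M => omega (base v) (vec v) ^+ 2 - F v ^+ 2.

Lemma smooth_lorentz_coord i : smooth_on (@coord_nonzero _ _ M i) ((L \o tangent_param i) : V * V -> R^o).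
Proof.
have oN := @open_coord_nonzero _ _ M i.
have sf := @smooth_form_coord_nonzero i; have sn := @smooth_norm_coord _ _ _ _ hF i.
apply: (@smooth_on_ext _ _ _ _ (fun z => form_coord omega i z * form_coord omega i z -
  norm_coord F i z * norm_coord F i z : R^o)) => //.
by apply: smooth_onB => //; exact: smooth_onM.
Qed.

Lemma lorentz_finsler_cone (hmeet : forall p : M,
    fiber (indicatrix [set: tangent M] F) p `&` omega p @^-1` [set 1] !=set0) :
  lorentz_finsler_metric A L.
Proof.
have clA : cone_closure A = Abar by exact: (cone_closure_open hF homega homega0 htransverse).
have A_gt0 p v : A (Tan p v) -> 0 <= F (Tan p v) by move=> _; exact: (minkowski_ge0 (mF p) v).
split.
  split.
  - exact: (open_cone_open hF homega).
  - exact: (cone_open_nonzero hF homega).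
  - move=> p; split.
    + have [v [[_ Fv] /= ov]] := hmeet p.
      have v0 : v != 0.
        apply/negP => /eqP v0; move: ov; rewrite v0 -[omega p _]/(om p 0) linear0 => /eqP.
        by rewrite eq_sym oner_eq0.
      have le : fiber_norm F p v <= om p v by rewrite /fiber_norm Fv -[om p v]/(omega p v) ov.
      have [u D] := cone_direction (mF p) (@tr p) v0 le.
      have /filter_ex[s Hs] := cone_enter (mF p) (@com p) v0 le D.
      by exists (v + s *: u).
    + exact: (open_cone_connected (om := om p) (mF p)).
    + move=> v a Av a0; rewrite /fiber /A /cone_open /=.
      rewrite -[F _]/(fiber_norm F p _) -[omega p _]/(om p _) linearZ.
      case: (mF p) => _ _ _ Fh _; rewrite Fh // /GRing.scale /= ltr_pM2l //.
  - by rewrite clA; exact: tangent_manifold_cone_bar.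
split.
- move=> [p v] Av; rewrite /L subr_gt0 -subr_gt0 subr_sqr mulr_gt0 ?subr_gt0 //=.
  by rewrite ltr_wpDr // ?A_gt0 // (le_lt_trans (A_gt0 p v Av)).
- move=> p v a Av a0; rewrite /L /=.
  rewrite -[F _]/(fiber_norm F p _) -[omega p _]/(om p _) linearZ.
  case: (mF p) => _ _ _ Fh _; rewrite Fh // /GRing.scale /= /fiber_norm.
  by rewrite !exprMn mulrBr.
- split; last first.
    move=> v; rewrite /cone_structure clA cone_boundary /L => -[_ ->].
    by rewrite subrr.
  move=> i z; rewrite clA => iz; have [Pz _] := (in_coord_bar i z).1 iz.
  exists (coord_nonzero i), (L \o tangent_param i); split=> //.
    exact: open_coord_nonzero.
  exact: smooth_lorentz_coord.
- move=> p; rewrite (fiber_closure_open hF homega homega0 htransverse).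
  exact: fiber_manifold.
- move=> p v; rewrite (fiber_closure_open hF homega homega0 htransverse).
  move=> [v0 le] O g [oO Ov sg gE].
  apply: (lorentz_signature (mF p) (@cF p) (@com p) (@tr p) v0 le oO Ov sg).
  by move=> y Cy Oy; rewrite gE // /fiber_fun /L /lorentz -!expr2.
Qed.

End LorentzFinsler.

(** * The cone triple *)

Section ConeTriple.
Context {R : realType} {n : nat} (M : manifold R n).
Let V : normedModType R := 'rV[R]_n.
Variables (F : tangent M -> R) (omega : M -> 'rV[R]_n -> R) (T : M -> 'rV[R]_n).
Hypotheses (hF : finsler_metric [set: tangent M] F) (homega : one_form omega)
  (hT : vector_field T) (omT : forall p, omega p (T p) = 1)
  (FT : forall p, fiber_norm F p (T p) < 1).

Let om := covector homega.
Let mF p := minkowski_fiber_norm hF p.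
Let cF p := @continuous_fiber_norm _ _ _ _ hF p.
Definition wind_norm (v : tangent M) : R :=
  zermelo (fiber_norm F (base v)) (T (base v)) (vec v).

Definition wind_coord i (x : V) : V := tangent_coord i (param i x) (T (param i x)).

Lemma tangent_param_wind i x y (t : R) : chart_cod i x ->
  tangent_param i (x, y + t *: wind_coord i x) =
  Tan (param i x) (vec (tangent_param i (x, y)) + t *: T (param i x)).
Proof.
move=> ix; rewrite tangent_paramE; congr Tan; rewrite /jac linearD linearZ.
congr (_ + _ *: _).
by have := tangent_paramK (T (param i x)) (param_dom ix); rewrite paramK // => -[].
Qed.

Lemma norm_coord_wind i x y (t : R) : chart_cod i x ->
  norm_coord F i (x, y + t *: wind_coord i x) =
  fiber_norm F (param i x) (vec (tangent_param i (x, y)) + t *: T (param i x)).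
Proof. by move=> ix; rewrite /norm_coord tangent_param_wind. Qed.

(** Covers zero vectors, where [F] need not be smooth. The root lies between [g - e] and [g + e]
    exactly when two strict inequalities for [norm_coord] at these fixed levels hold, and such
    inequalities persist nearby. *)
Lemma wind_norm_coord_continuous i z : chart_cod i z.1 ->
  {for z, continuous (wind_norm \o tangent_param i)}.
Proof.
move=> iz.
have shift (a : R) : {for z, continuous
    (fun w : V * V => norm_coord F i (w.1, w.2 + a *: wind_coord i w.1))}.
  apply: (@continuous_comp _ _ _ (fun w : V * V => (w.1, w.2 + a *: wind_coord i w.1)) (norm_coord F i)).
    apply: (@smooth_on_continuous _ _ _ (@coord_dom _ _ M i)) iz.
    apply: smooth_on_pair; [exact: open_coord_dom|exact: smooth_on_fst|].
    apply: smooth_onD; [exact: open_coord_dom|exact: smooth_on_snd|].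
    apply: smooth_onZ; [exact: open_coord_dom|exact: smooth_on_cst|].
    apply: (@smooth_on_comp _ _ _ _ _ (chart_cod i) fst (wind_coord i)) => //.
    - exact: has_basis_rV.
    - exact: open_coord_dom.
    - exact: smooth_on_fst.
  exact: (@continuous_norm_coord _ _ _ _ hF i).
have dom : \forall w \near z, coord_dom i w by apply: open_near => //; exact: open_coord_dom.
apply/cvgrPdist_lt => e e0.
set g := (wind_norm \o tangent_param i) z.
have lt w (a : R) : coord_dom i w ->
    norm_coord F i (w.1, w.2 + a *: wind_coord i w.1) < a <-> (wind_norm \o tangent_param i) w < a.
  move: w => [x y] ix; rewrite norm_coord_wind //.
  exact: (zermelo_lt (mF _) (@cF _) (FT _)).
have gt w (a : R) : coord_dom i w ->
    a < norm_coord F i (w.1, w.2 + a *: wind_coord i w.1) <-> a < (wind_norm \o tangent_param i) w.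
  move: w => [x y] ix; rewrite norm_coord_wind //.
  exact: (zermelo_gt (mF _) (@cF _) (FT _)).
have up : norm_coord F i (z.1, z.2 + (g + e) *: wind_coord i z.1) < g + e.
  by apply/lt => //; rewrite ltrDl.
have dn : g - e < norm_coord F i (z.1, z.2 + (g - e) *: wind_coord i z.1).
  by apply/gt => //; rewrite ltrBlDr ltrDl.
near=> w.
have dw : coord_dom i w by near: w.
rewrite ltr_distl; apply/andP; split; last first.
  suff : g - e < (wind_norm \o tangent_param i) w by rewrite ltrBlDr.
  by apply/gt => //; near: w; exact: (cvgr_gt _ (shift _) _ dn).
suff : (wind_norm \o tangent_param i) w < g + e by rewrite ltrBlDr.
by apply/lt => //; near: w; exact: (cvgr_lt _ (shift _) _ up).
Unshelve. all: by end_near. Qed.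

Lemma wind_norm_continuous : continuous wind_norm.
Proof.
have ccst (a : R) i z : chart_cod i z.1 -> {for z, continuous ((fun=> a) \o @tangent_param _ _ M i)}.
  by move=> _; exact: cvg_cst.
move=> v B /nbhs_ballP[e /= e0 eB].
have o1 : open [set w | wind_norm w < wind_norm v + e].
  by apply: (@tangent_open_lt _ _ _ wind_norm (fun=> wind_norm v + e)) => i z iz; [exact: wind_norm_coord_continuous|exact: ccst].
have o2 : open [set w | wind_norm v - e < wind_norm w].
  by apply: (@tangent_open_lt _ _ _ (fun=> wind_norm v - e) wind_norm) => i z iz; [exact: ccst|exact: wind_norm_coord_continuous].
have v1 : wind_norm v < wind_norm v + e by rewrite ltrDl.
have v2 : wind_norm v - e < wind_norm v by rewrite ltrBlDr ltrDl.
apply: filterS (open_near (openI o1 o2) (conj v1 v2)) => w [/= w1 w2].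
by apply: eB; rewrite -ball_normE /= distrC ltr_distl w1 w2.
Qed.

(** The equation is solved over the chart of TM at once, with the wind depending on the base point,
    which gives smoothness in both variables. *)
Lemma smooth_wind_norm_coord i :
  smooth_on (@coord_nonzero _ _ M i) ((wind_norm \o tangent_param i) : V * V -> R^o).
Proof.
pose sh (w : (V * V) * R^o) : V * V := (w.1.1, w.1.2 + w.2 *: wind_coord i w.1.1).
pose D : set ((V * V) * R^o) := setT `&` fst @^-1` coord_dom i.
have oD : open D.
  apply: open_setI_preimage; [exact: openT| |exact: open_coord_dom].
  by move=> w _; exact: cvg_fst.
have ssh : smooth_on D sh.
  have s11 : smooth_on D (fun w => w.1.1).
    apply: (@smooth_on_comp _ _ _ _ _ setT fst fst) => //.
    - exact: has_basis_VV.
    - exact: smooth_on_fst.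
    - exact: smooth_on_fst.
  apply: smooth_on_pair => //; apply: smooth_onD => //.
    apply: (@smooth_on_comp _ _ _ _ _ setT fst snd) => //.
    - exact: has_basis_VV.
    - exact: smooth_on_fst.
    - exact: smooth_on_snd.
  apply: smooth_onZ => //; first exact: smooth_on_snd.
  apply: (@smooth_on_comp _ _ _ _ _ (chart_cod i) (fun w => w.1.1) (wind_coord i)) => //.
  - exact: has_basis_rV.
  - by move=> w [].
(* The equation is smooth where the shifted vector is nonzero; [zermelo_point_neq0] places the roots
   there. *)
pose O := D `&` sh @^-1` coord_nonzero i.
have oO : open O.
  apply: open_setI_preimage; [exact: oD| |exact: open_coord_nonzero].
  exact: (smooth_on_continuous ssh).
pose H w : R^o := norm_coord F i (sh w) - w.2.
have sH : smooth_on O H.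
  apply: smooth_onB => //; last exact: smooth_on_snd.
  apply: (@smooth_on_comp _ _ _ _ _ (coord_nonzero i) sh (norm_coord F i)) => //.
  - exact: has_basis_VV.
  - by move=> w [].
  - by apply: smooth_on_restrict ssh => w [].
  - exact: smooth_norm_coord.
apply: (@smooth_on_root _ _ _ O H) => //; first exact: has_basis_VV.
  exact: open_coord_nonzero.
move=> [x y] [/= ix y0]; set p := param i x; set v : V := vec (tangent_param i (x, y)).
have v0 : v != 0 by rewrite /v tangent_param0.
set g := wind_norm _.
have gE : g = zermelo (fiber_norm F p) (T p) v by [].
have HE (t : R) : H ((x, y), t : R^o) = fiber_norm F p (v + t *: T p) - t.
  by rewrite /H /sh /= norm_coord_wind.
have n0 : v + g *: T p != 0 by rewrite gE; exact: (zermelo_point_neq0 (mF p) (@cF p) (FT p)).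
have Oz : O ((x, y), g : R^o).
  split; [by split|split; [exact: ix|]].
  by rewrite /= -(tangent_param0 _ ix) tangent_param_wind.
split=> //.
- by rewrite HE gE (zermeloP (mF p) (@cF p) (FT p)) subrr.
- have [_ <-] := is_derive_line0 (0, 1 : R^o) (smooth_on_differentiable sH Oz).
  have sFp : smooth_on (@nonzero _ V) (fiber_norm F p) by case: (mF p).
  have D1 := is_derive_line0 (T p) (smooth_on_differentiable sFp n0).
  have [_ E] := is_deriveB D1 (is_derive_id (0 : R) 1).
  have lt := minkowski_derive_wind (mF p) (FT p) n0.
  rewrite (_ : (fun s : R => H _) = (fun s : R => fiber_norm F p (v + g *: T p + s *: T p)) - id - cst g).
    rewrite deriveB; last exact: derivable_cst.
      by rewrite E derive_cst subr0 subr_eq0 lt_eqF.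
    by case: (is_deriveB D1 (is_derive_id (0 : R) 1)).
  apply/funext => s; rewrite !fctE.
  have -> : ((x, y), g : R^o) + s *: (0, 1 : R^o) = ((x, y), g + s : R^o) :> (V * V) * R^o.
    by apply/pair_equal_spec; split; rewrite /= ?scaler0 ?addr0 // /GRing.scale /= mulr1.
  by rewrite HE scalerDl addrA opprD addrA addrAC.
- move=> t /eqP; rewrite HE subr_eq0 => /eqP tE.
  exact: (zermelo_unique (mF p) (@cF p) (FT p)).
Qed.

Lemma smooth_fiber_zermelo p : smooth_on (@nonzero _ V) (zermelo (fiber_norm F p) (T p)).
Proof.
apply: (@smooth_on_ext _ _ _ _ (fun v => (wind_norm \o tangent_param (chart_at p)) (chart (chart_at p) p, v))).
- exact: open_nonzero.
- by move=> v _; rewrite /= -/(tangent_param _ (_, v)) tangent_param_at.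
- by apply: smooth_fiber_slice; exact: smooth_wind_norm_coord.
Qed.

Lemma wind_norm_finsler : finsler_metric (kernel_bundle omega) wind_norm.
Proof.
have G0 p (v : V) : v != 0 -> 0 < wind_norm (Tan p v).
  exact: (zermelo_gt0 (mF p) (@cF p) (FT p)).
split.
- split; first by apply: continuous_subspaceT; exact: wind_norm_continuous.
  (* The norm is smooth at every nonzero vector, so off the kernel bundle it extends itself. *)
  move=> i z [iz [_ nz]]; exists (coord_nonzero i), (wind_norm \o tangent_param i); split=> //.
  + exact: open_coord_nonzero.
  + by rewrite -in_coord_nonzero.
  + exact: smooth_wind_norm_coord.
- by move=> [p v] _; exact: (zermelo_ge0 (mF p) (@cF p) (FT p)).
- by move=> [p v] _; exact: G0.
- by move=> p v a _; exact: (zermeloZ (mF p) (@cF p) (FT p)).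
- move=> p v u _ v0 _ u0.
  exact: (zermelo_second_variation (mF p) (@cF p) (FT p) (@smooth_fiber_zermelo p) v0 u0).
Qed.

(** At level 1 the defining equation [F (w + l T) = l] reads [F (w + T) = 1]. *)
Lemma wind_norm_indicatrix : indicatrix (kernel_bundle omega) wind_norm =
  translate_by_neg T (indicatrix [set: tangent M] F `&`
    [set v | omega (base v) (vec v) = 1]).
Proof.
apply/seteqP; split=> [[p v] [/= kv Gv]|_ [[p v] [[_ Fv] ov] <-]].
  exists (Tan p (v + T p)) => /=; last by rewrite addrK.
  split.
    have := zermeloP (mF p) (@cF p) (FT p) v.
    by rewrite -[zermelo _ _ _]/(wind_norm (Tan p v)) Gv scale1r.
  by rewrite -[omega p _]/(om p (v + T p)) linearD [om p v]kv add0r; exact: omT.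
split=> /=.
  rewrite /kernel_bundle /= -[omega p _]/(om p (v - T p)) linearB.
  by rewrite [om p v]ov [om p (T p)]omT subrr.
apply/esym; apply: (zermelo_unique (mF p) (@cF p) (FT p)).
by rewrite /= scale1r subrK; exact: Fv.
Qed.

(** Writing [v = w + a T] with [a = omega v], the condition [F v = omega v] is the defining equation
    of the root at [w]. *)
Lemma wind_norm_cone : [set v : tangent M | vec v != 0 /\ F v = omega (base v) (vec v)] =
  cone_of_triple omega T wind_norm.
Proof.
apply/seteqP; split=> [[p v] [/= v0 Fv]|_ [p [w [kw w0 ->]]]].
  pose a := om p v; pose w : V := v - a *: T p.
  have wE : v = w + a *: T p by rewrite subrK.
  have ka : om p w = 0.
    by rewrite /w linearB linearZ /= omT /GRing.scale /= mulr1 subrr.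
  have Gw : wind_norm (Tan p w) = a.
    apply/esym; apply: (zermelo_unique (mF p) (@cF p) (FT p)).
    by rewrite /= -wE; exact: Fv.
  exists p, w; split=> //; last by rewrite Gw addrC -wE.
  (* If [w = 0], then [v = a T] with [F v = a > 0], so [F T = 1], against [FT]. *)
  apply: contraTneq (FT p) => w_0.
  have a0 : 0 < a by rewrite /a -[om p v]/(omega p v) -Fv; case: (mF p) => _ _ /(_ v v0).
  have vE : v = a *: T p by rewrite wE w_0 add0r.
  have : fiber_norm F p v = a by exact: Fv.
  rewrite vE; case: (mF p) => _ _ _ Fh _; rewrite Fh // => /(canRL (mulKf (lt0r_neq0 a0))) ->.
  by rewrite mulVf ?gt_eqF // ltxx.
rewrite addrC; split => /=; first exact: (zermelo_point_neq0 (mF p) (@cF p) (FT p)).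
have := zermeloP (mF p) (@cF p) (FT p) w.
rewrite /fiber_norm /wind_norm /= => ->.
rewrite -[omega p _]/(om p (w + _ *: T p)) linearD linearZ /= kw add0r.
by rewrite omT /GRing.scale /= mulr1.
Qed.

End ConeTriple.

(** Dividing a nonzero [v] by [F' v] puts it on the common indicatrix, where [F] is 1; homogeneity
    then recovers [F v]. *)
Lemma finsler_indicatrix_unique (R : realType) (n : nat) (M : manifold R n)
    (E : set (tangent M)) (F F' : tangent M -> R) :
  (forall p v (a : R), E (Tan p v) -> E (Tan p (a *: v))) ->
  finsler_metric E F -> finsler_metric E F' -> indicatrix E F' = indicatrix E F ->
  forall v, E v -> F' v = F v.
Proof.
move=> conE [_ _ Fpos Fh _] [_ _ Fpos' Fh' _] I [p v] Ev.
have [v0|v0] := eqVneq v 0.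
  (* No multiple of the zero vector lies on an indicatrix; its value is forced to 0 by homogeneity
     with factor 2. *)
  have z (G : tangent M -> R) : (forall p v (a : R), E (Tan p v) -> 0 < a ->
      G (Tan p (a *: v)) = a * G (Tan p v)) -> G (Tan p v) = 0.
    by move=> Gh; have := Gh p v 2 Ev; rewrite v0 scaler0 => /(_ (ltr0Sn _ 1)); lra.
  by rewrite (z _ Fh) (z _ Fh').
have F'0 : 0 < F' (Tan p v) by exact: Fpos'.
have Fi : 0 < (F' (Tan p v))^-1 by rewrite invr_gt0.
have : indicatrix E F' (Tan p ((F' (Tan p v))^-1 *: v)).
  by split; [exact: conE|rewrite Fh' // mulVf ?gt_eqF].
rewrite I => -[_]; rewrite Fh // => /(canRL (mulKf (lt0r_neq0 Fi))) ->.
by rewrite invrK mulr1.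
Qed.

(** * Existence of the vector field *)

Section FlatFunction.
Context {R : realType}.

(* Starting the powers at 1 keeps the family closed under differentiation. *)
Definition flat (m : nat) (s : R) : R^o :=
  if 0 < s then s^-1 ^+ m.+1 * expR (- s^-1) else 0.

Lemma flat_gt0 m s : 0 < s -> 0 < flat m s.
Proof. by move=> s0; rewrite /flat s0 mulr_gt0 ?exprn_gt0 ?invr_gt0 ?expR_gt0. Qed.

Lemma flat_eq0 m s : s <= 0 -> flat m s = 0.
Proof. by move=> s0; rewrite /flat ltNge s0. Qed.

Lemma flat_ge0 m s : 0 <= flat m s.
Proof. by have [/flat_gt0/ltW//|/flat_eq0->//] := ltP 0 s. Qed.

(** The term of degree [m + 3] of the series bounds [expR s^-1] from below and leaves two spare
    powers of [s], enough for a zero derivative at 0. *)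
Lemma flat_le m s : 0 < s -> flat m s <= (m.+3)`!%:R * s ^+ 2.
Proof.
move=> s0; rewrite /flat s0 expRN.
have i0 : 0 < s^-1 by rewrite invr_gt0.
rewrite ler_pdivrMr ?expR_gt0 //.
have : s^-1 ^+ m.+3 / (m.+3)`!%:R <= expR s^-1.
  by apply: le_trans (expR_ge1Dxn m.+2 (ltW i0)); rewrite lerDr.
have f0 : (0 : R) < (m.+3)`!%:R by rewrite ltr0n fact_gt0.
rewrite ler_pdivrMr // => h.
have -> : s^-1 ^+ m.+1 = s ^+ 2 * s^-1 ^+ m.+3.
  by rewrite (exprS s^-1 m.+2) (exprS s^-1 m.+1); field; rewrite gt_eqF.
have -> : (m.+3)`!%:R * s ^+ 2 * expR s^-1 = s ^+ 2 * (expR s^-1 * (m.+3)`!%:R) by ring.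
by rewrite (@ler_pM2l R) ?exprn_gt0.
Qed.

(** The product rule for [s^-1 ^+ m.+1 * expR (- s^-1)]: the exponential contributes two more powers
    of [s^-1], the power factor one more. *)
Definition flat' m (s : R) : R := flat m.+2 s - m.+1%:R * flat m.+1 s.

Lemma is_derive_flat m (s : R) : is_derive s 1 (flat m) (flat' m s).
Proof.
case: (ltgtP s 0) => [sn|sp|->].
- have -> : flat' m s = 0 by rewrite /flat' !flat_eq0 ?ltW // mulr0 subr0.
  apply: (@near_eq_is_derive _ _ _ (cst 0)).
  near=> t; rewrite flat_eq0 // ltW //; near: t; exact: lt_nbhsl.
- apply: (@near_eq_is_derive _ _ _ (fun t : R => t^-1 ^+ m.+1 * expR (- t^-1))).
    by near=> t; rewrite /flat ifT //; near: t; exact: lt_nbhsr.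
  have s0 : s != 0 by rewrite gt_eqF.
  have di : is_derive s 1 (fun t : R => t^-1) (- s ^- 2).
    have dV := differentiable_Rinv s0.
    apply: DeriveDef; first exact/derivable1_diffP.
    by rewrite (deriveE _ dV) diff_Rinv // /GRing.scale /= mulr1.
  have dX := is_deriveX m.+1 di.
  have dN := is_deriveN di.
  have dE : is_derive s 1 (fun t : R => expR (- t^-1)) (expR (- s^-1) * - - s ^- 2).
    exact: (@is_derive1_comp _ expR (fun t : R => - t^-1)).
  have D := is_deriveM dX dE.
  rewrite (_ : (fun t : R => _) = ((fun t : R => t^-1) ^+ m.+1 * (fun t : R => expR (- t^-1)))).
    apply: (is_derive_eq D).
    rewrite /flat' /flat sp /GRing.scale /= !fctE !exprS.
    by move: (s^-1 ^+ m) (expR _) (m.+1%:R) => a b c; field.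
  by apply/funext => t; rewrite !fctE.
- have -> : flat' m 0 = 0 by rewrite /flat' !flat_eq0 // mulr0 subr0.
  have f0 : (0 : R) < (m.+3)`!%:R by rewrite ltr0n fact_gt0.
  have D : is_diff (0 : R) (flat m) (\0 : {linear R -> R^o}).
    apply: is_diff_eps => [x|e e0]; first exact: cvg_cst.
    near=> h; rewrite addr0 (flat_eq0 m (lexx 0)) /= !subr0.
    have [h0|h0] := leP h 0.
      by rewrite flat_eq0 // normr0 mulr_ge0 // ltW.
    rewrite (ger0_norm (flat_ge0 m h)) (ger0_norm (ltW h0)).
    apply: (le_trans (flat_le m h0)); rewrite expr2 mulrA ler_pM2r // mulrC.
    rewrite -ler_pdivlMr // ltW //.
    have : `|h| < e / (m.+3)`!%:R.
      by near: h; apply: (@nbhs0_lt _ R^o); rewrite divr_gt0.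
    by rewrite (ger0_norm (ltW h0)).
  apply: DeriveDef; first by apply: diff_derivable; case: D.
  by rewrite (is_diff_derive _ D).
Unshelve. all: by end_near. Qed.

Lemma smooth_flat m : smooth_on setT (flat m).
Proof.
move=> k; elim: k m => [|k IH] m.
  move=> s _; apply: differentiable_continuous; apply/derivable1_diffP.
  by case: (is_derive_flat m s).
split=> [s _|v]; first by apply/derivable1_diffP; case: (is_derive_flat m s).
apply: (@Ck_on_ext _ _ _ _ _ (fun s => v *: (flat m.+2 s + (- m.+1%:R) *: flat m.+1 s))).
- exact: openT.
- move=> s _; have ds : differentiable (flat m) s.
    by apply/derivable1_diffP; case: (is_derive_flat m s).
  rewrite (deriveE _ ds) -[v in RHS]mulr1 -[v * 1]/(v *: (1 : R)) linearZ -(deriveE _ ds).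
  have [_ ->] := is_derive_flat m s.
  by rewrite /flat' /GRing.scale /= mulNr.
apply: Ck_onZ; [exact: openT|exact: Ck_on_cst|].
apply: Ck_onD; [exact: openT|exact: IH|].
by apply: Ck_onZ; [exact: openT|exact: Ck_on_cst|exact: IH].
Qed.

End FlatFunction.

(** * Smooth functions and vector fields on the manifold *)

Section SmoothFields.
Context {R : realType} {n : nat} (M : manifold R n).
Let V : normedModType R := 'rV[R]_n.
Implicit Types (i j : chart_index M) (b : M -> R) (X Y : M -> V).

Definition manifold_smooth b :=
  forall i, smooth_on (chart_cod i) (fun x : V => b (param i x) : R^o).

Lemma manifold_smooth_cst (a : R) : manifold_smooth (fun=> a).
Proof. by move=> i; exact: smooth_on_cst. Qed.

Lemma manifold_smoothM b c : manifold_smooth b -> manifold_smooth c ->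
  manifold_smooth (fun p => b p * c p).
Proof. by move=> sb sc i; apply: smooth_onM => //; exact: open_chart_cod. Qed.

Lemma manifold_smoothB b c : manifold_smooth b -> manifold_smooth c ->
  manifold_smooth (fun p => b p - c p).
Proof. by move=> sb sc i; apply: smooth_onB => //; exact: open_chart_cod. Qed.

Lemma manifold_smooth_comp (g : R^o -> R^o) b : smooth_on setT g ->
  manifold_smooth b -> manifold_smooth (fun p => g (b p)).
Proof.
move=> sg sb i; apply: (@smooth_on_comp _ _ _ _ _ setT (fun x => b (param i x) : R^o) g) => //.
- exact: has_basis_real.
- exact: open_chart_cod.
Qed.

Lemma manifold_smooth_continuous b : manifold_smooth b -> continuous (b : M -> R).
Proof.
move=> sb p; pose i := chart_at p; have ip := chart_at_dom p.
have c : {for p, continuous ((fun x : V => b (param i x) : R^o) \o chart i)}.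
  apply: continuous_comp; first exact: chart_continuous.
  exact: (smooth_on_continuous (sb i) (chart_codP ip)).
move=> B; rewrite -{1}(chartK ip) => /c.
have := open_near (@chart_dom_open _ _ M i) ip.
by apply: filterS2 => q iq /=; rewrite chartK.
Qed.

Lemma tangent_coordZ i p (a : R) (v : V) :
  tangent_coord i p (a *: v) = a *: tangent_coord i p v.
Proof. by rewrite /tangent_coord linearZ. Qed.

Lemma tangent_coordD i p (u v : V) :
  tangent_coord i p (u + v) = tangent_coord i p u + tangent_coord i p v.
Proof. by rewrite /tangent_coord linearD. Qed.

Lemma vector_field0 : vector_field ((fun=> 0) : M -> V).
Proof.
move=> i; rewrite (_ : (fun x => _) = fun=> 0); first exact: smooth_on_cst.
by apply/funext => x; rewrite /tangent_coord linear0.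
Qed.

Lemma vector_fieldD X Y : vector_field X -> vector_field Y ->
  vector_field (fun p => X p + Y p).
Proof.
move=> sX sY i; rewrite (_ : (fun x => _) = fun x => tangent_coord i (param i x) (X (param i x)) +
  tangent_coord i (param i x) (Y (param i x))).
  by apply: smooth_onD; [exact: open_chart_cod|exact: sX|exact: sY].
by apply/funext => x; rewrite tangent_coordD.
Qed.

Lemma vector_fieldZ b X : manifold_smooth b -> vector_field X ->
  vector_field (fun p => b p *: X p).
Proof.
move=> sb sX i; rewrite (_ : (fun x => _) = fun x => b (param i x) *: tangent_coord i (param i x) (X (param i x))).
  by apply: smooth_onZ; [exact: open_chart_cod|exact: sb|exact: sX].
by apply/funext => x; rewrite tangent_coordZ.
Qed.

Lemma vector_field_sum N (X : 'I_N -> M -> V) : (forall k, vector_field (X k)) ->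
  vector_field (fun p => \sum_(k < N) X k p).
Proof.
elim: N X => [|N IH] X sX.
  rewrite (_ : (fun p => _) = fun=> 0); first exact: vector_field0.
  by apply/funext => p; rewrite big_ord0.
rewrite (_ : (fun p => _) = fun p => \sum_(k < N) X (widen_ord (leqnSn N) k) p + X ord_max p).
  by apply: vector_fieldD => //; exact: IH.
by apply/funext => p; rewrite big_ord_recr.
Qed.

Lemma open_param_preimage i (W : set M) : open W ->
  open (chart_cod i `&` param i @^-1` W).
Proof.
move=> oW; apply: open_setI_preimage; [exact: open_chart_cod| |exact: oW].
by move=> x ix; exact: param_continuous.
Qed.

Lemma vector_field_local X : (forall q, exists W Y, [/\ open W, W q, vector_field Y
    & forall p, W p -> X p = Y p]) -> vector_field X.
Proof.
move=> H i; apply: smooth_on_local => x ix; have [W [Y [oW Wx sY XY]]] := H (param i x).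
exists (chart_cod i `&` param i @^-1` W); split=> //.
apply: (@smooth_on_ext _ _ _ _ (fun x => tangent_coord i (param i x) (Y (param i x)))).
- exact: open_param_preimage.
- by move=> y [_ Wy]; rewrite XY.
- by apply: smooth_on_restrict (sY i) => y [].
Qed.

Lemma compact_closed_ball (x : V) (r : R) : compact [set y : V | `|y - x| <= r].
Proof.
apply: bounded_closed_compact.
  exists (`|x| + r); split; first exact: num_real.
  move=> a xa y /= yr; apply: ltW; apply: le_lt_trans xa.
  by rewrite -(subrK x y) (le_trans (ler_normD _ _)) // addrC lerD2l.
rewrite (_ : [set _ | _] = (fun y => `|y - x|) @^-1` [set a | a <= r]) //.
apply: closed_comp; last exact: closed_le.
move=> y _; apply: (@continuous_comp _ _ _ (fun y : V => y - x) (fun y => `|y|)).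
  apply: (@smooth_on_continuous _ _ _ setT) => //.
  by apply: smooth_onB; [exact: openT|exact: smooth_on_id|exact: smooth_on_cst].
exact: norm_continuous.
Qed.

(** The norm on row vectors is the maximum norm, which is not smooth; bump functions use this
    Euclidean square instead, and [sqr_dist_lt] compares the two. *)
Definition sqr_dist (x y : V) : R^o := \sum_k (y 0 k - x 0 k) ^+ 2.

Lemma smooth_sqr_dist x (S : set V) : open S -> smooth_on S (sqr_dist x).
Proof.
move=> oS; have sk k : smooth_on S (fun y : V => y 0 k - x 0 k : R^o).
  apply: smooth_onB => //; last exact: smooth_on_cst.
  by apply: (@smooth_coord _ _ V S id) => //; exact: smooth_on_id.
apply: (@smooth_on_sum _ _ _ _ _ (fun k (y : V) => (y 0 k - x 0 k) ^+ 2 : R^o)) => // k.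
exact: (smooth_onM oS (sk k) (sk k)).
Qed.

Lemma sqr_dist_xx x : sqr_dist x x = 0.
Proof. by rewrite /sqr_dist big1 // => k _; rewrite subrr expr0n. Qed.

Lemma sqr_dist_lt x y (r : R) : 0 < r -> sqr_dist x y < r ^+ 2 -> `|y - x| <= r.
Proof.
move=> r0 d; rewrite [leLHS]/Num.Def.normr /= mx_normrE bigmax_le ?(ltW r0) //= => -[i k] _ /=.
rewrite !mxE ord1 -(@ler_pXn2r _ 2) ?nnegrE ?(ltW r0) // real_normK ?num_real //.
apply: le_trans (ltW d); rewrite /sqr_dist (bigD1 k) //= lerDl.
by apply: sumr_ge0 => l _; exact: sqr_ge0.
Qed.

End SmoothFields.

(** * Gluing local sections of a convex cone bundle *)

Section Sections.
Context {R : realType} {n : nat} (M : manifold R n).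
Let V : normedModType R := 'rV[R]_n.
Variable A : set (tangent M).
Hypotheses (oA : open A) (neA : forall p, fiber A p !=set0)
  (conA : forall p (v : V) (a : R), A (Tan p v) -> 0 < a -> A (Tan p (a *: v))).

(** A vector with constant components in a chart stays in [A] on a small ball; multiplied by a bump
    supported there, it extends by zero to the whole manifold. *)
Lemma local_section (p0 : M) : exists (b : M -> R) (X : M -> V),
  [/\ manifold_smooth b, vector_field X, 1 < b p0,
      (forall q, 0 <= b q) & forall q, (b q = 0 -> X q = 0) /\ (0 < b q -> A (Tan q (X q)))].
Proof.
pose i := chart_at p0; pose x0 := chart i p0; have ip0 : chart_dom i p0 := chart_at_dom p0.
have [Y AY] := neA p0.
have A0 : in_coord i A (x0, Y).
  by split; [exact: chart_codP|rewrite /i /x0 tangent_param_at].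
have c0 : {for x0, continuous (fun x : V => (x, Y))} by exact: continuous_pair_cst.
have near0 : \forall x \near x0, in_coord i A (x, Y).
  have oAi : open (in_coord i A) by have tA : tangent_open A := oA; exact: tA.
  exact: (c0 _ (open_near oAi A0)).
have [r r0 ball_r] : exists2 r, 0 < r & forall x : V, `|x - x0| <= r -> in_coord i A (x, Y).
  move: near0 => /nbhs_ballP[e /= e0 eA]; exists (e / 2); first by rewrite divr_gt0.
  move=> x xe; apply: eA; rewrite -ball_normE /= distrC; apply: (le_lt_trans xe).
  by rewrite ltr_pdivrMr // ltr_pMr // ltr1n.
(* Positive exactly on the Euclidean ball of radius [r], which lies in the closed maximum-norm ball
   of the same radius. *)
pose g (x : V) : R^o := flat 0 (r ^+ 2 - sqr_dist x0 x).
have g0 : 0 < g x0 by apply: flat_gt0; rewrite sqr_dist_xx subr0 exprn_gt0.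
have sg : smooth_on setT g.
  apply: (@smooth_on_comp _ _ _ _ _ setT (fun x => r ^+ 2 - sqr_dist x0 x : R^o) (flat 0)) => //.
  - exact: has_basis_real.
  - exact: openT.
  - apply: smooth_onB; [exact: openT|exact: smooth_on_cst|].
    by apply: smooth_sqr_dist; exact: openT.
  - exact: smooth_flat.
have g_ball x : g x != 0 -> `|x - x0| <= r.
  apply: contraNT; rewrite -ltNge => h; rewrite /g flat_eq0 //.
  rewrite subr_le0 leNgt; apply/negP => /(sqr_dist_lt r0).
  by rewrite leNgt h.
(* Normalised so that [b p0 = 2], hence above the threshold 1 on a whole neighbourhood. *)
pose b (p : M) : R := if pselect (chart_dom i p) then 2 / g x0 * g (chart i p) else 0.
pose X (p : M) : V := if pselect (chart_dom i p)
  then b p *: vec (tangent_param i (chart i p, Y)) else 0.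
have bE p : chart_dom i p -> b p = 2 / g x0 * g (chart i p).
  by rewrite /b; case: pselect.
have XE p : chart_dom i p -> X p = b p *: vec (tangent_param i (chart i p, Y)).
  by rewrite /X; case: pselect.
have b_out p : ~ chart_dom i p -> b p = 0 by rewrite /b; case: pselect.
have X_out p : ~ chart_dom i p -> X p = 0 by rewrite /X; case: pselect.
have b0X p : b p = 0 -> X p = 0.
  by have [/XE ->|/X_out//] := pselect (chart_dom i p); move=> ->; rewrite scale0r.
(* Compact, hence closed since the manifold is Hausdorff. The chart domain and the complement of [K]
   then form an open cover, and [b] and [X] vanish on the latter. *)
pose K := param i @` [set x : V | `|x - x0| <= r].
have KC : [set x : V | `|x - x0| <= r] `<=` chart_cod i by move=> x /ball_r[].
have cK : closed K.
  apply: compact_closed; first exact: manifold_hausdorff.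
  apply: continuous_compact; last exact: compact_closed_ball.
  apply: continuous_in_subspaceT => x; rewrite inE => /KC; exact: param_continuous.
have bK p : ~ K p -> b p = 0.
  move=> nK; have [ip|/b_out//] := pselect (chart_dom i p).
  rewrite bE //; apply/eqP; rewrite mulf_eq0; apply/orP; right.
  apply: contra_notT nK => /g_ball h; exists (chart i p) => //; exact: chartK.
have KD p : K p -> chart_dom i p by move=> [x /KC ix <-]; exact: param_dom.
have oK : open (~` K) by exact: closed_openC.
have cover j (x : V) : chart_cod j x -> overlap j i x \/ (~` K) (param j x).
  move=> jx; have [ip|nip] := pselect (chart_dom i (param j x)); [left|right].
    exact/overlapP.
  by move=> /KD.
have sb : manifold_smooth b.
  move=> j; apply: smooth_on_local => x jx; have [ij|nK] := cover j x jx.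
    exists (overlap j i); split=> //.
    apply: (@smooth_on_ext _ _ _ _ (fun x => 2 / g x0 * g (chart i (param j x)) : R^o)).
    - exact: open_overlap.
    - by move=> y /overlapP[_ iy]; rewrite bE.
    - apply: smooth_onM; [exact: open_overlap|exact: smooth_on_cst|].
      apply: (@smooth_on_comp _ _ _ _ _ setT (chart i \o param j) g) => //.
      + exact: has_basis_rV.
      + exact: open_overlap.
      + exact: transition_smooth.
  exists (chart_cod j `&` param j @^-1` (~` K)); split=> //.
  apply: (@smooth_on_ext _ _ _ _ (fun=> 0)).
  - exact: open_param_preimage.
  - by move=> y [_ /bK ->].
  - exact: smooth_on_cst.
have sX : vector_field X.
  move=> j; apply: smooth_on_local => x jx; have [ij|nK] := cover j x jx.
    exists (overlap j i); split=> //.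
    apply: (@smooth_on_ext _ _ _ _ (fun x => b (param j x) *: jac i j (chart i (param j x)) Y)).
    - exact: open_overlap.
    - move=> y /overlapP[jy iy]; rewrite XE // tangent_coordZ; congr (_ *: _).
      set p := param j y; rewrite /tangent_coord -/(jac _ _ _ _) tangent_paramE /=.
      have cp : chart_cod i (chart i p) by exact: chart_codP.
      have pE : param i (chart i p) = p by exact: chartK.
      have := @jac_comp _ _ M i (chart_at p) j (chart i p) Y.
      rewrite pE => -> //; last exact: param_dom.
      by apply/overlapP; rewrite pE; split=> //; exact: chart_at_dom.
    - apply: smooth_onZ; first exact: open_overlap.
        by apply: smooth_on_restrict (sb j) => y /overlapP[].
      apply: smooth_jac; [exact: open_overlap|exact: transition_smooth|exact: smooth_on_cst|].
      move=> y /overlapP[jy iy]; apply/overlapP; rewrite chartK //.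
      by split; [exact: chart_codP|exact: param_dom].
  exists (chart_cod j `&` param j @^-1` (~` K)); split=> //.
  apply: (@smooth_on_ext _ _ _ _ (fun=> 0)).
  - exact: open_param_preimage.
  - by move=> y [_ /bK /b0X ->]; rewrite /tangent_coord linear0.
  - exact: smooth_on_cst.
have c2 : 0 < 2 / g x0 by rewrite divr_gt0.
exists b, X; split=> //.
- by rewrite bE // divfK ?gt_eqF // ltr1n.
- move=> q; have [iq|/b_out->//] := pselect (chart_dom i q).
  by rewrite bE // mulr_ge0 ?flat_ge0 // ltW.
- move=> q; split; first exact: b0X.
  have [iq|/b_out->] := pselect (chart_dom i q); last by rewrite ltxx.
  move=> bq; rewrite XE //; apply: conA => //.
  have gq : g (chart i q) != 0.
    by move: bq; rewrite bE // pmulr_rgt0 // => /gt_eqF/negbT.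
  have [_ ] := ball_r _ (g_ball _ gq); rewrite tangent_paramE chartK //.
Qed.

Hypothesis addA : forall p (u v : V), A (Tan p u) -> A (Tan p v) -> A (Tan p (u + v)).

(** Sums of elements of [A] stay in [A]; the case of all terms zero is singled out because the empty
    sum need not lie in [A]. *)
Lemma section_sum p N (t : 'I_N -> V) : (forall j, t j = 0 \/ A (Tan p (t j))) ->
  (forall j, t j = 0) \/ A (Tan p (\sum_j t j)).
Proof.
elim: N t => [|N IH] t Ht; first by left; case.
rewrite big_ord_recr /=; have [t0|At] := IH _ (fun j => Ht (widen_ord (leqnSn N) j)).
  rewrite big1 ?add0r; last by move=> j _; exact: t0.
  have [tm|?] := Ht ord_max; last by right.
  left=> j; have [jN|jN] := ltnP j N.
    by rewrite -(t0 (Ordinal jN)); congr t; exact: val_inj.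
  rewrite -tm; congr t; apply: val_inj => /=; apply/eqP.
  by rewrite eqn_leq jN -ltnS ltn_ord.
by right; have [->|?] := Ht ord_max; rewrite ?addr0 //; exact: addA.
Qed.

(** For each member of a countable base contained in some admissible [W d], choose one such [d]; an
    injection into the natural numbers indexes the base, and [d0] fills the remaining indices. *)
Lemma lindelof (T : topologicalType) (D : Type) (d0 : D) (W : D -> set T) (Q : D -> Prop) :
  second_countable (T := T) -> Q d0 ->
  (forall p, exists d, [/\ Q d, open (W d) & W d p]) ->
  exists s : nat -> D, (forall k, Q (s k)) /\ forall p, exists k, W (s k) p.
Proof.
move=> [B /countable_injP[f injf] [_ basisB]] Q0 H.
pose P k d := Q d /\ exists U, [/\ B U, f U = k & U `<=` W d].
have /choice[s Hs] : forall k, exists d, Q d /\ ((exists d', P k d') -> P k d).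
  move=> k; have [[d Pd]|nP] := pselect (exists d', P k d').
    by exists d; split=> //; case: Pd.
  by exists d0.
exists s; split=> [k|p]; first by have [] := Hs k.
have [d [Qd oW Wp]] := H p.
have [U [BU Up] UW] := basisB p _ (open_near oW Wp).
exists (f U); have [_ Hk] := Hs (f U).
have [|_ [U' [BU' fU' U'W]]] := Hk; first by exists d; split=> //; exists U.
have E : U = U' by apply: injf; rewrite ?inE.
by apply: U'W; rewrite -E.
Qed.

(* With [c j = prod_(i < j) flat (1 - b i)], the sum of the [c j *: X j] is
   locally finite: [c j] vanishes where some [b i] with [i < j] exceeds [1]. *)
Lemma global_section : exists S : M -> V, vector_field S /\ forall p, A (Tan p (S p)).
Proof.
pose D := ((M -> R) * (M -> V))%type.
pose Q (d : D) := [/\ manifold_smooth d.1, vector_field d.2,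
  (forall q, 0 <= d.1 q) & forall q, (d.1 q = 0 -> d.2 q = 0) /\ (0 < d.1 q -> A (Tan q (d.2 q)))].
have Q0 : Q (fun=> 0, fun=> 0).
  split=> //=; [exact: manifold_smooth_cst|exact: vector_field0|].
  by move=> q; split=> //; rewrite ltxx.
have [|s [Qs cov]] := @lindelof M D (fun=> 0, fun=> 0) (fun d => [set q | 1 < d.1 q]) Q
  (@manifold_second_countable _ _ M) Q0.
  move=> p; have [b [X [sb sX bp b0 bX]]] := local_section p.
  exists (b, X); split=> //=.
  rewrite (_ : [set q | _] = b @^-1` [set a | 1 < a]) //.
  apply: open_comp; last exact: open_gt.
  by move=> q _; exact: manifold_smooth_continuous.
pose b k := (s k).1; pose X k := (s k).2.
pose c := fix c (k : nat) : M -> R := if k is k'.+1 then fun q => c k' q * flat 0 (1 - b k' q) else fun=> 1.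
have sb k : manifold_smooth (b k) by have [] := Qs k.
have b0 k q : 0 <= b k q by have [_ _ h _] := Qs k; exact: h.
have sc k : manifold_smooth (c k).
  elim: k => [|k IH]; first exact: manifold_smooth_cst.
  apply: manifold_smoothM => //.
  apply: (manifold_smooth_comp (@smooth_flat _ 0)).
  by apply: manifold_smoothB => //; exact: manifold_smooth_cst.
have c0 k q : 0 <= c k q.
  by elim: k => [|k IH] /=; rewrite ?ler01 // mulr_ge0 // flat_ge0.
have c_zero k q m : 1 < b k q -> (k < m)%N -> c m q = 0.
  move=> bk; elim: m => // m IH; rewrite ltnS leq_eqVlt => /orP[/eqP <-|/IH E] /=.
    by rewrite flat_eq0 ?mulr0 // subr_le0 ltW.
  by rewrite E mul0r.
have c_pos k q : (forall l, (l < k)%N -> b l q = 0) -> 0 < c k q.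
  elim: k => [|k IH] H //=.
  rewrite mulr_gt0 ?IH //; first by move=> l lk; apply: H; exact: ltnW.
  by rewrite H // subr0 flat_gt0.
pose S N q := \sum_(k < N) c k q *: X k q.
have sS N : vector_field (S N).
  apply: vector_field_sum => k; apply: vector_fieldZ => //.
  by have [] := Qs k.
have S_stable k q N : 1 < b k q -> (k < N)%N -> S N q = S k.+1 q.
  move=> bk; elim: N => // N IH; rewrite ltnS leq_eqVlt => /orP[/eqP <- //|kN].
  by rewrite /S big_ord_recr /= (c_zero k) // scale0r addr0 -/(S N q) IH.
have /choice[N HN] : forall q, exists k, 1 < b k q by exact: cov.
(* The sum is cut at an index depending on [q]. Any other index whose bump exceeds 1 gives the same
   value, so near each point a single finite sum represents the field. *)
have S_eq k q : 1 < b k q -> S (N q).+1 q = S k.+1 q.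
  move=> bk; rewrite -(S_stable _ q (maxn (N q) k).+1 (HN q)) ?ltnS ?leq_maxl //.
  by rewrite (S_stable k) // ltnS leq_maxr.
exists (fun q => S (N q).+1 q); split.
  apply: vector_field_local => q; exists [set p | 1 < b (N q) p], (S (N q).+1); split=> //.
  - rewrite (_ : [set p | _] = b (N q) @^-1` [set a | 1 < a]) //.
    apply: open_comp; last exact: open_gt.
    by move=> p _; exact: manifold_smooth_continuous.
  - exact: HN.
  - by move=> p; exact: S_eq.
move=> p.
have term k : c k p *: X k p = 0 \/ A (Tan p (c k p *: X k p)).
  have [_ _ _ /(_ p)[bX bA]] := Qs k.
  have [/bX E|bn] := eqVneq ((s k).1 p) 0; first by left; rewrite /X E scaler0.
  have [->|cn] := eqVneq (c k p) 0; first by left; rewrite scale0r.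
  right; apply: conA; last by rewrite lt_neqAle eq_sym cn c0.
  by apply: bA; rewrite lt_neqAle eq_sym bn b0.
have [zero|//] := section_sum (t := fun k : 'I_(N p).+1 => c k p *: X k p) (fun k => term k).
(* All terms are now zero. At the least [m] with [b m p] nonzero, the coefficient [c m p] is
   positive, so its term lies in [A]; this puts 0, which is also the sum, in [A]. *)
have [m bm mmin] : exists2 m, b m p != 0 & forall l, (l < m)%N -> b l p = 0.
  have ex : exists m, b m p != 0 by exists (N p); rewrite gt_eqF // (lt_trans ltr01) // HN.
  case: (ex_minnP ex) => m bm mmin; exists m => // l lm; apply/eqP.
  by apply/negPn/negP => /mmin; rewrite leqNgt lm.
have mN : (m <= N p)%N.
  by rewrite leqNgt; apply/negP => /mmin E; have := HN p; rewrite E ltNge ler01.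
have Am : A (Tan p (X m p)).
  have [_ _ _ /(_ p)[_ bA]] := Qs m.
  by apply: bA; rewrite lt_neqAle eq_sym bm b0.
have cm : 0 < c m p by exact: c_pos.
have z : c m p *: X m p = 0 by exact: (zero (Ordinal (mN : m < (N p).+1)%N)).
have Az : A (Tan p 0) by rewrite -z; exact: conA.
rewrite (_ : S _ p = 0) //; rewrite /S big1 // => k _; exact: zero.
Qed.

End Sections.

(** The triangle inequality makes the cone additive, as gluing requires. A section [S] has
    [omega S > F S >= 0], so dividing by [omega S] is smooth and keeps it in the cone. *)
Lemma exists_wind (R : realType) (n : nat) (M : manifold R n) (F : tangent M -> R)
    (omega : M -> 'rV[R]_n -> R) :
  finsler_metric [set: tangent M] F -> one_form omega ->
  (forall p, fiber (cone_open F omega) p !=set0) ->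
  exists T : M -> 'rV[R]_n,
    vector_field T /\ forall p, omega p (T p) = 1 /\ cone_open F omega (Tan p (T p)).
Proof.
move=> hF ho ne; pose om := covector ho.
have mF p := minkowski_fiber_norm hF p.
have conA p (v : 'rV[R]_n) (a : R) : cone_open F omega (Tan p v) -> 0 < a ->
    cone_open F omega (Tan p (a *: v)).
  move=> Av a0; case: (mF p) => _ _ _ Fh _; rewrite /cone_open /=.
  rewrite -[F _]/(fiber_norm F p _) -[omega p _]/(om p _) Fh // linearZ /=.
  by rewrite ltr_pM2l.
have addA p (u v : 'rV[R]_n) : cone_open F omega (Tan p u) ->
    cone_open F omega (Tan p v) -> cone_open F omega (Tan p (u + v)).
  move=> Au Av; rewrite /cone_open /= -[omega p _]/(om p (u + v)) linearD.
  exact: le_lt_trans (minkowski_triangle (mF p) u v) (ltrD Au Av).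
have [S [sS AS]] := global_section (open_cone_open hF ho) ne conA addA.
have oS p : 0 < omega p (S p).
  by apply: le_lt_trans (AS p); exact: (minkowski_ge0 (mF p)).
exists (fun p => (omega p (S p))^-1 *: S p); split.
  apply: vector_fieldZ => // i.
  apply: (@smooth_onV _ _ _ (fun x => omega (param i x) (S (param i x)) : R^o)).
  - exact: open_chart_cod.
  - by move=> x _; rewrite gt_eqF.
  apply: (@smooth_on_ext _ _ _ _ (fun x => form_coord omega i
      (x, tangent_coord i (param i x) (S (param i x))))).
  - exact: open_chart_cod.
  - move=> x ix; have := tangent_paramK (S (param i x)) (param_dom ix).
    by rewrite paramK // /form_coord => ->.
  apply: (@smooth_on_comp _ _ _ _ _ (coord_dom i)
    (fun x => (x, tangent_coord i (param i x) (S (param i x)))) (form_coord omega i)).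
  - exact: has_basis_VV.
  - exact: open_chart_cod.
  - by [].
  - by apply: smooth_on_pair; [exact: open_chart_cod|exact: smooth_on_id|exact: sS].
  - exact: smooth_form_coord.
move=> p; split; last by apply: conA; rewrite ?invr_gt0.
by rewrite -[omega p (_ *: _)]/(om p _) linearZ /= /GRing.scale /= mulVf // gt_eqF.
Qed.

Theorem theorem4p1 (R : realType) (n : nat) (hn : (2 <= n)%N)
  (M : manifold R n) (Fhat : tangent M -> R) (omega : M -> 'rV[R]_n -> R)
  (hFhat : finsler_metric [set: tangent M] Fhat)
  (homega : one_form omega) (homega0 : nonvanishing omega)
  (hmeet : forall p : M,
    fiber (indicatrix [set: tangent M] Fhat) p `&` omega p @^-1` [set 1]
      !=set0)
  (htransverse : forall p : M,
    transverse_levels (fiber_fun Fhat p) (omega p) 1) :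
  let L := fun v : tangent M =>
    omega (base v) (vec v) ^+ 2 - Fhat v ^+ 2 in
  let Abar := [set w : tangent M |
    nonzero_vectors w /\ Fhat w <= omega (base w) (vec w)] in
  let A := interior Abar in
  let admissible := fun T : M -> 'rV[R]_n =>
    vector_field T /\ forall p, omega p (T p) = 1 /\ A (Tan p (T p)) in
  let has_translated_indicatrix := fun (T : M -> 'rV[R]_n) F =>
    indicatrix (kernel_bundle omega) F =
    translate_by_neg T
      (indicatrix [set: tangent M] Fhat `&`
       [set v | omega (base v) (vec v) = 1]) in
  [/\ cone_closure A = Abar,
      lorentz_finsler_metric A L,
      exists T, admissible T
    & forall T, admissible T ->
        exists F : tangent M -> R,
          [/\ cone_triple omega T F,
              has_translated_indicatrix T F,
              (forall F', finsler_metric (kernel_bundle omega) F' ->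
                 has_translated_indicatrix T F' ->
                 forall v, kernel_bundle omega v -> F' v = F v)
            & cone_structure A = cone_of_triple omega T F]].
Proof.
move=> L Abar A admissible translated.
have AE : A = cone_open Fhat omega.
  exact: (interior_cone_bar hFhat homega homega0 htransverse).
have lf := lorentz_finsler_cone hFhat homega homega0 htransverse hmeet.
have clA : cone_closure A = Abar.
  by rewrite AE; exact: (cone_closure_open hFhat homega homega0 htransverse).
have ne p : fiber (cone_open Fhat omega) p !=set0.
  by case: lf => -[_ _ /(_ p)[]].
split=> //; first by rewrite AE.
  by have [T [vT HT]] := exists_wind hFhat homega ne; exists T; split=> // p; rewrite AE.
move=> T [vT HT].
have omT p : omega p (T p) = 1 by have [] := HT p.
(* Where [omega] is 1, lying in the open cone is the condition [F T < 1] of Zermelo navigation. *)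
have FT p : fiber_norm Fhat p (T p) < 1.
  by have [ot] := HT p; rewrite AE /cone_open /= ot.
have wF := wind_norm_finsler omega hFhat vT FT.
have wI : translated T (wind_norm Fhat T) by exact: (wind_norm_indicatrix hFhat homega omT FT).
exists (wind_norm Fhat T); split=> //.
- move=> F' fF' I'; apply: (finsler_indicatrix_unique _ wF fF'); last by rewrite wI.
  move=> p v a kv; rewrite /kernel_bundle /= -[omega p _]/(covector homega p (a *: v)).
  by rewrite linearZ /= [omega p v]kv scaler0.
- rewrite -(wind_norm_cone hFhat homega omT FT) /cone_structure clA.
  exact: (cone_boundary hFhat homega homega0 htransverse).
Qed.
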